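(* The problem $\mathsf{QBSF}$ restricted to formulas in CNF, and likewise $\mathsf{QBSF}$ restricted to formulas in DNF, is $\leq^{\log}_m$-hard for $\mathrm{AEXP}(\mathrm{poly})$.
   Context: Quantified Boolean second-order formulas (qbsfs): the constants $0,1$ are qbsfs; if $f^n$ is a function variable of arity $n \ge 0$ and $\varphi_1,\ldots,\varphi_n$ are qbsfs, then $f^n(\varphi_1,\ldots,\varphi_n)$, $\varphi_1 \land \varphi_2$, $\neg\varphi_1$ and $\exists f^n \varphi_1$ are qbsfs ($\lor,\to,\leftrightarrow,\forall$ are abbreviations). Arity-0 variables are propositions. An interpretation maps function variables $f^n$ to Boolean functions $\{0,1\}^n\to\{0,1\}$; evaluation is as usual, with $\exists f^n\varphi$ true iff $\varphi$ is true for some Boolean function assigned to $f^n$. $\mathsf{QBSF}$ is the set of qbsfs satisfied by the empty interpretation. A qbsf is in prenex form if all quantifiers stand at the beginning; it is simple if every function symbol has only propositional variables as arguments; it is in CNF (DNF) if it is in prenex form, simple, and its quantifier-free matrix is a propositional CNF (DNF) over the atoms $f(x_1,\ldots,x_n)$. A logspace reduction from $A$ to $B$ is a logspace-computable $f$ with $x\in A \iff f(x)\in B$; $B$ is $\leq^{\log}_m$-hard for a class $\mathcal C$ if every $A\in\mathcal C$ reduces to $B$. $\mathrm{AEXP}(\mathrm{poly}) = \bigcup_{t \in 2^{n^{O(1)}},\, p \in n^{O(1)}} \mathrm{ATIME}^{\Sigma}(t,p)$, where $\mathrm{ATIME}^{\Sigma}(t,g)$ is the class of problems decided by an alternating TM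 starting in an existential state in time $O(t(n))$ with at most $g(n)$ alternations (counting the initial configuration as the first). *)

(* Defs.v *)
From Stdlib Require BinNat.
From mathcomp Require Import all_boot.

Set Implicit Arguments. Unset Strict Implicit. Unset Printing Implicit Defensive.

(* A function variable is identified by a pair (name, arity) of naturals.    *)
Inductive qbsf : Type :=
| QConst of bool
| QApp of nat & nat & seq qbsf      (* QApp f n args : f^n(args) *)
| QAnd of qbsf & qbsf
| QNeg of qbsf
| QEx of nat & nat & qbsf.          (* QEx f n phi : exists f^n phi *)

Definition QOr (a b : qbsf) : qbsf := QNeg (QAnd (QNeg a) (QNeg b)).
Definition QForall (f n : nat) (phi : qbsf) : qbsf := QNeg (QEx f n (QNeg phi)).

Fixpoint qwf (phi : qbsf) : bool :=
  match phi with
  | QConst _ => true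
  | QApp _ n args => (size args == n) && all qwf args
  | QAnd a b => qwf a && qwf b
  | QNeg a => qwf a
  | QEx _ _ a => qwf a
  end.

Fixpoint qclosed (bnd : seq (nat * nat)) (phi : qbsf) : bool :=
  match phi with
  | QConst _ => true
  | QApp f n args => ((f, n) \in bnd) && all (qclosed bnd) args
  | QAnd a b => qclosed bnd a && qclosed bnd b
  | QNeg a => qclosed bnd a
  | QEx f n a => qclosed ((f, n) :: bnd) a
  end.

(* Interpretations: (f, n) |-> a function on bit-lists (only used on length n) *)
Definition interp := nat -> nat -> seq bool -> bool.

(* Boolean functions {0,1}^n -> {0,1} are represented by their truth tables
   (lists of length 2^n); every Boolean function has exactly one table. *)
Fixpoint all_tables (m : nat) : seq (seq bool) :=
  match m with
  | 0 => [:: [::]]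
  | m'.+1 => [seq b :: t | b <- [:: false; true], t <- all_tables m']
  end.
Definition bits_val (xs : seq bool) : nat := foldl (fun (acc : nat) (b : bool) => acc.*2 + nat_of_bool b) 0 xs.
Definition table_fun (t : seq bool) : seq bool -> bool :=
  fun xs => nth false t (bits_val xs).

Definition upd (I : interp) (f n : nat) (g : seq bool -> bool) : interp :=
  fun f' n' => if (f' == f) && (n' == n) then g else I f' n'.

Fixpoint qeval (I : interp) (phi : qbsf) : bool :=
  match phi with
  | QConst b => b
  | QApp f n args => I f n (map (qeval I) args)
  | QAnd a b => qeval I a && qeval I b
  | QNeg a => ~~ qeval I a
  | QEx f n a =>
      has (fun t => qeval (upd I f n (table_fun t)) a) (all_tables (2 ^ n))
  end.

(* the "empty" interpretation (irrelevant for closed formulas) *)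
Definition I0 : interp := fun _ _ _ => false.

Definition in_QBSF (phi : qbsf) : bool :=
  [&& qwf phi, qclosed [::] phi & qeval I0 phi].

Definition is_propvar (phi : qbsf) : bool :=
  if phi is QApp _ 0 [::] then true else false.
Definition is_atom (phi : qbsf) : bool :=
  if phi is QApp _ _ args then all is_propvar args else false.

Inductive is_literal : qbsf -> Prop :=
| LitPos a : is_atom a -> is_literal a
| LitNeg a : is_atom a -> is_literal (QNeg a).

Inductive is_clause : qbsf -> Prop :=
| ClLit l : is_literal l -> is_clause l
| ClOr a b : is_clause a -> is_clause b -> is_clause (QOr a b).

Inductive is_cnf_matrix : qbsf -> Prop :=
| CnfCl c : is_clause c -> is_cnf_matrix c
| CnfAnd a b : is_cnf_matrix a -> is_cnf_matrix b -> is_cnf_matrix (QAnd a b).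

Inductive is_term : qbsf -> Prop :=
| TmLit l : is_literal l -> is_term l
| TmAnd a b : is_term a -> is_term b -> is_term (QAnd a b).

Inductive is_dnf_matrix : qbsf -> Prop :=
| DnfTm c : is_term c -> is_dnf_matrix c
| DnfOr a b : is_dnf_matrix a -> is_dnf_matrix b -> is_dnf_matrix (QOr a b).

Inductive prenex (P : qbsf -> Prop) : qbsf -> Prop :=
| PMat phi : P phi -> prenex P phi
| PEx f n phi : prenex P phi -> prenex P (QEx f n phi)
| PAll f n phi : prenex P phi -> prenex P (QForall f n phi).

Definition is_CNF (phi : qbsf) : Prop := prenex is_cnf_matrix phi.
Definition is_DNF (phi : qbsf) : Prop := prenex is_dnf_matrix phi.

Fixpoint pos_bits (p : BinNums.positive) : seq bool :=
  match p with
  | BinNums.xH => [:: true]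
  | BinNums.xO q => rcons (pos_bits q) false
  | BinNums.xI q => rcons (pos_bits q) true
  end.
Definition nat_bits (n : nat) : seq bool :=
  match BinNat.N.of_nat n with BinNums.N0 => [::] | BinNums.Npos p => pos_bits p end.
(* self-delimiting: each bit b as [1;b], terminated by [0] *)
Definition enc_nat (n : nat) : seq bool :=
  rcons (flatten [seq [:: true; b] | b <- nat_bits n]) false.

Fixpoint enc (phi : qbsf) : seq bool :=
  match phi with
  | QConst b => [:: false; false; b]
  | QApp f n args => [:: false; true; false] ++ enc_nat f ++ enc_nat n
                       ++ flatten (map enc args)
  | QAnd a b => [:: false; true; true] ++ enc a ++ enc b
  | QNeg a => [:: true; false; false] ++ enc a
  | QEx f n a => [:: true; false; true] ++ enc_nat f ++ enc_nat n ++ enc a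
  end.

Definition language := seq bool -> Prop.

Definition QBSF_CNF : language :=
  fun w => exists phi, enc phi = w /\ is_CNF phi /\ in_QBSF phi.
Definition QBSF_DNF : language :=
  fun w => exists phi, enc phi = w /\ is_DNF phi /\ in_QBSF phi.

(* Alternating Turing machines (single tape, one-way infinite)              *)
Inductive dir := DL | DS | DR.
Inductive skind := KEx | KUn | KAcc | KRej.
Definition skind_eqb (a b : skind) : bool :=
  match a, b with
  | KEx, KEx | KUn, KUn | KAcc, KAcc | KRej, KRej => true | _, _ => false end.

Record ATM := {
  aSt : finType;
  aSym : finType;
  ablank : aSym;
  ainput : bool -> aSym;
  astart : aSt;
  akind : aSt -> skind;
  adelta : aSt -> aSym -> seq (aSt * aSym * dir) }.

(* configuration: state, visited tape cells, head position (< size tape) *)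
Definition aconf (M : ATM) : Type := (aSt M * seq (aSym M) * nat)%type.

Definition tape_move {S : Type} (blank : S) (tp : seq S) (pos : nat) (a : S) (d : dir)
  : seq S * nat :=
  let tp1 := set_nth blank tp pos a in
  let pos' := match d with DL => pos.-1 | DS => pos | DR => pos.+1 end in
  (if size tp1 <= pos' then rcons tp1 blank else tp1, pos').

Definition asuccs (M : ATM) (c : aconf M) : seq (aconf M) :=
  let: (q, tp, pos) := c in
  [seq let: (q', a, d) := tr in let: (tp', pos') := tape_move (ablank M) tp pos a d in
       (q', tp', pos') | tr <- adelta q (nth (ablank M) tp pos)].

Definition ainit (M : ATM) (w : seq bool) : aconf M :=
  (astart M, (if w is [::] then [:: ablank M] else map (ainput M) w), 0).

Definition akind_of (M : ATM) (c : aconf M) : skind := @akind M c.1.1.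

Definition is_halting (k : skind) : bool :=
  match k with KAcc | KRej => true | _ => false end.

Fixpoint halts_within (M : ATM) (d : nat) (c : aconf M) : Prop :=
  if is_halting (akind_of c) then True else
  match d with
  | 0 => False
  | d'.+1 => forall c', c' \in asuccs c -> halts_within d' c'
  end.

(* acceptance (evaluated with fuel d, meaningful when halts_within d holds) *)
Fixpoint accepts_in (M : ATM) (d : nat) (c : aconf M) : Prop :=
  match akind_of c with
  | KAcc => True
  | KRej => False
  | KEx => match d with 0 => False
           | d'.+1 => exists2 c', c' \in asuccs c & accepts_in d' c' end
  | KUn => match d with 0 => True
           | d'.+1 => forall c', c' \in asuccs c -> accepts_in d' c' end
  end.

(* along every path of length <= d from c, the number of maximal blocks of
   existential/universal configurations (the current one counted) is <= r,
   given that the previous block was of kind prev (None = no block yet). *)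
Fixpoint alt_ok (M : ATM) (d : nat) (r : nat) (prev : option skind) (c : aconf M) : Prop :=
  let k := akind_of c in
  if is_halting k then True else
  let same := if prev is Some p then skind_eqb p k else false in
  (same || (0 < r)) /\
  match d with
  | 0 => True
  | d'.+1 => forall c', c' \in asuccs c ->
               alt_ok d' (if same then r else r.-1) (Some k) c'
  end.

(* ATIME^Sigma(t, g): decided by an ATM starting in an existential state, in
   time O(t(n)), with at most g(n) alternations (initial configuration counted). *)
Definition ATIME_Sigma (t g : nat -> nat) (L : language) : Prop :=
  exists M : ATM, @akind M (astart M) = KEx /\
  exists C : nat, forall w : seq bool,
    let d := C * t (size w) + C in
    [/\ halts_within d (ainit M w),
        alt_ok d (g (size w)) None (ainit M w) &
        (L w <-> accepts_in d (ainit M w))].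

Definition exp_poly_bounded (t : nat -> nat) : Prop :=
  exists k, forall n, t n <= 2 ^ (k * n ^ k + k).
Definition poly_bounded (p : nat -> nat) : Prop :=
  exists k, forall n, p n <= k * n ^ k + k.

Definition AEXP_poly (L : language) : Prop :=
  exists t p, exp_poly_bounded t /\ poly_bounded p /\ ATIME_Sigma t p L.

(* Logspace transducers: read-only two-way input tape with endmarkers,      *)
(* one work tape, write-only one-way output.                                *)
Record LTM := {
  lSt : finType;
  lSym : finType;
  lblank : lSym;
  lstart : lSt;
  lhalt : lSt -> bool;
  (* state, input symbol (None = endmarker), work symbol |->
     new state, written work symbol, input move, work move, output bit *)
  ltrans : lSt -> option bool -> lSym -> lSt * lSym * dir * dir * option bool }.

(* state, input head (0 = left endmarker, 1..n input, n+1 right endmarker),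
   visited work cells, work head, output so far *)
Definition lconf (M : LTM) : Type := (lSt M * nat * seq (lSym M) * nat * seq bool)%type.

Definition lread (x : seq bool) (i : nat) : option bool :=
  if (0 < i) && (i <= size x) then Some (nth false x i.-1) else None.

Definition lstep (M : LTM) (x : seq bool) (c : lconf M) : lconf M :=
  let: (q, i, wt, wp, out) := c in
  if @lhalt M q then c else
  let: (q', a, di, dw, o) := ltrans q (lread x i) (nth (lblank M) wt wp) in
  let i' := match di with DL => i.-1 | DS => i | DR => minn i.+1 (size x).+1 end in
  let: (wt', wp') := tape_move (lblank M) wt wp a dw in
  (q', i', wt', wp', if o is Some b then rcons out b else out).

Definition linit (M : LTM) : lconf M := (lstart M, 0, [:: lblank M], 0, [::]).

Definition work_size (M : LTM) (c : lconf M) : nat := size c.1.1.2.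

Definition logspace_computable (f : seq bool -> seq bool) : Prop :=
  exists M : LTM, exists C : nat, forall x : seq bool,
    exists s : nat,
      let cs := iter s (lstep x) (linit M) in
      [/\ @lhalt M cs.1.1.1.1, cs.2 = f x &
          forall i, i <= s -> work_size (iter i (lstep x) (linit M))
                               <= C * Nat.log2 (size x) + C].

Definition logspace_reduces (A B : language) : Prop :=
  exists f, logspace_computable f /\ forall x, A x <-> B (f x).

Definition logspace_hard_for (C : language -> Prop) (B : language) : Prop :=
  forall A, C A -> logspace_reduces A B.

(* Main.v *)
(** Let an alternating machine run in time below 2^m with m polynomial. A player
    only has to fix which transition is taken at each time of a block, that is,
    Boolean functions of m arguments (the binary time); so the alternation of the
    blocks becomes the quantifier prefix over these choice functions, every choice
    is legal, and the run is determined. The run itself is then guessed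
    existentially by functions "cell p holds a at time t" and "in block k the
    head is at p in state q at time t". All constraints are Horn clauses forcing
    the facts of the true run, together with clauses excluding rejecting
    configurations, so the matrix is in CNF without any auxiliary variables.
    Successors of binary vectors are expressed by substitution: u01..1 is followed
    by u10..0, with one clause per position of the carry; and the cell at p' is
    away from the head at p when p and p' are distinguished at some bit.
    For DNF, the formula of the machine with the two players exchanged is dualized.

    The formula is written as a nest of for-loops over polynomially bounded
    counters printing bits. A logspace transducer runs such a program by keeping
    the counters in binary on parallel tracks of its work tape. *)

Require Import Defs.
From Stdlib Require Import Classical FunctionalExtensionality.
From mathcomp Require Import all_boot zify.

Set Implicit Arguments. Unset Strict Implicit. Unset Printing Implicit Defensive.

(** * Composable fragments of logspace transducers *)

(** Nothing in the matrix bounds the guessed tableau from above: there are no clauses saying that a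
    cell holds one symbol or that the head is in one place. The clauses only force the facts of the
    true run into every model, so a rejecting run contradicts an exclusion clause; conversely, if
    the run accepts, its own facts, frozen after the verdict, form a model. Soundness and
    completeness are therefore asymmetric: the former follows one run through an arbitrary model,
    the latter checks one explicit model. Atoms admit only propositional variables as arguments, so
    the constants in substituted vectors have to be two propositions whose values are forced by the
    matrix. A choice among several transitions is coded by Boolean functions of which the first true
    one counts; this makes all values legal without constraints on what either player picks. The
    machine with exchanged players starts universally, while the prefix starts existentially; its
    run is numbered from block 1, and the functions of block 0 remain unread. *)

Section Fragments.
Variables (Sym : finType) (blank : Sym).

Definition action : Type := (Sym * dir * dir * option bool)%type.

(** The work tape is a zipper: [zleft] lists the cells left of the head, nearest first, and [zright]
    the visited cells to its right. Moves then compute by constructors, and the visited space is the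
    length of the zipper. *)
Record zmem := ZMem {
  zin : nat; zleft : seq Sym; zcur : Sym; zright : seq Sym; zout : seq bool }.

Definition zsize (m : zmem) : nat := (size (zleft m) + size (zright m)).+1.

Definition in_move (x : seq bool) (d : dir) (i : nat) : nat :=
  match d with DL => i.-1 | DS => i | DR => minn i.+1 (size x).+1 end.

Definition out_bit (o : option bool) (s : seq bool) : seq bool :=
  if o is Some b then rcons s b else s.

Definition zact (x : seq bool) (m : zmem) (ac : action) : zmem :=
  let: (a, di, dw, o) := ac in
  let i := in_move x di (zin m) in
  let s := out_bit o (zout m) in
  match dw with
  | DS => ZMem i (zleft m) a (zright m) s
  | DR => ZMem i (a :: zleft m) (head blank (zright m)) (behead (zright m)) s
  | DL => if zleft m is b :: l then ZMem i l b (a :: zright m) s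
          else ZMem i [::] a (zright m) s
  end.

(** The last transition yields a Boolean besides its action, so the same structure serves as command
    and as test. *)
Record frag := Frag {
  fstate : finType;
  fentry : fstate;
  ftrans : fstate -> option bool -> Sym -> (fstate + bool) * action }.

(** A derivation is finite, hence witnesses termination, and it carries the space bound [B] at every
    configuration, including the one reached by the exit. *)
Inductive run (F : frag) (x : seq bool) (B : nat) :
    fstate F -> zmem -> bool -> zmem -> Prop :=
| RunExit q m e ac :
    ftrans q (lread x (zin m)) (zcur m) = (inr e, ac) ->
    zsize m <= B -> zsize (zact x m ac) <= B -> run x B q m e (zact x m ac)
| RunStep q m q' ac e m' :
    ftrans q (lread x (zin m)) (zcur m) = (inl q', ac) ->
    zsize m <= B -> run x B q' (zact x m ac) e m' -> run x B q m e m'.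

Definition exec (F : frag) x B m e m' := run x B (fentry F) m e m'.

Definition fstep (h : option bool -> Sym -> bool * action) : frag :=
  @Frag unit tt (fun _ i a => (inr (h i a).1, (h i a).2)).

Definition fseq (F G : frag) : frag :=
  @Frag (fstate F + fstate G)%type (inl (fentry F)) (fun q i a =>
    match q with
    | inl q => let: (n, ac) := ftrans q i a in
        (inl (if n is inl q' then inl q' else inr (fentry G)), ac)
    | inr q => let: (n, ac) := ftrans q i a in
        (match n with inl q' => inl (inr q') | inr e => inr e end, ac)
    end).

Definition fif (T F G : frag) : frag :=
  @Frag (fstate T + (fstate F + fstate G))%type (inl (fentry T)) (fun q i a =>
    match q with
    | inl q => let: (n, ac) := ftrans q i a in
        (inl (match n with
              | inl q' => inl q'
              | inr true => inr (inl (fentry F))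
              | inr false => inr (inr (fentry G)) end), ac)
    | inr (inl q) => let: (n, ac) := ftrans q i a in
        (match n with inl q' => inl (inr (inl q')) | inr e => inr e end, ac)
    | inr (inr q) => let: (n, ac) := ftrans q i a in
        (match n with inl q' => inl (inr (inr q')) | inr e => inr e end, ac)
    end).

Definition fwhile (T F : frag) : frag :=
  @Frag (fstate T + fstate F)%type (inl (fentry T)) (fun q i a =>
    match q with
    | inl q => let: (n, ac) := ftrans q i a in
        (match n with
         | inl q' => inl (inl q')
         | inr true => inl (inr (fentry F))
         | inr false => inr true end, ac)
    | inr q => let: (n, ac) := ftrans q i a in
        (inl (if n is inl q' then inr q' else inl (fentry T)), ac)
    end).

Variables (x : seq bool) (B : nat).

Lemma exec_step h m : let: (e, ac) := h (lread x (zin m)) (zcur m) in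
  zsize m <= B -> zsize (zact x m ac) <= B -> exec (fstep h) x B m e (zact x m ac).
Proof.
case E: (h _ _) => [e ac] s1 s2.
by apply: RunExit => //=; rewrite E.
Qed.

Lemma exec_seq F G m1 e m2 e' m3 :
  exec F x B m1 e m2 -> exec G x B m2 e' m3 -> exec (fseq F G) x B m1 e' m3.
Proof.
move=> rF rG; rewrite /exec /=.
elim: rF rG => {m1 e m2} [q m e ac Eq s1 s2|q m q' ac e m' Eq s1 _ IH] rG.
  apply: (@RunStep (fseq F G) _ _ _ _ (inr (fentry G)) ac) => //=; first by rewrite Eq.
  move: rG; rewrite /exec; elim => {Eq s1 s2 m e ac q e' m3} [q m e ac' Eq s1 s2|q m q' ac' e m' Eq s1 _ IH].
    by apply: RunExit => //=; rewrite Eq.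
  by apply: (@RunStep (fseq F G) _ _ _ _ (inr q') ac') => //=; rewrite Eq.
by apply: (@RunStep (fseq F G) _ _ _ _ (inl q') ac) => //=; [rewrite Eq | exact: IH].
Qed.

Lemma exec_if T F G m1 e m2 e' m3 :
  exec T x B m1 e m2 -> exec (if e then F else G) x B m2 e' m3 ->
  exec (fif T F G) x B m1 e' m3.
Proof.
move=> rT; rewrite /exec /=.
elim: rT => {m1 e m2} [q m e ac Eq s1 s2|q m q' ac e m' Eq s1 _ IH] rG.
  case: e rG Eq => rG Eq.
  - apply: (@RunStep (fif T F G) _ _ _ _ (inr (inl (fentry F))) ac) => //=; first by rewrite Eq.
    elim: rG => {Eq s1 s2 m ac q e' m3} [q m e ac' Eq s1 s2|q m q' ac' e m' Eq s1 _ IH].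
      by apply: RunExit => //=; rewrite Eq.
    by apply: (@RunStep (fif T F G) _ _ _ _ (inr (inl q')) ac') => //=; rewrite Eq.
  - apply: (@RunStep (fif T F G) _ _ _ _ (inr (inr (fentry G))) ac) => //=; first by rewrite Eq.
    elim: rG => {Eq s1 s2 m ac q e' m3} [q m e ac' Eq s1 s2|q m q' ac' e m' Eq s1 _ IH].
      by apply: RunExit => //=; rewrite Eq.
    by apply: (@RunStep (fif T F G) _ _ _ _ (inr (inr q')) ac') => //=; rewrite Eq.
by apply: (@RunStep (fif T F G) _ _ _ _ (inl q') ac) => //=; [rewrite Eq | exact: IH].
Qed.

Lemma exec_while_stop T F m1 m2 :
  exec T x B m1 false m2 -> exec (fwhile T F) x B m1 true m2.
Proof.
rewrite /exec /=; move Ee: false => e rT.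
elim: rT Ee => {m1 e m2} [q m e ac Eq s1 s2|q m q' ac e m' Eq s1 _ IH] Ee.
  by apply: RunExit => //=; rewrite Eq -Ee.
by apply: (@RunStep (fwhile T F) _ _ _ _ (inl q') ac) => //=; [rewrite Eq | exact: IH].
Qed.

Lemma exec_while_loop T F m1 m2 e m3 m4 :
  exec T x B m1 true m2 -> exec F x B m2 e m3 -> exec (fwhile T F) x B m3 true m4 ->
  exec (fwhile T F) x B m1 true m4.
Proof.
move=> rT rF rW; rewrite /exec /=.
(* The index [true] becomes a variable with an equation, so that induction on the run retains it. *)
have [e0 Ee] : exists e0, true = e0 by exists true.
move: rT; rewrite {1}/exec {1}Ee => rT.
elim: rT Ee rF => {m1 e0 m2} [q m e0 ac Eq s1 s2|q m q' ac e0 m' Eq s1 _ IH] Ee rF.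
  apply: (@RunStep (fwhile T F) _ _ _ _ (inr (fentry F)) ac) => //=; first by rewrite Eq -Ee.
  elim: rF rW => {Eq s1 s2 m ac q m3} [q m e1 ac' Eq s1 s2|q m q' ac' e1 m' Eq s1 _ IH] rW.
    by apply: (@RunStep (fwhile T F) _ _ _ _ (inl (fentry T)) ac') => //=; rewrite Eq.
  by apply: (@RunStep (fwhile T F) _ _ _ _ (inr q') ac') => //=; [rewrite Eq | exact: IH].
by apply: (@RunStep (fwhile T F) _ _ _ _ (inl q') ac) => //=; [rewrite Eq | exact: IH].
Qed.

Definition ltm_of (F : frag) : LTM :=
  @Build_LTM (fstate F + bool)%type Sym blank (inl (fentry F))
    (fun q => if q is inr _ then true else false)
    (fun q i a => match q with
       | inl q => let: (n, (a', di, dw, o)) := ftrans q i a in (n, a', di, dw, o)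
       | inr e => (inr e, a, DS, DS, None) end).

Definition zconf (F : frag) (q : fstate F + bool) (m : zmem) : lconf (ltm_of F) :=
  (q, zin m, rev (zleft m) ++ zcur m :: zright m, size (zleft m), zout m).

Lemma work_size_zconf F q m : work_size (@zconf F q m) = zsize m.
Proof. by rewrite /work_size /= size_cat size_rev /= addnS. Qed.

Lemma set_nth_mid (l : seq Sym) a r b :
  set_nth blank (rev l ++ a :: r) (size l) b = rev l ++ b :: r.
Proof.
rewrite set_nthE size_cat size_rev /= addnS ltnS leq_addr.
rewrite take_size_cat ?size_rev // drop_cat size_rev ltnNge leqnSn /=.
by rewrite subSn // subnn /= drop0.
Qed.

Lemma lstep_zconf F q m n ac :
  ftrans q (lread x (zin m)) (zcur m) = (n, ac) ->
  lstep x (@zconf F (inl q) m) = zconf n (zact x m ac).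
Proof.
case: ac => [[[a di] dw] o] Eq; case: m Eq => i l c r s /= Eq.
rewrite nth_cat size_rev ltnn subnn /= Eq /tape_move set_nth_mid.
rewrite size_cat size_rev /= addnS.
case: dw Eq => Eq /=.
- case: l Eq => [|b l] Eq /=; first by [].
  rewrite ifF; last by lia.
  by rewrite /zconf /= rev_cons cat_rcons.
- by rewrite ltnNge leq_addr.
- case: r Eq => [|b r] Eq /=.
    rewrite addn0 ltnS leqnn /zconf /= rev_cons -cats1 -catA /=.
    by rewrite -cats1 -catA.
  rewrite ltnS addnS ltnNge leq_addr /= /zconf /=.
  by rewrite rev_cons cat_rcons.
Qed.

Lemma run_lstep F q m e m' : @run F x B q m e m' ->
  exists s, iter s (lstep x) (zconf (inl q) m) = zconf (inr e) m' /\
    forall i, i <= s -> work_size (iter i (lstep x) (@zconf F (inl q) m)) <= B.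
Proof.
elim => {q m e m'} [q m e ac Eq s1 s2|q m q' ac e m' Eq s1 _ [s [Es Hs]]].
  exists 1; split; first exact: lstep_zconf.
  by case=> [|[|i]] // _; rewrite ?[iter _ _ _](lstep_zconf Eq) work_size_zconf.
exists s.+1; split; first by rewrite iterSr (lstep_zconf Eq).
case=> [|i] Hi; first by rewrite work_size_zconf.
by rewrite iterSr (lstep_zconf Eq) Hs.
Qed.

End Fragments.
Arguments exec {Sym} blank F x B m e m'.

(** * Binary counters on the work tape *)

Section Counters.
Variable Reg : finType.

(** One tape column carries one bit of every register, least significant column first, so all
    counters share the same cells. The cell [cmark] at the left end stops leftward scans. *)
Definition row : Type := {ffun Reg -> bool}.
Definition cell : finType := option (option row).
Definition cblank : cell := None.
Definition cmark : cell := Some None.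
Definition crow (f : row) : cell := Some (Some f).

Definition set_bit (r : Reg) (b : bool) (f : row) : row :=
  [ffun r' => if r' == r then b else f r'].
(** Blanks count as columns of zeros: reading one gives [false], and writing to one creates a column
    whose other bits are zero. *)
Definition get_bit (r : Reg) (a : cell) : bool :=
  if a is Some (Some f) then f r else false.
Definition put_bit (r : Reg) (b : bool) (a : cell) : cell :=
  crow (set_bit r b (if a is Some (Some f) then f else [ffun=> false])).

Definition rval (r : Reg) (rows : seq row) : nat :=
  foldr (fun (f : row) v => nat_of_bool (f r) + v.*2) 0 rows.

Definition fmove (d : dir) : frag cell := fstep (fun _ a => (true, (a, DS, d, None))).
Definition fin_move (d : dir) : frag cell := fstep (fun _ a => (true, (a, d, DS, None))).
Definition ftest (p : cell -> bool) : frag cell :=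
  fstep (fun _ a => (p a, (a, DS, DS, None))).
Definition fin_test (p : option bool -> bool) : frag cell :=
  fstep (fun i a => (p i, (a, DS, DS, None))).
Definition femit1 (b : bool) : frag cell :=
  fstep (fun _ a => (true, (a, DS, DS, Some b))).
Definition freturn (b : bool) : frag cell :=
  fstep (fun _ a => (b, (a, DS, DS, None))).
Definition fput (r : Reg) (b : bool) (d : dir) : frag cell :=
  fstep (fun _ a => (true, (put_bit r b a, DS, d, None))).

Definition frewind : frag cell := fwhile (ftest (predC1 cmark)) (fmove DL).

(** The carry stops at the first zero or at a blank; in the latter case all counters gain a
    column. *)
Definition finc (r : Reg) : frag cell :=
  fseq (fmove DR) (fseq (fwhile (ftest (get_bit r)) (fput r false DR))
    (fseq (fput r true DS) frewind)).

Definition fclear (r : Reg) : frag cell :=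
  fseq (fmove DR) (fseq (fwhile (ftest (predC1 cblank)) (fput r false DR)) frewind).

(* Scanning from the least significant bit, the last position at which the two
   counters differ decides the comparison; the state is the verdict so far. *)
Definition fscan_lt (r s : Reg) : frag cell :=
  @Frag cell bool false (fun (b : bool) _ (a : cell) =>
    if a is Some (Some f) then
      (inl (if f r == f s then b else f s : bool), (a, DS, DR, None))
    else (inr b, (a, DS, DS, None))).

(** [frewind] always exits with [true], so the verdict of the scan is kept in the control state, by
    one copy of the rewind for each outcome. *)
Definition flt (r s : Reg) : frag cell :=
  fseq (fmove DR) (fif (fscan_lt r s)
    (fseq frewind (freturn true)) (fseq frewind (freturn false))).

Definition femit_bit (r : Reg) : frag cell :=
  fstep (fun _ a => (true, (a, DS, DL, Some (get_bit r a)))).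

(** The encoding starts with the most significant bit: the head goes to the far end, returns over
    the leading zeros, and prints the remaining bits down to the mark. *)
Definition fnat (r : Reg) : frag cell :=
  fseq (fmove DR) (fseq (fwhile (ftest (predC1 cblank)) (fmove DR))
  (fseq (fmove DL) (fseq
    (fwhile (ftest (fun a => (a != cmark) && ~~ get_bit r a)) (fmove DL))
  (fseq (fwhile (ftest (predC1 cmark)) (fseq (femit1 true) (femit_bit r)))
    (femit1 false))))).

Variables (x : seq bool) (L : nat).

Notation Z := (@ZMem cell).
Notation ex F m e m' := (@exec cell cblank F x L.+2 m e m').

(** A scan to the right end may leave one visited blank behind, hence [j]. Together with the mark
    and at most [L] columns this makes [L.+2] cells. Leading zero columns are allowed, because
    clearing a counter does not shrink the tape. *)
Definition rep (v : Reg -> nat) (i : nat) (o : seq bool) (m : zmem cell) : Prop :=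
  exists rows j, [/\ m = Z i [::] cmark (map crow rows ++ nseq j cblank) o,
    j <= 1, size rows <= L & forall r, v r = rval r rows].

Definition tri (F : frag cell) v i o e v' i' o' : Prop :=
  forall m, rep v i o m -> exists2 m', ex F m e m' & rep v' i' o' m'.

Lemma rep_ext v v' i o m : v =1 v' -> rep v i o m -> rep v' i o m.
Proof. by move=> E [rows [j [-> Hj HL Hv]]]; exists rows, j; split=> // r; rewrite -E. Qed.

Lemma tri_ext F v v' i o e w w' i' o' :
  v =1 v' -> w =1 w' -> tri F v i o e w i' o' -> tri F v' i o e w' i' o'.
Proof.
move=> E E' H m Hm; have [m' Hm' Hr] := H m (rep_ext (fsym E) Hm).
by exists m' => //; exact: rep_ext Hr.
Qed.

Lemma tri_seq F G v1 i1 o1 e v2 i2 o2 e' v3 i3 o3 :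
  tri F v1 i1 o1 e v2 i2 o2 -> tri G v2 i2 o2 e' v3 i3 o3 ->
  tri (fseq F G) v1 i1 o1 e' v3 i3 o3.
Proof.
move=> HF HG m /HF[m2 E2 /HG[m3 E3 H3]]; exists m3 => //.
exact: exec_seq E2 E3.
Qed.

Lemma tri_if T F G v1 i1 o1 e v2 i2 o2 e' v3 i3 o3 :
  tri T v1 i1 o1 e v2 i2 o2 -> tri (if e then F else G) v2 i2 o2 e' v3 i3 o3 ->
  tri (fif T F G) v1 i1 o1 e' v3 i3 o3.
Proof.
move=> HF HG m /HF[m2 E2 /HG[m3 E3 H3]]; exists m3 => //.
exact: exec_if E2 E3.
Qed.

Lemma tri_while_stop T F v i o v' i' o' :
  tri T v i o false v' i' o' -> tri (fwhile T F) v i o true v' i' o'.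
Proof. by move=> H m /H[m' E H']; exists m' => //; apply: exec_while_stop. Qed.

Lemma tri_while_loop T F v1 i1 o1 v2 i2 o2 e v3 i3 o3 v4 i4 o4 :
  tri T v1 i1 o1 true v2 i2 o2 -> tri F v2 i2 o2 e v3 i3 o3 ->
  tri (fwhile T F) v3 i3 o3 true v4 i4 o4 -> tri (fwhile T F) v1 i1 o1 true v4 i4 o4.
Proof.
move=> HT HF HW m /HT[m2 E2 /HF[m3 E3 /HW[m4 E4 H4]]]; exists m4 => //.
exact: exec_while_loop E2 E3 E4.
Qed.

Lemma exec_fstep h m e ac m' :
  h (lread x (zin m)) (zcur m) = (e, ac) -> zact cblank x m ac = m' ->
  zsize m <= L.+2 -> zsize m' <= L.+2 -> ex (fstep h) m e m'.
Proof.
move=> E <- s1 s2; have := @exec_step _ cblank x L.+2 h m; rewrite E; exact.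
Qed.

Lemma rep_size v i o m : rep v i o m -> zsize m <= L.+2.
Proof.
move=> [rows [j [-> Hj HL _]]]; rewrite /zsize /= size_cat size_map size_nseq; lia.
Qed.

Lemma exec_frewind i ls a r o :
  size ls + size r <= L -> (a == cmark) = false -> all (predC1 cmark) ls ->
  ex frewind (Z i (rcons ls cmark) a r o) true (Z i [::] cmark (rev ls ++ a :: r) o).
Proof.
elim: ls a r => [|b ls IH] a r Hs Ha /=.
  move=> _; apply: (@exec_while_loop _ _ x _ _ _ _ (Z i [:: cmark] a r o) true (Z i [::] cmark (a :: r) o)).
  - by apply: exec_fstep => //=; rewrite ?Ha //= /zsize /=; lia.
  - by apply: exec_fstep => //=; rewrite /zsize /=; lia.
  apply: exec_while_stop; apply: exec_fstep => //=; rewrite /zsize /=; lia.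
move=> /andP[/negbTE Hb Hls].
apply: (@exec_while_loop _ _ x _ _ _ _ (Z i (b :: rcons ls cmark) a r o) true (Z i (rcons ls cmark) b (a :: r) o)).
- by apply: exec_fstep => //=; rewrite ?Ha //= /zsize /= size_rcons; move: Hs => /=; lia.
- by apply: exec_fstep => //=; rewrite /zsize /= size_rcons; move: Hs => /=; lia.
rewrite rev_cons cat_rcons; apply: IH => //; move: Hs => /=; lia.
Qed.

Lemma all_crow rows : all (predC1 cmark) (map crow rows).
Proof. by elim: rows. Qed.

(** The default [cblank] covers a head that has just moved past the visited cells and thereby
    created a blank. *)
Definition cursor i o (ls tl : seq cell) : zmem cell :=
  Z i (rcons ls cmark) (head cblank tl) (behead tl) o.

Lemma cursor_size i o ls tl : size ls + size tl <= L.+1 -> size ls <= L ->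
  zsize (cursor i o ls tl) <= L.+2.
Proof. rewrite /zsize /= size_rcons size_behead; lia. Qed.

Lemma exec_enter v i o m : rep v i o m -> exists rows j,
  [/\ j <= 1, size rows <= L, forall r, v r = rval r rows &
    ex (fmove DR) m true (cursor i o [::] (map crow rows ++ nseq j cblank))].
Proof.
move=> Hm; have := rep_size Hm; move: Hm => [rows [j [-> Hj HL Hv]]] Hs.
exists rows, j; split=> //; apply: exec_fstep => //=.
by apply: cursor_size; rewrite // size_cat size_map size_nseq; lia.
Qed.

Lemma exec_leave v i o rows rest j : j <= 1 -> size rows + size rest <= L ->
  (forall r, v r = rval r (rev rows ++ rest)) ->
  exists2 m', ex frewind (cursor i o (map crow rows) (map crow rest ++ nseq j cblank)) true m'
    & rep v i o m'.
Proof.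
move=> Hj HL Hv; have Hm := all_crow rows.
exists (Z i [::] cmark (rev (map crow rows) ++ head cblank (map crow rest ++ nseq j cblank) ::
   behead (map crow rest ++ nseq j cblank)) o).
  apply: exec_frewind => //; last by case: rest {HL Hv} => //; case: j {Hj}.
  by rewrite size_behead size_cat !size_map size_nseq; lia.
case: rest HL Hv => [|f rest] HL Hv.
  (* The head stands on a blank past the columns; it becomes the trailing blank, whatever [j]
     was. *)
  exists (rev rows), 1; split=> //; last by move=> r; rewrite Hv cats0.
    by congr ZMem; rewrite map_rev; case: j Hj => [|[]].
  by rewrite size_rev; move: HL => /=; lia.
exists (rev rows ++ f :: rest), j; split=> //.
  by congr ZMem; rewrite map_cat map_rev /= -catA.
by rewrite size_cat size_rev.
Qed.

Lemma rval_cat r s t : rval r (s ++ t) = rval r s + 2 ^ size s * rval r t.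
Proof.
elim: s => [|f s IH] /=; first by rewrite mul1n.
by rewrite IH expnS -mulnA; lia.
Qed.

Lemma exec_fput_R i o r b rows f rest j :
  size rows + size rest < L -> j <= 1 ->
  ex (fput r b DR) (cursor i o (map crow rows) (map crow (f :: rest) ++ nseq j cblank))
    true (cursor i o (map crow (set_bit r b f :: rows)) (map crow rest ++ nseq j cblank)).
Proof.
by move=> HL Hj; apply: exec_fstep => //; apply: cursor_size => /=;
  rewrite ?size_cat ?size_map ?size_nseq; lia.
Qed.

Lemma exec_fmove_R i o rows f rest j :
  size rows + size rest < L -> j <= 1 ->
  ex (fmove DR) (cursor i o (map crow rows) (map crow (f :: rest) ++ nseq j cblank))
    true (cursor i o (map crow (f :: rows)) (map crow rest ++ nseq j cblank)).
Proof.
by move=> HL Hj; apply: exec_fstep => //; apply: cursor_size => /=;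
  rewrite ?size_cat ?size_map ?size_nseq; lia.
Qed.

Lemma exec_ftest i o (p : cell -> bool) rows rest j b :
  size rows + size rest <= L -> j <= 1 ->
  p (head cblank (map crow rest ++ nseq j cblank)) = b ->
  ex (ftest p) (cursor i o (map crow rows) (map crow rest ++ nseq j cblank)) b
    (cursor i o (map crow rows) (map crow rest ++ nseq j cblank)).
Proof.
by move=> HL Hj Hb; apply: exec_fstep; rewrite /= ?Hb //; apply: cursor_size;
  rewrite ?size_cat ?size_map ?size_nseq; lia.
Qed.

Lemma head_blank j : head cblank (nseq j cblank : seq cell) = cblank.
Proof. by case: j. Qed.

Lemma exec_put_while i o r p ones rest rows j :
  size rows + size ones + size rest <= L -> j <= 1 ->
  all (fun f => p (crow f)) ones -> p (head cblank (map crow rest ++ nseq j cblank)) = false ->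
  ex (fwhile (ftest p) (fput r false DR))
    (cursor i o (map crow rows) (map crow (ones ++ rest) ++ nseq j cblank)) true
    (cursor i o (map crow (rev (map (set_bit r false) ones) ++ rows))
       (map crow rest ++ nseq j cblank)).
Proof.
elim: ones rows => [|f ones IH] rows /= HL Hj.
  move=> _ Hp; apply: exec_while_stop; apply: exec_ftest => //; lia.
move=> /andP[pf Hall] Hp.
have Hsz: size rows + size (f :: ones ++ rest) <= L by rewrite /= size_cat; lia.
apply: exec_while_loop.
- exact: (@exec_ftest i o p rows (f :: ones ++ rest) j true Hsz).
- by apply: exec_fput_R => //; rewrite size_cat; lia.
rewrite rev_cons cat_rcons; apply: IH => //=; lia.
Qed.

Definition upd_reg (v : Reg -> nat) r n : Reg -> nat :=
  fun r' => if r' == r then n else v r'.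

Lemma rval_map_set r b r' rows : r' != r ->
  rval r' (map (set_bit r b) rows) = rval r' rows.
Proof. by move=> /negbTE H; elim: rows => //= f s ->; rewrite ffunE H. Qed.

Lemma rval_map_clear r rows : rval r (map (set_bit r false) rows) = 0.
Proof. by elim: rows => //= f s ->; rewrite ffunE eqxx. Qed.

Lemma rval_ones r rows : all (fun f : row => f r) rows -> (rval r rows).+1 = 2 ^ size rows.
Proof. by elim: rows => //= f s IH /andP[-> /IH]; rewrite expnS; lia. Qed.

Lemma tri_fclear v i o r : tri (fclear r) v i o true (upd_reg v r 0) i o.
Proof.
move=> m /exec_enter[rows [j [Hj HL Hv E1]]].
have [m' E2 Hm'] : exists2 m', ex frewind (cursor i o
    (map crow (rev (map (set_bit r false) rows))) (map crow [::] ++ nseq j cblank)) true m'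
    & rep (upd_reg v r 0) i o m'.
  apply: exec_leave => //; first by rewrite size_rev size_map addn0.
  move=> r'; rewrite revK cats0 /upd_reg; case: eqP => [->|/eqP ne].
    by rewrite rval_map_clear.
  by rewrite rval_map_set.
exists m' => //; apply: exec_seq E1 _; apply: exec_seq E2.
rewrite -[rev _]cats0 -{1}[rows]cats0.
apply: (@exec_put_while i o r _ rows [::] [::]) => //=; first by rewrite addn0.
  by apply/allP.
by rewrite head_blank.
Qed.

Lemma split_ones r (rows : seq row) : exists ones rest, [/\ rows = ones ++ rest,
  all (fun f : row => f r) ones & if rest is f :: _ then f r = false else True].
Proof.
elim: rows => [|f rows [ones [rest [-> H1 H2]]]]; first by exists [::], [::].
case E: (f r); first by exists (f :: ones), rest; split=> //=; rewrite E.
by exists [::], (f :: ones ++ rest).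
Qed.

(** The [k] ones below the carry are worth [2 ^ k - 1], so clearing them and setting the bit at
    position [k] adds 1. *)
Lemma rval_inc r r' ones (f : row) rest : all (fun f : row => f r) ones -> f r = false ->
  rval r' (map (set_bit r false) ones ++ set_bit r true f :: rest) =
  rval r' (ones ++ f :: rest) + (r' == r).
Proof.
move=> H1 Hf; rewrite !rval_cat size_map /= ffunE.
have [->|ne] := eqVneq r' r; last by rewrite rval_map_set // addn0.
rewrite rval_map_clear Hf -(rval_ones H1) /=; nia.
Qed.

Lemma tri_finc v i o r : (v r).+1 < 2 ^ L ->
  tri (finc r) v i o true (upd_reg v r (v r).+1) i o.
Proof.
move=> Hlt m /exec_enter[rows [j [Hj HL Hv E1]]].
have [ones [rest [Er H1 H2]]] := split_ones r rows; subst rows.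
have Hw : ex (fwhile (ftest (get_bit r)) (fput r false DR))
    (cursor i o (map crow [::]) (map crow (ones ++ rest) ++ nseq j cblank)) true
    (cursor i o (map crow (rev (map (set_bit r false) ones) ++ [::]))
       (map crow rest ++ nseq j cblank)).
  apply: exec_put_while => //=; first by rewrite add0n -size_cat.
  by case: rest H2 {E1 HL Hv} => //=; rewrite head_blank.
rewrite cats0 in Hw.
(* A carry that runs past all columns falls on a blank, which is treated as a zero column. *)
set f : row := if rest is f :: _ then f else [ffun=> false].
have Hf : f r = false by rewrite /f; case: (rest) H2 => //=; rewrite ffunE.
have Hval r' : upd_reg v r (v r).+1 r' =
   rval r' (map (set_bit r false) ones ++ set_bit r true f :: behead rest).
  rewrite rval_inc // /upd_reg.
  have -> : rval r' (ones ++ f :: behead rest) = v r'.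
    rewrite Hv !rval_cat /f; case: (rest) => //=; rewrite ffunE //.
  by case: eqP => [->|_]; rewrite ?addn1 ?addn0.
(* If a column is created, all present ones hold a 1 of [r], so the new value is 2 to the number of
   columns; the bound on the value thus bounds the length of the tape. *)
have HL' : size ones + (size (behead rest)).+1 <= L.
  move: HL; rewrite size_cat; case: rest H2 E1 Hv Hw @f Hf Hval => [|f0 rest] _ _ Hv _ _ _ _ //= HL.
  move: Hlt; rewrite Hv cats0 (rval_ones H1) ltn_exp2l //; lia.
(* A newly created column takes the place of the trailing blank. *)
pose j' := if rest is [::] then 0 else j.
have [m' E2 Hm'] : exists2 m', ex frewind (cursor i o
    (map crow (rev (map (set_bit r false) ones)))
    (map crow (set_bit r true f :: behead rest) ++ nseq j' cblank)) true m'
    & rep (upd_reg v r (v r).+1) i o m'.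
  apply: exec_leave; rewrite ?size_rev ?size_map //; first by rewrite /j'; case: (rest).
  by move=> r'; rewrite revK.
exists m' => //; apply: exec_seq E1 _; apply: exec_seq Hw _; apply: exec_seq E2.
apply: exec_fstep => //=.
- rewrite /cursor /=; congr ZMem.
    by rewrite /put_bit /f; case: (rest) => //=; rewrite head_blank.
  by rewrite /j'; case: (rest) => //=; case: j Hj {j'} => [|[]].
- apply: cursor_size; rewrite ?size_cat !size_map ?size_rev ?size_map ?size_nseq.
    by move: HL' => /=; case: (rest) => /=; lia.
  lia.
- apply: cursor_size; rewrite ?size_cat /= ?size_cat !size_map ?size_rev ?size_map ?size_nseq.
    by rewrite /j'; move: HL' => /=; case: (rest) => /=; lia.
  lia.
Qed.

(** [b] is the verdict of the lower columns already scanned; it survives exactly if the remaining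
    higher parts are equal. *)
Lemma run_fscan_lt i o r s b rows rest j :
  size rows + size rest <= L -> j <= 1 ->
  @run cell cblank (fscan_lt r s) x L.+2 b
    (cursor i o (map crow rows) (map crow rest ++ nseq j cblank))
    (if rval r rest == rval s rest then b else rval r rest < rval s rest)
    (cursor i o (map crow (rev rest ++ rows)) (nseq j cblank)).
Proof.
elim: rest rows b => [|f rest IH] rows b /= HL Hj.
  have E : zact cblank x (cursor i o (map crow rows) (nseq j cblank))
     (cblank, DS, DS, None) = cursor i o (map crow rows) (nseq j cblank).
    by rewrite /cursor /= head_blank.
  have Hs : zsize (cursor i o (map crow rows) (nseq j cblank)) <= L.+2.
    by apply: cursor_size; rewrite size_map ?size_nseq; lia.
  rewrite -{2}E; apply: RunExit; rewrite ?E //=.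
  by rewrite head_blank.
rewrite rev_cons cat_rcons.
have -> : (if f r + (rval r rest).*2 == f s + (rval s rest).*2 then b
     else f r + (rval r rest).*2 < f s + (rval s rest).*2) =
   (if rval r rest == rval s rest then (if f r == f s then b else f s)
    else rval r rest < rval s rest).
  by case: (f r); case: (f s) => /=; case: (ltngtP (rval r rest) (rval s rest)) => H;
    (case: eqP => ?; try lia).
apply: (@RunStep _ _ _ _ _ _ _ (if f r == f s then b else f s)
   (crow f, DS, DR, None)) => //.
  by apply: cursor_size; rewrite /= ?size_cat ?size_map ?size_nseq; lia.
by apply: (IH (f :: rows)) => //=; lia.
Qed.

Lemma tri_flt v i o r s e : (v r < v s) = e -> tri (flt r s) v i o e v i o.
Proof.
move=> <- m /exec_enter[rows [j [Hj HL Hv E1]]].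
have E2 := @run_fscan_lt i o r s false [::] rows j HL Hj.
have Eb : (if rval r rows == rval s rows then false else rval r rows < rval s rows) = (v r < v s).
  by rewrite !Hv; case: ltngtP.
rewrite Eb cats0 in E2.
have [m' E3 Hm'] : exists2 m', ex frewind (cursor i o
    (map crow (rev rows)) (map crow [::] ++ nseq j cblank)) true m'
    & rep v i o m'.
  by apply: exec_leave; rewrite ?size_rev //= ?addn0 // => r'; rewrite revK cats0.
have Hs := rep_size Hm'.
exists m' => //; apply: exec_seq E1 _; apply: exec_if E2 _.
have E4 : forall b, ex (freturn b) m' b m'.
  by move=> b; apply: exec_fstep => //; case: (m').
by case: (v r < v s); apply: exec_seq E3 (E4 _).
Qed.

Lemma nat_bits_double b n : (0 < n) || b -> nat_bits (nat_of_bool b + n.*2) = rcons (nat_bits n) b.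
Proof.
move=> H; rewrite /nat_bits.
case: b H => H.
  have -> : BinNat.N.of_nat (true + n.*2) = BinNat.N.succ_double (BinNat.N.of_nat n) by lia.
  by case: (BinNat.N.of_nat n).
have -> : BinNat.N.of_nat (false + n.*2) = BinNat.N.double (BinNat.N.of_nat n) by lia.
by case E: (BinNat.N.of_nat n) => //; lia.
Qed.

Fixpoint strip0 (s : seq bool) : seq bool :=
  if s is b :: s' then if b then s else strip0 s' else [::].

Lemma strip0_rcons s b : strip0 (rcons s b) =
  if has id s || b then rcons (strip0 s) b else [::].
Proof. by elim: s => [|[] s IH] //=; case: b. Qed.

Lemma nat_bits_rval r rows : nat_bits (rval r rows) = strip0 (rev [seq f r | f : row <- rows]).
Proof.
have Hp : forall rows, (0 < rval r rows) = has id [seq f r | f : row <- rows].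
  by elim => //= f s <-; case: (f r) => //=; lia.
elim: rows => //= f s IH; rewrite rev_cons strip0_rcons has_rev -Hp.
case: ifP => H; first by rewrite nat_bits_double // IH.
by move: H => /norP[]; rewrite -eqn0Ngt => /eqP -> /negbTE ->.
Qed.

(** The counterpart of [cursor] for walking left: [rr] lists the columns from the head down, and the
    head is on the mark when none is left. *)
Definition lcursor i o (rr : seq row) (t : seq cell) : zmem cell :=
  if rr is f :: rr' then Z i (rcons (map crow rr') cmark) (crow f) t o
  else Z i [::] cmark t o.

Lemma lcursor_size i o rr t : size rr + size t <= L.+1 -> zsize (lcursor i o rr t) <= L.+2.
Proof. by case: rr => [|f rr] /=; rewrite /zsize /= ?size_rcons ?size_map; lia. Qed.

Lemma exec_skip_zeros i o r rr dn tl : size rr + size dn + size tl <= L.+1 ->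
  exists rr' dn', [/\ ex (fwhile (ftest (fun a => (a != cmark) && ~~ get_bit r a)) (fmove DL))
      (lcursor i o rr (map crow dn ++ tl)) true (lcursor i o rr' (map crow dn' ++ tl)),
    [seq f r | f : row <- rr'] = strip0 [seq f r | f : row <- rr] &
    rev rr' ++ dn' = rev rr ++ dn].
Proof.
elim: rr dn => [|f rr IH] dn HL.
  exists [::], dn; split=> //; apply: exec_while_stop.
  by apply: exec_fstep => //; apply: lcursor_size; rewrite size_cat size_map addnA.
have Hs : zsize (lcursor i o (f :: rr) (map crow dn ++ tl)) <= L.+2.
  by apply: lcursor_size; rewrite size_cat size_map addnA.
case Ef: (f r).
  exists (f :: rr), dn; split=> //=; last by rewrite Ef.
  by apply: exec_while_stop; apply: exec_fstep; rewrite //= ?Ef.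
have [|rr' [dn' [E1 E2 E3]]] := IH (f :: dn); first by move: HL => /=; lia.
exists rr', dn'; split=> //=; last by rewrite E3 rev_cons cat_rcons.
- apply: exec_while_loop E1.
  + by apply: exec_fstep; rewrite //= ?Ef.
  + apply: exec_fstep => //; first by case: (rr).
    by apply: lcursor_size; rewrite /= size_cat size_map; move: HL => /=; lia.
- by rewrite E2 Ef.
Qed.

Lemma exec_emit_bits i o r rr dn tl : size rr + size dn + size tl <= L.+1 ->
  ex (fwhile (ftest (predC1 cmark)) (fseq (femit1 true) (femit_bit r)))
    (lcursor i o rr (map crow dn ++ tl)) true
    (lcursor i (o ++ flatten [seq [:: true; b] | b <- [seq f r | f : row <- rr]])
       [::] (map crow (rev rr ++ dn) ++ tl)).
Proof.
elim: rr o dn => [|f rr IH] o dn HL.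
  rewrite cats0; apply: exec_while_stop.
  by apply: exec_fstep => //; apply: lcursor_size; rewrite size_cat size_map addnA.
have Hs o' : zsize (lcursor i o' (f :: rr) (map crow dn ++ tl)) <= L.+2.
  by apply: lcursor_size; rewrite size_cat size_map addnA.
apply: (@exec_while_loop _ _ x _ _ _ _ (lcursor i o (f :: rr) (map crow dn ++ tl)) true
   (lcursor i (o ++ [:: true; f r]) rr (map crow (f :: dn) ++ tl))).
- exact: exec_fstep.
- apply: (@exec_seq _ _ _ _ _ _ _ true (lcursor i (rcons o true) (f :: rr) (map crow dn ++ tl))).
    exact: exec_fstep.
  apply: exec_fstep => //.
    by rewrite -cat_rcons cats1; case: (rr).
  by apply: lcursor_size; rewrite /= size_cat size_map; move: HL => /=; lia.
have := IH (o ++ [:: true; f r]) (f :: dn); rewrite -catA rev_cons cat_rcons; apply.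
by move: HL => /=; lia.
Qed.

Lemma exec_move_end i o rest rows j :
  size rows + size rest <= L -> j <= 1 ->
  ex (fwhile (ftest (predC1 cblank)) (fmove DR))
    (cursor i o (map crow rows) (map crow rest ++ nseq j cblank)) true
    (cursor i o (map crow (rev rest ++ rows)) (nseq j cblank)).
Proof.
elim: rest rows => [|f rest IH] rows /= HL Hj.
  apply: exec_while_stop; apply: (@exec_ftest _ _ _ _ [::]) => //.
  by rewrite /= head_blank.
apply: exec_while_loop.
- by apply: (@exec_ftest i o (predC1 cblank) rows (f :: rest)).
- by apply: exec_fmove_R => //; lia.
by rewrite rev_cons cat_rcons; apply: (IH (f :: rows)) => //=; lia.
Qed.

Lemma tri_fnat v i o r : tri (fnat r) v i o true v i (o ++ enc_nat (v r)).
Proof.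
move=> m /exec_enter[rows [j [Hj HL Hv E1]]].
have E2 := @exec_move_end i o rows [::] j HL Hj; rewrite cats0 in E2.
(* The search for the right end has visited one blank, which stays behind. *)
pose tl : seq cell := [:: cblank].
have E3 : ex (fmove DL) (cursor i o (map crow (rev rows)) (nseq j cblank)) true
    (lcursor i o (rev rows) (map crow [::] ++ tl)).
  apply: exec_fstep => //.
  - rewrite /cursor /= head_blank; case: (rev rows) => [|f rr] /=; congr ZMem;
      by case: j Hj {E1 E2} => [|[]].
  - by apply: cursor_size; rewrite ?size_map ?size_rev ?size_nseq; lia.
  - by apply: lcursor_size; rewrite /= size_rev; lia.
have [|rr [dn [E4 E5 E6]]] := @exec_skip_zeros i o r (rev rows) [::] tl.
  by rewrite size_rev /=; lia.
have Hsz : size rr + size dn = size rows.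
  by rewrite -(size_rev rr) -size_cat E6 cats0 revK.
have E7 := @exec_emit_bits i o r rr dn tl.
rewrite E6 cats0 revK in E7.
exists (lcursor i (o ++ enc_nat (v r)) [::] (map crow rows ++ tl)); last first.
  by exists rows, 1.
apply: exec_seq E1 _; apply: exec_seq E2 _; apply: exec_seq E3 _.
apply: exec_seq E4 _; apply: (exec_seq (E7 _)).
  by rewrite Hsz /=; lia.
apply: exec_fstep => //=.
- by rewrite /enc_nat Hv nat_bits_rval E5 map_rev /= rcons_cat.
- by apply: (@lcursor_size i _ [::]); rewrite size_cat size_map /=; lia.
- by apply: (@lcursor_size i _ [::]); rewrite size_cat size_map /=; lia.
Qed.

Fixpoint femit (bs : seq bool) : frag cell :=
  if bs is b :: bs' then fseq (femit1 b) (femit bs') else freturn true.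

Lemma tri_fstep_o v i o e o' d b :
  out_bit b o = o' ->
  tri (fstep (fun _ a => (e, (a, d, DS, b)))) v i o e v (in_move x d i) o'.
Proof.
move=> Ho m Hm; exists (ZMem (in_move x d i) (zleft m) (zcur m) (zright m) o').
  have Hs := rep_size Hm; apply: exec_fstep => //.
  by case: Hm => rows [j [-> *]] /=; rewrite Ho.
by case: Hm => rows [j [-> *]]; exists rows, j.
Qed.

Lemma tri_femit v i o bs : tri (femit bs) v i o true v i (o ++ bs).
Proof.
elim: bs o => [|b bs IH] o /=; first by rewrite cats0; apply: tri_fstep_o.
by apply: (@tri_seq _ _ _ _ _ true v i (rcons o b)); [apply: tri_fstep_o|rewrite -cat_rcons; apply: IH].
Qed.

Lemma tri_freturn v i o e : tri (freturn e) v i o e v i o.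
Proof. exact: tri_fstep_o. Qed.

Lemma tri_fin_move v i o d : tri (fin_move d) v i o true v (in_move x d i) o.
Proof. exact: tri_fstep_o. Qed.

Lemma tri_fin_test v i o p e : p (lread x i) = e -> tri (fin_test p) v i o e v i o.
Proof.
move=> <- m Hm; exists m => //.
by have Hs := rep_size Hm; case: Hm Hs => rows [j [-> _ _ _]] Hs; apply: exec_fstep.
Qed.

(** The first move leaves the right endmarker, on which the loop would stop at once. *)
Definition fin_rewind : frag cell :=
  fseq (fin_move DL) (fwhile (fin_test isSome) (fin_move DL)).

Lemma lreadE i : isSome (lread x i) = (0 < i <= size x).
Proof. by rewrite /lread; case: ifP. Qed.

Lemma tri_fin_rewind v i o : i <= (size x).+1 -> tri fin_rewind v i o true v 0 o.
Proof.
move=> Hi; apply: tri_seq; first exact: tri_fin_move.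
have {Hi} : i.-1 <= size x by lia.
rewrite /=; elim: i.-1 => [|k IH] Hk.
  by apply: tri_while_stop; apply: tri_fin_test; rewrite lreadE.
apply: tri_while_loop.
- by apply: tri_fin_test; rewrite lreadE Hk.
- exact: tri_fin_move.
by apply: IH; lia.
Qed.

Definition fsize (r : Reg) : frag cell :=
  fseq (fin_move DR) (fseq (fwhile (fin_test isSome) (fseq (finc r) (fin_move DR)))
    fin_rewind).

Lemma tri_fsize v o r : size x < 2 ^ L -> v r = 0 ->
  tri (fsize r) v 0 o true (upd_reg v r (size x)) 0 o.
Proof.
move=> HL H0; apply: tri_seq; first exact: tri_fin_move.
apply: (@tri_seq _ _ _ _ _ true (upd_reg v r (size x)) (size x).+1 o); last first.
  exact: tri_fin_rewind.
suff H k w : k <= size x -> w r = size x - k -> (forall r', r' != r -> w r' = v r') ->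
    tri (fwhile (fin_test isSome) (fseq (finc r) (fin_move DR))) w (size x - k).+1 o true
     (upd_reg v r (size x)) (size x).+1 o.
  have := H (size x) v (leqnn _) _ (fun _ _ => erefl); rewrite subnn H0 => /(_ erefl).
  by rewrite /= minnSS min0n.
elim: k w => [|k IH] w Hk Hw Hv.
  rewrite subn0 in Hw *; apply: tri_while_stop.
  apply: (@tri_ext _ w w _ _ _ w) => //.
    by move=> r'; rewrite /upd_reg; case: eqVneq => [->//|/Hv->].
  by apply: tri_fin_test; rewrite lreadE ltnn andbF.
apply: tri_while_loop.
- by apply: tri_fin_test; rewrite lreadE; lia.
- apply: tri_seq; first by apply: tri_finc; rewrite Hw; lia.
  exact: tri_fin_move.
have -> : in_move x DR (size x - k.+1).+1 = (size x - k).+1 by rewrite /=; lia.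
apply: IH; first lia.
  by rewrite /upd_reg eqxx Hw; lia.
by move=> r' /[dup] /Hv <- /negbTE; rewrite /upd_reg => ->.
Qed.

(** The input head moves along with the counter [s]. An address past the input leaves it on the
    right endmarker, which is read as [false], like the default of [nth]. *)
Definition fread (r s : Reg) : frag cell :=
  fseq (fclear s) (fseq (fin_move DR)
   (fseq (fwhile (flt s r) (fseq (finc s) (fin_move DR)))
   (fif (fin_test (fun o => if o is Some b then b else false))
      (fseq fin_rewind (freturn true)) (fseq fin_rewind (freturn false))))).

Lemma tri_fread v o r s : r != s -> v r < 2 ^ L ->
  tri (fread r s) v 0 o (nth false x (v r)) (upd_reg v s (v r)) 0 o.
Proof.
move=> rs HL; apply: tri_seq; first exact: tri_fclear.
apply: tri_seq; first exact: tri_fin_move.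
apply: (@tri_seq _ _ _ _ _ true (upd_reg v s (v r)) (minn (v r).+1 (size x).+1) o).
  suff H k w : k <= v r -> w s = v r - k -> (forall r', r' != s -> w r' = v r') ->
    tri (fwhile (flt s r) (fseq (finc s) (fin_move DR))) w
      (minn (v r - k).+1 (size x).+1) o true
     (upd_reg v s (v r)) (minn (v r).+1 (size x).+1) o.
    have := H (v r) (upd_reg v s 0) (leqnn _); rewrite subnn /= minnSS min0n; apply.
      by rewrite /upd_reg eqxx.
    by move=> r' /negbTE; rewrite /upd_reg => ->.
  elim: k w => [|k IH] w Hk Hw Hv.
    rewrite subn0 in Hw *; apply: tri_while_stop; apply: (@tri_ext _ w w _ _ _ w) => //.
      by move=> r'; rewrite /upd_reg; case: eqVneq => [->//|/Hv->].
    by apply: tri_flt; rewrite Hw Hv // ltnn.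
  apply: tri_while_loop.
  - by apply: tri_flt; rewrite Hw Hv //; lia.
  - apply: tri_seq; first by apply: tri_finc; rewrite Hw; lia.
    exact: tri_fin_move.
  have -> : in_move x DR (minn (v r - k.+1).+1 (size x).+1) = minn (v r - k).+1 (size x).+1.
    by rewrite /=; lia.
  apply: IH; first lia.
    by rewrite /upd_reg eqxx Hw; lia.
  by move=> r' /[dup] /Hv <- /negbTE; rewrite /upd_reg => ->.
apply: tri_if; first exact: tri_fin_test.
have -> : (if lread x (minn (v r).+1 (size x).+1) is Some b then b else false) = nth false x (v r).
  rewrite /lread; case: (ltnP (v r) (size x)) => H.
    have -> : minn (v r).+1 (size x).+1 = (v r).+1 by lia.
    by rewrite H.
  have -> : minn (v r).+1 (size x).+1 = (size x).+1 by lia.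
  by rewrite ltnn andbF nth_default.
case: (nth false x (v r)); (apply: tri_seq; [apply: tri_fin_rewind; lia | exact: tri_freturn]).
Qed.

Definition finit : frag cell := fstep (fun _ _ => (true, (cmark, DS, DS, None))).

Lemma exec_finit : exists2 m, ex finit (Z 0 [::] cblank [::] [::]) true m &
  rep (fun _ => 0) 0 [::] m.
Proof.
exists (Z 0 [::] cmark [::] [::]); last by exists [::], 0; split.
exact: exec_fstep.
Qed.

End Counters.

(** * Loop programs printing bits *)

Inductive expr :=
| EConst of nat
| EVar of nat
| EAdd of expr & expr
| EMul of expr & expr.

Fixpoint ev (e : expr) (env : seq nat) : nat :=
  match e with
  | EConst c => c
  | EVar v => nth 0 env v
  | EAdd a b => ev a env + ev b env
  | EMul a b => ev a env * ev b env
  end.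

Fixpoint evars (d : nat) (e : expr) : bool :=
  match e with
  | EConst _ => true
  | EVar v => v < d
  | EAdd a b | EMul a b => evars d a && evars d b
  end.

(* [EVar v] is the variable bound at nesting level [v]; level 0 holds the
   length of the input word. *)
Inductive gen (A : Type) :=
| GNil
| GLeaf of A
| GCat of gen A & gen A
| GFor of expr & gen A
| GLt of expr & expr & gen A & gen A
| GIn of expr & gen A & gen A.
Arguments GNil {A}.

Fixpoint gev (A B : Type) (x : seq bool) (f : A -> seq nat -> seq B) (g : gen A)
    (env : seq nat) : seq B :=
  match g with
  | GNil => [::]
  | GLeaf a => f a env
  | GCat g1 g2 => gev x f g1 env ++ gev x f g2 env
  | GFor e g => flatten [seq gev x f g (rcons env i) | i <- iota 0 (ev e env)]
  | GLt e1 e2 g1 g2 => if ev e1 env < ev e2 env then gev x f g1 env else gev x f g2 env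
  | GIn e g1 g2 => if nth false x (ev e env) then gev x f g1 env else gev x f g2 env
  end.

(** Templates are refined to bit printers by replacing leaves. As variables are nesting levels
    counted from outside, the inserted program is evaluated in the environment of the leaf without
    any shifting. *)
Fixpoint gbind (A B : Type) (g : gen A) (h : A -> gen B) : gen B :=
  match g with
  | GNil => GNil
  | GLeaf a => h a
  | GCat g1 g2 => GCat (gbind g1 h) (gbind g2 h)
  | GFor e g => GFor e (gbind g h)
  | GLt e1 e2 g1 g2 => GLt e1 e2 (gbind g1 h) (gbind g2 h)
  | GIn e g1 g2 => GIn e (gbind g1 h) (gbind g2 h)
  end.

Fixpoint gscoped (A : Type) (p : nat -> A -> bool) (d : nat) (g : gen A) : bool :=
  match g with
  | GNil => true
  | GLeaf a => p d a
  | GCat g1 g2 => gscoped p d g1 && gscoped p d g2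
  | GFor e g => evars d e && gscoped p d.+1 g
  | GLt e1 e2 g1 g2 => [&& evars d e1, evars d e2, gscoped p d g1 & gscoped p d g2]
  | GIn e g1 g2 => [&& evars d e, gscoped p d g1 & gscoped p d g2]
  end.

Lemma gev_gbind A B C x (f : B -> seq nat -> seq C) (g : gen A) h env :
  gev x f (gbind g h) env = gev x (fun a env => gev x f (h a) env) g env.
Proof.
elim: g env => //= [g1 IH1 g2 IH2 env|e g IH env|e1 e2 g1 IH1 g2 IH2 env|e g1 IH1 g2 IH2 env].
- by rewrite IH1 IH2.
- by congr flatten; apply: eq_map => i; rewrite IH.
- by rewrite IH1 IH2.
- by rewrite IH1 IH2.
Qed.

Lemma eq_gev A B x (f f' : A -> seq nat -> seq B) (g : gen A) env :
  (forall a env, f a env = f' a env) -> gev x f g env = gev x f' g env.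
Proof.
move=> E; elim: g env => //= [g1 IH1 g2 IH2 env|e g IH env|e1 e2 g1 IH1 g2 IH2 env|e g1 IH1 g2 IH2 env].
- by rewrite IH1 IH2.
- by congr flatten; apply: eq_map => i; rewrite IH.
- by rewrite IH1 IH2.
- by rewrite IH1 IH2.
Qed.

Lemma gev_flatten A B C x (f : A -> seq nat -> seq B) (h : B -> seq C) (g : gen A) env :
  flatten (map h (gev x f g env)) = gev x (fun a env => flatten (map h (f a env))) g env.
Proof.
elim: g env => //= [g1 IH1 g2 IH2 env|e g IH env|e1 e2 g1 IH1 g2 IH2 env|e g1 IH1 g2 IH2 env].
- by rewrite map_cat flatten_cat IH1 IH2.
- by elim: (iota _ _) => //= i s IHs; rewrite map_cat flatten_cat IHs IH.
- by case: ifP; rewrite ?IH1 ?IH2.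
- by case: ifP; rewrite ?IH1 ?IH2.
Qed.

Lemma gscoped_gbind A B (p : nat -> A -> bool) (q : nat -> B -> bool) (g : gen A) (h : A -> gen B) d :
  (forall d a, p d a -> gscoped q d (h a)) -> gscoped p d g -> gscoped q d (gbind g h).
Proof.
move=> H; elim: g d => //= [a d /H //|g1 IH1 g2 IH2 d|e g IH d|e1 e2 g1 IH1 g2 IH2 d|e g1 IH1 g2 IH2 d].
- by move=> /andP[/IH1-> /IH2->].
- by move=> /andP[-> /IH->].
- by move=> /and4P[-> -> /IH1-> /IH2->].
- by move=> /and3P[-> /IH1-> /IH2->].
Qed.

Inductive bleaf := LBits of seq bool | LNat of expr.
Definition bleaf_out (l : bleaf) (env : seq nat) : seq bool :=
  match l with LBits bs => bs | LNat e => enc_nat (ev e env) end.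
Definition bleaf_scoped (d : nat) (l : bleaf) : bool :=
  if l is LNat e then evars d e else true.

(* Exponents [k'] such that values bounded by [N ^ k'] occur when the
   variables are bounded by [N ^ k], for [N >= 2]. *)
Fixpoint edeg (e : expr) (k : nat) : nat :=
  match e with
  | EConst c => c
  | EVar _ => k
  | EAdd a b => (edeg a k + edeg b k).+1
  | EMul a b => edeg a k + edeg b k
  end.

Fixpoint gdeg (g : gen bleaf) (k : nat) : nat :=
  match g with
  | GNil => 0
  | GLeaf l => if l is LNat e then edeg e k else 0
  | GCat g1 g2 => gdeg g1 k + gdeg g2 k
  | GFor e g => edeg e k + gdeg g (k + edeg e k)
  | GLt e1 e2 g1 g2 => edeg e1 k + edeg e2 k + gdeg g1 k + gdeg g2 k
  | GIn e g1 g2 => edeg e k + gdeg g1 k + gdeg g2 k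
  end.

Fixpoint eregs (e : expr) : nat :=
  match e with
  | EConst _ => 0
  | EVar _ => 1
  | EAdd a b => eregs a + eregs b
  | EMul a b => (eregs a + eregs b).+2
  end.

Fixpoint gregs (g : gen bleaf) : nat :=
  match g with
  | GNil => 0
  | GLeaf l => if l is LNat e then (eregs e).+2 else 0
  | GCat g1 g2 => gregs g1 + gregs g2
  | GFor e g => (eregs e + gregs g).+2
  | GLt e1 e2 g1 g2 => (eregs e1 + eregs e2 + gregs g1 + gregs g2).+2
  | GIn e g1 g2 => (eregs e + gregs g1 + gregs g2).+2
  end.

Lemma leq_edeg e env N k : 1 < N -> (forall v, nth 0 env v <= N ^ k) ->
  ev e env <= N ^ edeg e k.
Proof.
move=> HN Hv; elim: e => //= [c|a IHa b IHb|a IHa b IHb].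
- by apply: ltnW; apply: ltn_expl.
- have Ha : N ^ edeg a k <= N ^ (edeg a k + edeg b k) by rewrite leq_exp2l //; lia.
  have Hb : N ^ edeg b k <= N ^ (edeg a k + edeg b k) by rewrite leq_exp2l //; lia.
  by rewrite expnS; nia.
- by rewrite expnD leq_mul.
Qed.

(** * Compilation of loop programs to transducers *)

Section Compile.
Variable K : nat.
Let Reg : finType := 'I_K.+1.
Definition rg (d : nat) : Reg := inord d.

Lemma rg_eq a b : a <= K -> b <= K -> (rg a == rg b) = (a == b).
Proof. by move=> Ha Hb; rewrite -val_eqE /= !inordK. Qed.

Fixpoint fincs (r : Reg) (c : nat) : frag (cell Reg) :=
  if c is c'.+1 then fseq (finc r) (fincs r c') else freturn Reg true.

(* The variable of level [v] lives in register [2 v]; registers from [s] on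
   are scratch. *)
Fixpoint fadd (e : expr) (r s : nat) : frag (cell Reg) :=
  match e with
  | EConst c => fincs (rg r) c
  | EVar v => fseq (fclear (rg s))
      (fwhile (flt (rg s) (rg v.*2)) (fseq (finc (rg r)) (finc (rg s))))
  | EAdd a b => fseq (fadd a r s) (fadd b r s)
  | EMul a b => fseq (fclear (rg s)) (fseq (fadd a s s.+1) (fseq (fclear (rg s.+1))
      (fwhile (flt (rg s.+1) (rg s)) (fseq (fadd b r s.+2) (finc (rg s.+1))))))
  end.

Definition feval (e : expr) (r s : nat) : frag (cell Reg) :=
  fseq (fclear (rg r)) (fadd e r s).

(** At level [d] a loop keeps its variable in register [2d] and its bound in [2d + 1], and the body
    works only with registers above these. Tests use the same two registers for their operands,
    which are free again when a branch starts. *)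
Fixpoint fgen (g : gen bleaf) (d : nat) : frag (cell Reg) :=
  match g with
  | GNil => freturn Reg true
  | GLeaf l => match l with
      | LBits bs => femit Reg bs
      | LNat e => fseq (feval e d.*2 d.*2.+1) (fnat (rg d.*2)) end
  | GCat g1 g2 => fseq (fgen g1 d) (fgen g2 d)
  | GFor e g => fseq (feval e d.*2.+1 d.*2.+2) (fseq (fclear (rg d.*2))
      (fwhile (flt (rg d.*2) (rg d.*2.+1)) (fseq (fgen g d.+1) (finc (rg d.*2)))))
  | GLt e1 e2 g1 g2 => fseq (feval e1 d.*2 d.*2.+2) (fseq (feval e2 d.*2.+1 d.*2.+2)
      (fif (flt (rg d.*2) (rg d.*2.+1)) (fgen g1 d) (fgen g2 d)))
  | GIn e g1 g2 => fseq (feval e d.*2 d.*2.+2)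
      (fif (fread (rg d.*2) (rg d.*2.+1)) (fgen g1 d) (fgen g2 d))
  end.

Variables (x : seq bool) (L N : nat).
Hypothesis N_gt1 : 1 < N.

Notation tri := (tri x L).

Definition agree (s : nat) (v w : Reg -> nat) := forall q, q < s -> v (rg q) = w (rg q).
Definition holds (env : seq nat) (d : nat) (v : Reg -> nat) :=
  forall q, q < d -> v (rg q.*2) = nth 0 env q.

Lemma upd_same v r n : upd_reg v (rg r) n (rg r) = n.
Proof. by rewrite /upd_reg eqxx. Qed.

Lemma upd_other v r n q : r <= K -> q <= K -> q != r -> upd_reg v (rg r) n (rg q) = v (rg q).
Proof. by move=> Hr Hq H; rewrite /upd_reg rg_eq // (negbTE H). Qed.

Lemma tri_fincs v i o r c : v r + c < 2 ^ L ->
  tri (fincs r c) v i o true (upd_reg v r (v r + c)) i o.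
Proof.
elim: c v => [|c IH] v Hc /=.
  by apply: (@tri_ext _ x L _ v v _ _ _ v) => // [q|]; [rewrite /upd_reg addn0; case: eqP => [->|] | exact: tri_freturn].
apply: tri_seq; first by apply: tri_finc; lia.
have := IH (upd_reg v r (v r).+1); rewrite /upd_reg eqxx => {}IH.
apply: (tri_ext _ _ (IH _)) => //; last by lia.
by move=> q; case: eqP => // _; lia.
Qed.

(** The invariant is a predicate on valuations, not a fixed valuation, because scratch registers end
    up with unspecified contents. *)
Lemma tri_for (Inv : nat -> (Reg -> nat) -> Prop) (o : nat -> seq bool) c b n body i :
  n < 2 ^ L ->
  (forall k v, Inv k v -> v c = k /\ v b = n) ->
  (forall k v, k < n -> Inv k v -> exists v1, [/\ tri body v i (o k) true v1 i (o k.+1),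
     v1 c = k & Inv k.+1 (upd_reg v1 c k.+1)]) ->
  forall v, Inv 0 v ->
  exists2 v', tri (fwhile (flt c b) (fseq body (finc c))) v i (o 0) true v' i (o n) & Inv n v'.
Proof.
move=> HL Hcb Hstep.
suff H j k v : j + k = n -> Inv k v -> exists2 v',
    tri (fwhile (flt c b) (fseq body (finc c))) v i (o k) true v' i (o n) & Inv n v'.
  by move=> v; apply: (H n 0); rewrite addn0.
elim: j k v => [|j IH] k v Hjk Hi.
  move: Hjk Hi; rewrite add0n => -> Hi; exists v => //; apply: tri_while_stop; apply: tri_flt.
  by have [-> ->] := Hcb _ _ Hi; rewrite ltnn.
have [Hc Hb] := Hcb _ _ Hi.
have [|v1 [T1 H1 I1]] := Hstep k v _ Hi; first by lia.
have [|v' T2 I2] := IH k.+1 _ _ I1; first by lia.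
exists v' => //; apply: tri_while_loop; first by apply: tri_flt; rewrite Hc Hb; lia.
  by apply: tri_seq T1 _; apply: tri_finc; rewrite H1; lia.
by rewrite H1.
Qed.

(** Adding to an accumulator, instead of assigning, makes a product an iterated call on the second
    factor. The last conjunct protects all registers below the scratch area. *)
Lemma tri_fadd e env k d r s v i o :
  (forall q, nth 0 env q <= N ^ k) ->
  d.*2 <= r -> r < s -> s + eregs e <= K.+1 -> evars d e -> holds env d v ->
  v (rg r) + N ^ edeg e k < 2 ^ L ->
  exists2 v', tri (fadd e r s) v i o true v' i o &
    v' (rg r) = v (rg r) + ev e env /\ forall q, q < s -> q != r -> v' (rg q) = v (rg q).
Proof.
move=> Henv; elim: e r s v => [c|u|a IHa b IHb|a IHa b IHb] r s v /= Hdr Hrs HK Hsc Hh HL.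
- exists (upd_reg v (rg r) (v (rg r) + c)).
    by apply: tri_fincs; have := ltn_expl c N_gt1; lia.
  by rewrite upd_same; split=> // q Hq Hqr; rewrite upd_other //; lia.
- have Hu := Hh u Hsc; set n := nth 0 env u in Hu *; have Hn : n <= N ^ k := Henv u.
  pose Inv j w := [/\ w (rg s) = j, w (rg r) = v (rg r) + j &
    forall q, q < s -> q != r -> w (rg q) = v (rg q)].
  have [lt1 lt2 lt3 lt4] : [/\ u.*2 < s, u.*2 != r, u.*2 <= K & s <= K] by split; lia.
  have [||||v' T [H1 H2 H3]] := @tri_for Inv (fun=> o) (rg s) (rg u.*2) n (finc (rg r)) i
    _ _ _ (upd_reg v (rg s) 0) _; first lia.
  - by move=> j w [-> _ H]; rewrite H // Hu.
  - move=> j w Hj [H1 H2 H3]; exists (upd_reg w (rg r) (w (rg r)).+1); split.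
    + by apply: tri_finc; rewrite H2; lia.
    + by rewrite upd_other //; lia.
    split; first by rewrite upd_same.
      by rewrite upd_other ?upd_same ?H2; lia.
    by move=> q Hq Hqr; rewrite !upd_other ?H3 //; lia.
  - split; first by rewrite upd_same.
      by rewrite upd_other ?addn0; lia.
    by move=> q Hq Hqr; rewrite upd_other //; lia.
  exists v' => //.
  by apply: tri_seq T; exact: tri_fclear.
- move: Hsc => /andP[Sa Sb].
  have Ha := leq_edeg a N_gt1 Henv; have Hb := leq_edeg b N_gt1 Henv.
  have P : N ^ edeg a k + N ^ edeg b k <= N ^ (edeg a k + edeg b k).+1.
    have Ha' : N ^ edeg a k <= N ^ (edeg a k + edeg b k) by rewrite leq_exp2l //; lia.
    have Hb' : N ^ edeg b k <= N ^ (edeg a k + edeg b k) by rewrite leq_exp2l //; lia.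
    by rewrite expnS; nia.
  have [||||||v1 T1 [E1 F1]] := IHa r s v => //; try lia.
  have [||||||v2 T2 [E2 F2]] := IHb r s v1 => //; try lia.
    by move=> q Hq; rewrite F1 ?Hh //; lia.
  exists v2; first exact: tri_seq T1 T2.
  split; first by rewrite E2 E1 addnA.
  by move=> q Hq Hqr; rewrite F2 ?F1.
- move: Hsc => /andP[Sa Sb].
  have Ha := leq_edeg a N_gt1 Henv; have Hb := leq_edeg b N_gt1 Henv.
  have P : N ^ edeg a k <= N ^ (edeg a k + edeg b k) by rewrite leq_exp2l //; lia.
  rewrite expnD in HL P.
  have [||||||v1 T1 [E1 F1]] := IHa s s.+1 (upd_reg v (rg s) 0) => //; try lia.
    by move=> q Hq; rewrite upd_other ?Hh //; lia.
    by rewrite upd_same; lia.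
  rewrite upd_same add0n in E1.
  set n := ev a env in E1 Ha.
  pose Inv j w := [/\ w (rg s.+1) = j, w (rg s) = n, w (rg r) = v (rg r) + j * ev b env &
    forall q, q < s -> q != r -> w (rg q) = v (rg q)].
  have [||||v' T [H1 H2 H3 H4]] := @tri_for Inv (fun=> o) (rg s.+1) (rg s) n (fadd b r s.+2) i
    _ _ _ (upd_reg v1 (rg s.+1) 0) _; first lia.
  - by move=> j w [-> ->].
  - move=> j w Hj [H1 H2 H3 H4].
    have [||||||w1 T2 [E2 F2]] := IHb r s.+2 w => //; try lia.
      by move=> q Hq; rewrite H4 ?Hh //; lia.
      by rewrite H3; nia.
    exists w1; split=> //; first by rewrite F2 //; lia.
    split; first by rewrite upd_same.
    + by rewrite upd_other ?F2 //; lia.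
    + by rewrite upd_other ?E2 ?H3; lia.
    by move=> q Hq Hqr; rewrite upd_other ?F2 ?H4 //; lia.
  - split; first by rewrite upd_same.
    + by rewrite upd_other //; lia.
    + by rewrite upd_other ?F1 ?upd_other ?addn0; lia.
    by move=> q Hq Hqr; rewrite upd_other ?F1 ?upd_other //; lia.
  exists v' => //.
  apply: tri_seq; first exact: tri_fclear.
  by apply: tri_seq T1 _; apply: tri_seq T; exact: tri_fclear.
Qed.

Lemma tri_feval e env k d r s v i o :
  (forall q, nth 0 env q <= N ^ k) ->
  d.*2 <= r -> r < s -> s + eregs e <= K.+1 -> evars d e -> holds env d v ->
  N ^ edeg e k < 2 ^ L ->
  exists2 v', tri (feval e r s) v i o true v' i o &
    v' (rg r) = ev e env /\ forall q, q < s -> q != r -> v' (rg q) = v (rg q).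
Proof.
move=> Henv Hdr Hrs HK Hsc Hh HL.
have [|||||||v' T [E F]] := @tri_fadd e env k d r s (upd_reg v (rg r) 0) i o => //.
  by move=> q Hq; rewrite upd_other ?Hh //; lia.
  by rewrite upd_same.
exists v'; first by apply: tri_seq T; exact: tri_fclear.
split; first by rewrite E upd_same.
by move=> q Hq Hqr; rewrite F // upd_other //; lia.
Qed.

Lemma tri_fgen g env k d v o :
  (forall q, nth 0 env q <= N ^ k) -> size env = d ->
  d.*2 + gregs g <= K.+1 -> gscoped bleaf_scoped d g -> holds env d v ->
  N ^ gdeg g k < 2 ^ L ->
  exists2 v', tri (fgen g d) v 0 o true v' 0 (o ++ gev x bleaf_out g env) &
    agree d.*2 v v'.
Proof.
elim: g env k d v o => [|l|g1 IH1 g2 IH2|e g IH|e1 e2 g1 IH1 g2 IH2|e g1 IH1 g2 IH2]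
   env k d v o /= Henv Hd HK Hsc Hh HL.
- by exists v; rewrite ?cats0 //; exact: tri_freturn.
- case: l HK Hsc HL => [bs|e] /= HK Hsc HL; first by exists v => //; exact: tri_femit.
  have [|||v' T [E F]] := @tri_feval e env k d d.*2 d.*2.+1 v 0 o Henv _ _ _ Hsc Hh HL; try lia.
  exists v'; first by apply: tri_seq T _; rewrite -E; exact: tri_fnat.
  by move=> q Hq; rewrite F //; lia.
- move: Hsc => /andP[S1 S2].
  have lt1 : N ^ gdeg g1 k <= N ^ (gdeg g1 k + gdeg g2 k) by rewrite leq_exp2l //; lia.
  have lt2 : N ^ gdeg g2 k <= N ^ (gdeg g1 k + gdeg g2 k) by rewrite leq_exp2l //; lia.
  have [||v1 T1 A1] := IH1 env k d v o Henv Hd _ S1 Hh; try lia.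
  have [|||v2 T2 A2] := IH2 env k d v1 (o ++ gev x bleaf_out g1 env) Henv Hd _ S2; try lia.
    by move=> q Hq; rewrite -A1 ?Hh //; lia.
  exists v2; first by rewrite catA; exact: tri_seq T1 T2.
  by move=> q Hq; rewrite A1 // A2.
(* The loop variable can be as large as the bound of the loop, so the environment of the body is
   bounded with the larger exponent [kk]. *)
- move: Hsc => /andP[S1 S2]; set kk := k + edeg e k in HL.
  have lt1 : N ^ edeg e k <= N ^ (edeg e k + gdeg g kk) by rewrite leq_exp2l //; lia.
  have lt2 : N ^ gdeg g kk <= N ^ (edeg e k + gdeg g kk) by rewrite leq_exp2l //; lia.
  have He := leq_edeg e N_gt1 Henv.
  have [||||v1 T1 [E1 F1]] := @tri_feval e env k d d.*2.+1 d.*2.+2 v 0 o Henv _ _ _ S1 Hh; try lia.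
  set n := ev e env in He E1 *.
  pose oo j := o ++ flatten [seq gev x bleaf_out g (rcons env i) | i <- iota 0 j].
  pose Inv j w := [/\ w (rg d.*2) = j, w (rg d.*2.+1) = n & agree d.*2 v w].
  have [||||v' T [H1 H2 H3]] := @tri_for Inv oo (rg d.*2) (rg d.*2.+1) n (fgen g d.+1) 0
    _ _ _ (upd_reg v1 (rg d.*2) 0) _; first lia.
  - by move=> j w [-> ->].
  - move=> j w Hj [H1 H2 H3].
    have [||||||w1 T2 A2] := IH (rcons env j) kk d.+1 w (oo j) => //.
    + move=> q; rewrite nth_rcons; case: ltnP => Hq.
        by apply: leq_trans (Henv q) _; rewrite leq_exp2l // leq_addr.
      case: eqP => // _; apply: (@leq_trans (N ^ edeg e k)); first by lia.
      by rewrite leq_exp2l // leq_addl.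
    + by rewrite size_rcons Hd.
    + by lia.
    + move=> q; rewrite ltnS leq_eqVlt nth_rcons Hd => /orP[/eqP->|Hq].
        by rewrite ltnn eqxx.
      by rewrite Hq -H3 ?Hh //; lia.
    + by lia.
    have Eo : oo j.+1 = oo j ++ gev x bleaf_out g (rcons env j).
      by rewrite /oo -{1}addn1 iotaD map_cat flatten_cat /= cats0 catA.
    exists w1; rewrite Eo; split=> //; first by rewrite -A2 //; lia.
    split; first by rewrite upd_same.
      by rewrite upd_other -?A2 //; lia.
    by move=> q Hq; rewrite upd_other -?A2 ?H3 //; lia.
  - split; first by rewrite upd_same.
      by rewrite upd_other //; lia.
    by move=> q Hq; rewrite upd_other ?F1 //; lia.
  exists v' => //.
  apply: tri_seq T1 _; apply: tri_seq; first exact: tri_fclear.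
  by move: T; rewrite {1}/oo /= cats0.
- move: Hsc => /and4P[S1 S2 S3 S4].
  set mx := (_ + _ + _ + _) in HL.
  have [lt1 lt2 lt3 lt4] : [/\ N ^ edeg e1 k <= N ^ mx, N ^ edeg e2 k <= N ^ mx,
    N ^ gdeg g1 k <= N ^ mx & N ^ gdeg g2 k <= N ^ mx] by rewrite !leq_exp2l // /mx; split; lia.
  have [||||v1 T1 [E1 F1]] := @tri_feval e1 env k d d.*2 d.*2.+2 v 0 o Henv _ _ _ S1 Hh; try lia.
  have Hh1 : holds env d v1 by move=> q Hq; rewrite F1 ?Hh //; lia.
  have [||||v2 T2 [E2 F2]] := @tri_feval e2 env k d d.*2.+1 d.*2.+2 v1 0 o Henv _ _ _ S2 Hh1; try lia.
  have Hh2 : holds env d v2 by move=> q Hq; rewrite F2 ?Hh1 //; lia.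
  have A2 : agree d.*2 v v2 by move=> q Hq; rewrite F2 ?F1 //; lia.
  have E3 : v2 (rg d.*2) = ev e1 env by rewrite F2 //; lia.
  suff [v3 T3 A3] : exists2 v', tri (if ev e1 env < ev e2 env then fgen g1 d else fgen g2 d) v2 0 o true v' 0
     (o ++ (if ev e1 env < ev e2 env then gev x bleaf_out g1 env else gev x bleaf_out g2 env)) & agree d.*2 v2 v'.
    exists v3; last by move=> q Hq; rewrite A2 // A3.
    by apply: tri_seq T1 _; apply: tri_seq T2 _; apply: tri_if T3; apply: tri_flt; rewrite E2 E3.
  by case: ifP => _; [apply: IH1|apply: IH2] => //; lia.
- move: Hsc => /and3P[S1 S3 S4].
  set mx := (_ + _ + _) in HL.
  have [lt1 lt3 lt4] : [/\ N ^ edeg e k <= N ^ mx,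
    N ^ gdeg g1 k <= N ^ mx & N ^ gdeg g2 k <= N ^ mx] by rewrite !leq_exp2l // /mx; split; lia.
  have He := leq_edeg e N_gt1 Henv.
  have [||||v1 T1 [E1 F1]] := @tri_feval e env k d d.*2 d.*2.+2 v 0 o Henv _ _ _ S1 Hh; try lia.
  set v2 := upd_reg v1 (rg d.*2.+1) (ev e env).
  have T2 : tri (fread (rg d.*2) (rg d.*2.+1)) v1 0 o (nth false x (ev e env)) v2 0 o.
    by rewrite /v2 -E1; apply: tri_fread; rewrite ?rg_eq ?E1; lia.
  have A2 : agree d.*2 v v2 by move=> q Hq; rewrite /v2 upd_other ?F1 //; lia.
  have Hh2 : holds env d v2 by move=> q Hq; rewrite -A2 ?Hh //; lia.
  suff [v3 T3 A3] : exists2 v', tri (if nth false x (ev e env) then fgen g1 d else fgen g2 d) v2 0 o true v' 0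
     (o ++ (if nth false x (ev e env) then gev x bleaf_out g1 env else gev x bleaf_out g2 env)) & agree d.*2 v2 v'.
    exists v3; last by move=> q Hq; rewrite A2 // A3.
    by apply: tri_seq T1 _; apply: tri_if T3; exact: T2.
  by case: ifP => _; [apply: IH1|apply: IH2] => //; lia.
Qed.

End Compile.

Lemma gen_logspace (g : gen bleaf) : gscoped bleaf_scoped 1 g ->
  logspace_computable (fun x => gev x bleaf_out g [:: size x]).
Proof.
move=> Hsc; pose K := (gregs g).+2; pose k := gdeg g 1.
exists (ltm_of (cblank 'I_K.+1) (fseq (finit 'I_K.+1) (fseq (fsize (rg K 0)) (fgen K g 1)))).
(* The space used is [L.+2] for the [L] chosen next; the factor 4 leaves room for the additive
   terms. *)
exists (k.+1 * 4 + 2) => x.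
pose N := (size x).+2; pose L := k.+1 * (Nat.log2 (size x) + 2).
have HN : N <= 2 ^ (Nat.log2 (size x) + 2).
  case: (posnP (size x)) => Hx; first by rewrite /N Hx.
  have [_] : Nat.pow 2 (Nat.log2 (size x)) <= size x /\ size x < Nat.pow 2 (Nat.log2 (size x)).+1.
    by have := PeanoNat.Nat.log2_spec (size x); lia.
  have -> : forall n, Nat.pow 2 n = 2 ^ n by elim=> //= n ->; rewrite expnS; lia.
  rewrite addn2 !expnS /N; have : 0 < 2 ^ Nat.log2 (size x) by rewrite expn_gt0.
  lia.
(* The additional factor [N] makes the bound on all values strict and covers the input length. *)
have HL : N ^ k.+1 <= 2 ^ L by rewrite /L mulnC expnM leq_exp2r.
have HNk : N ^ k < 2 ^ L by apply: leq_trans HL; rewrite ltn_exp2l.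
have Hx : size x < 2 ^ L.
  by apply: leq_trans HL; apply: leq_trans (leq_pexp2l _ (isT : 1 <= k.+1)); rewrite ?expn1 /N.
have [m0 E0 R0] := @exec_finit 'I_K.+1 x L.
have T1 := @tri_fsize _ x L (fun=> 0) [::] (rg K 0) Hx erefl.
have [||||||v' T2 _] := @tri_fgen K x L N isT g [:: size x] 1 1 (upd_reg (fun=> 0) (rg K 0) (size x)) [::] => //.
- by case=> [|[]] //=; rewrite expn1 /N; lia.
- by case=> // _; rewrite upd_same.
have [m1 E1 [rows [j [Em1 _ _ _]]]] := tri_seq T1 T2 R0.
move: (exec_seq E0 E1); set F := fseq _ _ => /run_lstep[s []].
set c0 := zconf _ _ _; have <- : linit (ltm_of (cblank 'I_K.+1) F) = c0 by [].
move=> Es Hs; exists s; rewrite Es Em1; split=> // i Hi.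
by apply: leq_trans (Hs i Hi) _; rewrite /L; nia.
Qed.

(** * Prenex formulas as data *)

(** The hypothesis on the arguments is indexed through [nth]; its default is a constant, so it holds
    at every index and needs no membership side condition. *)
Fixpoint qbsf_nested_ind (P : qbsf -> Prop)
  (Hc : forall b, P (QConst b))
  (Ha : forall f n args, (forall i, P (nth (QConst false) args i)) -> P (QApp f n args))
  (Hand : forall a b, P a -> P b -> P (QAnd a b))
  (Hneg : forall a, P a -> P (QNeg a))
  (Hex : forall f n a, P a -> P (QEx f n a)) phi : P phi :=
  let rec := qbsf_nested_ind Hc Ha Hand Hneg Hex in
  match phi with
  | QConst b => Hc b
  | QApp f n args => Ha f n args
      ((fix go (s : seq qbsf) : forall i, P (nth (QConst false) s i) :=
        match s with
        | [::] => fun i => match i with 0 => Hc false | _.+1 => Hc false end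
        | a :: s' => fun i => match i with 0 => rec a | j.+1 => go s' j end
        end) args)
  | QAnd a b => Hand a b (rec a) (rec b)
  | QNeg a => Hneg a (rec a)
  | QEx f n a => Hex f n a (rec a)
  end.

Lemma size_bits_val (s : seq bool) : bits_val s < 2 ^ size s.
Proof.
elim/last_ind: s => //= s b; rewrite /bits_val foldl_rcons size_rcons expnS.
case: b => /=; lia.
Qed.

Lemma bits_val_rcons s b : bits_val (rcons s b) = (bits_val s).*2 + b.
Proof. by rewrite /bits_val foldl_rcons. Qed.

Lemma bits_val_inj s t : size s = size t -> bits_val s = bits_val t -> s = t.
Proof.
elim/last_ind: s t => [|s b IH] t; first by case: t.
case/lastP: t => [|t c]; rewrite !size_rcons // => -[Hs]; rewrite !bits_val_rcons => H.
have [H1 H2] : bits_val s = bits_val t /\ b = c by case: b H; case: c => /= H; lia.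
by rewrite (IH t Hs H1) H2.
Qed.

Fixpoint vec (m n : nat) : seq bool :=
  if m is m'.+1 then rcons (vec m' n./2) (odd n) else [::].

Lemma size_vec m n : size (vec m n) = m.
Proof. by elim: m n => //= m IH n; rewrite size_rcons IH. Qed.

Lemma vecK m n : n < 2 ^ m -> bits_val (vec m n) = n.
Proof.
elim: m n => [|m IH] n /=; first by case: n.
by rewrite expnS bits_val_rcons => H; rewrite IH; lia.
Qed.

Lemma bits_valK s : vec (size s) (bits_val s) = s.
Proof. by apply: bits_val_inj; rewrite ?size_vec // vecK // size_bits_val. Qed.

Lemma mem_all_tables t : t \in all_tables (size t).
Proof.
elim: t => //= b t IH; rewrite cats0 mem_cat.
by case: b; apply/orP; [right|left]; apply: map_f.
Qed.

Definition same_interp (I J : interp) :=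
  forall f n s, size s = n -> I f n s = J f n s.

Lemma same_upd I J f n g h : same_interp I J -> (forall s, size s = n -> g s = h s) ->
  same_interp (upd I f n g) (upd J f n h).
Proof.
move=> HI Hg f' n' s Hs; rewrite /upd; case: ifP => [/andP[_ /eqP E]|_]; last exact: HI.
by apply: Hg; rewrite -E.
Qed.

Lemma eq_qeval I J phi : qwf phi -> same_interp I J -> qeval I phi = qeval J phi.
Proof.
elim/qbsf_nested_ind: phi I J => //= [f n args IH|a b IHa IHb|a IHa|f n a IHa] I J.
- move=> /andP[/eqP Hs /(all_nthP (QConst false)) Hw] HI.
  have -> : map (qeval I) args = map (qeval J) args.
    apply: (@eq_from_nth _ false); rewrite !size_map // => i Hi.
    rewrite !(nth_map (QConst false)) //; apply: IH => //.
    exact: Hw.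
  by apply: HI; rewrite size_map.
- by move=> /andP[Ha Hb] HI; rewrite (IHa I J) // (IHb I J).
- by move=> Ha HI; rewrite (IHa I J).
- move=> Ha HI; apply: eq_has => t; apply: IHa => //.
  exact: same_upd.
Qed.

(** A well-formed formula applies [f] of arity [n] only to lists of length [n], and there every
    function is given by a table. *)
Lemma qeval_QExP I f n phi : qwf phi ->
  reflect (exists g, qeval (upd I f n g) phi) (qeval I (QEx f n phi)).
Proof.
move=> Hw; apply: (iffP hasP) => [[t _ H]|[g H]]; first by exists (table_fun t).
exists [seq g (vec n i) | i <- iota 0 (2 ^ n)].
  by rewrite -[X in all_tables X](size_iota 0 (2 ^ n)) -(size_map (fun i => g (vec n i))) mem_all_tables.
rewrite -/qeval; rewrite -(@eq_qeval (upd I f n g)) //; apply: same_upd => // s Hs.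
have Hb := size_bits_val s; rewrite Hs in Hb.
by rewrite /table_fun (nth_map 0) ?size_iota // nth_iota // add0n -Hs bits_valK.
Qed.

(* A prenex formula as data: the prefix lists (is existential, name, arity),
   a literal is (sign, name, arity, names of the argument propositions). *)
Definition quant : Type := (bool * nat * nat)%type.
Definition lit : Type := (bool * nat * nat * seq nat)%type.

Definition prop_var (p : nat) : qbsf := QApp p 0 [::].
(** With [dual] set, signs are flipped here and connectives and quantifiers are exchanged below, so
    the same data yield the De Morgan dual; one generator serves both normal forms. *)
Definition lit_qbsf (dual : bool) (l : lit) : qbsf :=
  let: (s, f, n, args) := l in
  let a := QApp f n (map prop_var args) in if s (+) dual then a else QNeg a.

Definition clause_qbsf (dual : bool) (c : seq lit) : qbsf :=
  foldr (fun l phi => if dual then QAnd (lit_qbsf dual l) phi else QOr (lit_qbsf dual l) phi)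
    (lit_qbsf dual (true, 0, 0, [::])) c.

(* Proposition 0 is forced to be false: it closes every clause, and its
   negation closes the conjunction. *)
Definition matrix_qbsf (dual : bool) (cs : seq (seq lit)) : qbsf :=
  foldr (fun c phi => if dual then QOr (clause_qbsf dual c) phi else QAnd (clause_qbsf dual c) phi)
    (lit_qbsf dual (false, 0, 0, [::])) cs.

Definition quant_qbsf (dual : bool) (q : quant) (phi : qbsf) : qbsf :=
  let: (ex, f, n) := q in if ex (+) dual then QEx f n phi else QForall f n phi.

Definition prenex_qbsf (dual : bool) (qs : seq quant) (cs : seq (seq lit)) : qbsf :=
  foldr (quant_qbsf dual) (matrix_qbsf dual cs) qs.

Definition enc_prop (p : nat) : seq bool := [:: false; true; false] ++ enc_nat p ++ enc_nat 0.
Definition enc_lit (dual : bool) (l : lit) : seq bool :=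
  let: (s, f, n, args) := l in
  (if s (+) dual then [::] else [:: true; false; false]) ++ [:: false; true; false]
    ++ enc_nat f ++ enc_nat n ++ flatten (map enc_prop args).
Definition enc_and := [:: false; true; true].
Definition enc_or := [:: true; false; false; false; true; true; true; false; false].
(** The code is in prefix notation and the folds are nested to the right, so each element
    contributes its own code between a fixed prefix and suffix. For a disjunction the suffix is the
    negation sign of the remaining part. This is why loops can print the formula from left to
    right. *)
Definition enc_clause (dual : bool) (c : seq lit) : seq bool :=
  flatten [seq (if dual then enc_and else enc_or) ++ enc_lit dual l
             ++ (if dual then [::] else [:: true; false; false]) | l <- c]
    ++ enc_lit dual (true, 0, 0, [::]).
Definition enc_matrix (dual : bool) (cs : seq (seq lit)) : seq bool :=
  flatten [seq (if dual then enc_or else enc_and) ++ enc_clause dual c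
             ++ (if dual then [:: true; false; false] else [::]) | c <- cs]
    ++ enc_lit dual (false, 0, 0, [::]).
Definition enc_quant (dual : bool) (q : quant) : seq bool :=
  let: (ex, f, n) := q in
  (if ex (+) dual then [::] else [:: true; false; false]) ++ [:: true; false; true]
    ++ enc_nat f ++ enc_nat n ++ (if ex (+) dual then [::] else [:: true; false; false]).
Definition enc_prenex (dual : bool) (qs : seq quant) (cs : seq (seq lit)) : seq bool :=
  flatten (map (enc_quant dual) qs) ++ enc_matrix dual cs.

Lemma enc_lit_qbsf dual l : enc (lit_qbsf dual l) = enc_lit dual l.
Proof.
case: l => [[[s f] n] args]; rewrite /lit_qbsf /enc_lit.
by case: (s (+) dual) => /=; rewrite -map_comp.
Qed.

Lemma enc_QOr a b : enc (QOr a b) = enc_or ++ enc a ++ [:: true; false; false] ++ enc b.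
Proof. by []. Qed.

Lemma enc_QAnd a b : enc (QAnd a b) = enc_and ++ enc a ++ enc b.
Proof. by []. Qed.

Lemma enc_clause_qbsf dual c : enc (clause_qbsf dual c) = enc_clause dual c.
Proof.
elim: c => [|l c IH]; first exact: enc_lit_qbsf.
rewrite /enc_clause map_cons [flatten _]/= -catA -/(enc_clause dual c) -IH.
by rewrite /clause_qbsf [foldr _ _ _]/=; case: dual IH => IH;
  rewrite ?enc_QOr ?enc_QAnd enc_lit_qbsf -!catA.
Qed.

Lemma enc_matrix_qbsf dual cs : enc (matrix_qbsf dual cs) = enc_matrix dual cs.
Proof.
elim: cs => [|c cs IH]; first exact: enc_lit_qbsf.
rewrite /enc_matrix map_cons [flatten _]/= -catA -/(enc_matrix dual cs) -IH.
by rewrite /matrix_qbsf [foldr _ _ _]/=; case: dual IH => IH;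
  rewrite ?enc_QOr ?enc_QAnd enc_clause_qbsf -!catA.
Qed.

Lemma enc_prenex_qbsf dual qs cs : enc (prenex_qbsf dual qs cs) = enc_prenex dual qs cs.
Proof.
elim: qs => [|[[ex f] n] qs IH]; first exact: enc_matrix_qbsf.
rewrite /enc_prenex map_cons [flatten _]/= -catA -/(enc_prenex dual qs cs) -IH.
by rewrite /prenex_qbsf [foldr _ _ _]/=; case: (ex (+) dual) => /=; rewrite -?catA.
Qed.

Lemma prenex_qbsf_CNF qs cs : is_CNF (prenex_qbsf false qs cs).
Proof.
have Hl l : is_literal (lit_qbsf false l).
  case: l => [[[s f] n] args] /=.
  by case: s; constructor => /=; rewrite all_map; apply/allP.
have Hc c : is_clause (clause_qbsf false c).
  by elim: c => [|l c IH] /=; [exact: (ClLit (Hl (true, 0, 0, [::])))|apply: ClOr => //; exact: (ClLit (Hl l))].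
elim: qs => [|[[[] f] n] qs IH] /=; [constructor|by constructor..].
by elim: cs => [|c cs IH] /=; [exact: (CnfCl (ClLit (Hl (false, 0, 0, [::]))))|apply: CnfAnd => //; exact: (CnfCl (Hc c))].
Qed.

Lemma prenex_qbsf_DNF qs cs : is_DNF (prenex_qbsf true qs cs).
Proof.
have Hl l : is_literal (lit_qbsf true l).
  case: l => [[[s f] n] args] /=.
  by case: s; constructor => /=; rewrite all_map; apply/allP.
have Hc c : is_term (clause_qbsf true c).
  by elim: c => [|l c IH] /=; [exact: (TmLit (Hl (true, 0, 0, [::])))|apply: TmAnd => //; exact: (TmLit (Hl l))].
elim: qs => [|[[[] f] n] qs IH] /=; [constructor|by constructor..].
by elim: cs => [|c cs IH] /=; [exact: (DnfTm (TmLit (Hl (false, 0, 0, [::]))))|apply: DnfOr => //; exact: (DnfTm (Hc c))].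
Qed.

Definition lit_true (I : interp) (l : lit) : bool :=
  let: (s, f, n, args) := l in I f n [seq I p 0 [::] | p <- args] == s.

Definition matrix_true (I : interp) (cs : seq (seq lit)) : bool :=
  all (has (lit_true I)) cs.

Lemma qeval_lit dual I l : qeval I (lit_qbsf dual l) = dual (+) lit_true I l.
Proof.
case: l => [[[s f] n] args]; case: dual; case: s => /=;
  by rewrite -map_comp -?[map (qeval I \o prop_var) _]/(map (fun p => I p 0 [::]) _);
     case: (I f n _).
Qed.

Lemma qeval_clause dual I c :
  qeval I (clause_qbsf dual c) = dual (+) (has (lit_true I) c || I 0 0 [::]).
Proof.
elim: c => [|l c IH]; first by rewrite qeval_lit /= eqb_id.
by rewrite /= /QOr; case: dual IH => /= ->; rewrite qeval_lit /=; case: lit_true; case: has; case: (I 0 0 _).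
Qed.

Lemma qeval_matrix dual I cs :
  qeval I (matrix_qbsf dual cs) = dual (+) (matrix_true I cs && ~~ I 0 0 [::]).
Proof.
elim: cs => [|c cs IH]; first by rewrite qeval_lit /=; case: (I 0 0 _).
rewrite /= /QOr; case: dual IH => /= ->; rewrite qeval_clause /=.
  by case: (has _ c); case: (matrix_true I cs); case: (I 0 0 _).
by case: (has _ c); case: (matrix_true I cs); case: (I 0 0 _).
Qed.

Lemma qeval_dual I qs cs :
  qeval I (prenex_qbsf true qs cs) = ~~ qeval I (prenex_qbsf false qs cs).
Proof.
elim: qs I => [|[[ex f] n] qs IH] I; first by rewrite !qeval_matrix.
case: ex => /=.
  by congr (~~ _); apply: eq_has => t; rewrite IH negbK.
by rewrite negbK; apply: eq_has => t; rewrite IH.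
Qed.

Fixpoint qsem (qs : seq quant) (P : interp -> Prop) (I : interp) : Prop :=
  if qs is (ex, f, n) :: qs' then
    if ex then exists g, qsem qs' P (upd I f n g) else forall g, qsem qs' P (upd I f n g)
  else P I.

Lemma qeval_prenexP I qs cs : qwf (prenex_qbsf false qs cs) ->
  qeval I (prenex_qbsf false qs cs) <->
  qsem qs (fun I => matrix_true I cs && ~~ I 0 0 [::]) I.
Proof.
elim: qs I => [|[[ex f] n] qs IH] I; first by rewrite qeval_matrix.
case: ex; rewrite -[qwf _]/(qwf (prenex_qbsf false qs cs)) => Hw.
  rewrite [prenex_qbsf _ _ _]/= ; split; first by move/(qeval_QExP _ _ _ Hw) => [g /(IH _ Hw)]; exists g.
  by move=> [g /(IH _ Hw) H]; apply/qeval_QExP => //; exists g.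
have -> : qeval I (prenex_qbsf false ((false, f, n) :: qs) cs) =
  ~~ qeval I (QEx f n (QNeg (prenex_qbsf false qs cs))) by [].
have HwN : qwf (QNeg (prenex_qbsf false qs cs)) := Hw.
split.
  move=> /negP H g; apply/IH => //; apply/negP => /negP Hg; apply: H.
  by apply/qeval_QExP => //; exists g.
move=> H; apply/negP => /(qeval_QExP _ _ _ HwN)[g]; have /IH := H g.
by rewrite /= => /(_ Hw) ->.
Qed.

Definition quant_key (q : quant) : nat * nat := (q.1.2, q.2).
Definition lit_ok (keys : seq (nat * nat)) (l : lit) : bool :=
  let: (s, f, n, args) := l in
  [&& (f, n) \in keys, size args == n & all (fun p => (p, 0) \in keys) args].

Lemma prenex_qbsf_wf dual qs cs bnd :
  all (all (lit_ok (map quant_key qs ++ bnd))) cs ->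
  (0, 0) \in map quant_key qs ++ bnd ->
  qwf (prenex_qbsf dual qs cs) && qclosed bnd (prenex_qbsf dual qs cs).
Proof.
have Hl keys l : lit_ok keys l -> qwf (lit_qbsf dual l) && qclosed keys (lit_qbsf dual l).
  case: l => [[[s f] n] args] /and3P[H1 H2 H3] /=.
  suff : [&& size (map prop_var args) == n, all qwf (map prop_var args),
    (f, n) \in keys & all (qclosed keys) (map prop_var args)].
    by case: (s (+) dual) => /= /and4P[-> -> -> ->].
  rewrite size_map H2 H1 /= !all_map; apply/andP; split; first by apply/allP.
  by apply: sub_all H3 => p /= ->.
have Hz keys s : (0, 0) \in keys -> lit_ok keys (s, 0, 0, [::]).
  by move=> H; rewrite /lit_ok H.
have Hc keys c : (0, 0) \in keys -> all (lit_ok keys) c ->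
   qwf (clause_qbsf dual c) && qclosed keys (clause_qbsf dual c).
  move=> H0; elim: c => [_|l c IH] /=; first exact: (Hl _ _ (Hz _ true H0)).
  move=> /andP[/Hl/andP[H1 H2] /IH/andP[H3 H4]].
  by move: H1 H2 H3 H4; rewrite /QOr; case: (dual) => /= -> -> -> ->.
elim: qs bnd => [|[[ex f] n] qs IH] bnd Hcs H0.
  elim: cs Hcs => [_|c cs IHc] /=; first exact: (Hl _ _ (Hz _ false H0)).
  move=> /andP[/(Hc _ _ H0)/andP[H1 H2] /IHc/andP[H3 H4]].
  by move: H1 H2 H3 H4; rewrite /QOr; case: (dual) => /= -> -> -> ->.
have E : map quant_key ((ex, f, n) :: qs) ++ bnd =i map quant_key qs ++ (f, n) :: bnd.
  by move=> p; rewrite /= inE !mem_cat inE /quant_key /=; rewrite orbCA.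
have := IH ((f, n) :: bnd).
rewrite -E => /(_ _ H0); have -> : all (all (lit_ok (map quant_key qs ++ (f, n) :: bnd))) cs.
  apply: sub_all Hcs; apply: sub_all => -[[[s f'] n'] args] /and3P[K1 K2 K3].
  by rewrite /lit_ok -E K1 K2; apply: sub_all K3 => p; rewrite E.
by move=> /(_ isT); rewrite /=; case: (ex (+) dual).
Qed.

(** * Blocks of equal quantifiers *)

Lemma qsem_cat qs1 qs2 P I : qsem (qs1 ++ qs2) P I <-> qsem qs1 (qsem qs2 P) I.
Proof.
elim: qs1 I => [|[[[] f] n] qs1 IH] I //=.
  by split=> -[g /IH H]; exists g.
by split=> H g; apply/IH.
Qed.

Definition override (I : interp) (keys : seq (nat * nat)) (G : interp) : interp :=
  fun f n => if (f, n) \in keys then G f n else I f n.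

Lemma upd_override I f n keys G : override (upd I f n (G f n)) keys G = override I ((f, n) :: keys) G.
Proof.
apply: functional_extensionality => f'; apply: functional_extensionality => n'.
rewrite /override /upd inE xpair_eqE; case: ((f', n') \in keys) => /=; first by rewrite orbT.
by rewrite orbF; case: andP => // -[/eqP-> /eqP->].
Qed.

(** The combined interpretation on the left is itself the joint witness for the enlarged block. If a
    key is repeated, the inner quantifier prevails on both sides. *)
Lemma override_upd I f n keys G g : override (upd I f n g) keys G =
  override I ((f, n) :: keys) (override (upd I f n g) keys G).
Proof.
apply: functional_extensionality => f'; apply: functional_extensionality => n'.
rewrite /override /upd inE xpair_eqE; case: ((f', n') \in keys) => /=; first by rewrite orbT.
by rewrite orbF; case: andP.
Qed.

Definition quants (ex : bool) (keys : seq (nat * nat)) : seq quant :=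
  [seq (ex, k.1, k.2) | k <- keys].

Lemma override0 I G : override I [::] G = I.
Proof. by []. Qed.

Lemma qsem_exists keys P I : qsem (quants true keys) P I <-> exists G, P (override I keys G).
Proof.
elim: keys I => [|[f n] keys IH] I /=.
  by split=> [H|[G]]; [exists I|]; rewrite override0.
split; first by move=> [g /IH[G H]]; rewrite override_upd in H; eexists; exact: H.
by move=> [G H]; exists (G f n); apply/IH; exists G; rewrite upd_override.
Qed.

Lemma qsem_forall keys P I : qsem (quants false keys) P I <-> forall G, P (override I keys G).
Proof.
elim: keys I => [|[f n] keys IH] I /=.
  by split=> [H G|/(_ I)]; rewrite override0.
split; first by move=> H G; have /IH := H (G f n) => /(_ G); rewrite upd_override.
by move=> H g; apply/IH => G; rewrite override_upd.
Qed.

(** * Unique readability of the encoding *)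

Lemma enc_nat_inj a b s t : enc_nat a ++ s = enc_nat b ++ t -> a = b /\ s = t.
Proof.
have bits_inj : forall n n', nat_bits n = nat_bits n' -> n = n'.
  move=> n n'; rewrite /nat_bits.
  have pinj : forall p q, pos_bits p = pos_bits q -> p = q.
    elim=> [p IH|p IH|] [q|q|] //= E; try (move/rcons_inj: E => [] //; by move=> /IH->);
      have := congr1 size E; rewrite ?size_rcons /=; try (by case: (q) => ? //=; rewrite size_rcons);
      by case: (p) => ? //=; rewrite size_rcons.
  have pnil : forall p, pos_bits p <> [::].
    by case=> //= q; case: (pos_bits q).
  case En: (BinNat.N.of_nat n) => [|p]; case En': (BinNat.N.of_nat n') => [|q] //.
  - by move=> _; lia.
  - by move=> /esym/pnil.
  - by move=> /pnil.
  - by move=> /pinj E; move: En En'; rewrite E; lia.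
have key : forall u v : seq bool, rcons (flatten [seq [:: true; b] | b <- u]) false ++ s =
    rcons (flatten [seq [:: true; b] | b <- v]) false ++ t -> u = v /\ s = t.
  elim=> [|c u IH] [|d v] //=; first by move=> [->].
  by move=> [-> /IH[-> ->]].
by move=> /key[/bits_inj-> ->].
Qed.

(** The code does not delimit the list of arguments; well-formedness does, because the printed arity
    fixes their number. *)
Lemma enc_inj phi psi s t : qwf phi -> qwf psi -> enc phi ++ s = enc psi ++ t ->
  phi = psi /\ s = t.
Proof.
elim/qbsf_nested_ind: phi psi s t =>
  [b|f n args IH|a b IHa IHb|a IHa|f n a IHa] [b'|f' n' args'|a' b'|a'|f' n' a'] s t //=.
- by move=> _ _ [-> ->].
- move=> /andP[/eqP Hs Hw] /andP[/eqP Hs' Hw'].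
  rewrite -!catA => -[] /enc_nat_inj[-> /enc_nat_inj[En]].
  have {Hs Hs'} : size args = size args' by rewrite Hs Hs'.
  move=> Hs E; suff [-> ->] : args = args' /\ s = t by rewrite En.
  elim: args args' IH Hs Hw Hw' s t E {En} => [|a args IHs] [|a' args'] //= IH [Hs] /andP[wa Hw] /andP[wa' Hw'] s t.
  rewrite -!catA => /(IH 0 _ _ _ wa wa')[/= -> E].
  by have [] := IHs args' (fun i => IH i.+1) Hs Hw Hw' _ _ E => -> ->.
- by move=> /andP[wa wb] /andP[wa' wb'] []; rewrite -!catA => /(IHa _ _ _ wa wa')[-> /(IHb _ _ _ wb wb')[-> ->]].
- by move=> wa wa' [] /(IHa _ _ _ wa wa')[-> ->].
- by move=> wa wa' []; rewrite -!catA => /enc_nat_inj[-> /enc_nat_inj[-> /(IHa _ _ _ wa wa')[-> ->]]].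
Qed.

(** * The game played on an alternating machine *)

Section Game.
Variable M : ATM.

Definition trans : Type := (aSt M * aSym M * dir)%type.
Definition headsym (c : aconf M) : aSym M := nth (ablank M) c.1.2 c.2.

Definition apply_tr (c : aconf M) (tr : trans) : aconf M :=
  let: (q', a, d) := tr in
  let: (tp', pos') := tape_move (ablank M) c.1.2 c.2 a d in (q', tp', pos').

Lemma asuccsE c : asuccs c = map (apply_tr c) (adelta c.1.1 (headsym c)).
Proof. by case: c => [[q tp] pos]. Qed.

(* A configuration without successors behaves as a halting one. *)
Definition verdict (q : aSt M) (a : aSym M) : option bool :=
  match @akind M q with
  | KAcc => Some true
  | KRej => Some false
  | KEx => if adelta q a is [::] then Some false else None
  | KUn => if adelta q a is [::] then Some true else None
  end.

(** An index out of range selects the first transition, so every value of a choice function is a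
    legal move. The stationary dummy occurs only without transitions, where a verdict exists
    already. *)
Definition select (q : aSt M) (a : aSym M) (i : nat) : trans :=
  let l := adelta q a in nth (head (q, a, DS) l) l i.

Definition anext (i : nat) (c : aconf M) : aconf M :=
  apply_tr c (select c.1.1 (headsym c) i).

(** Entering a halting configuration opens no block, in accordance with [alt_ok], which does not
    charge for it. *)
Definition next_block (q q' : aSt M) (k : nat) : nat :=
  if is_halting (@akind M q') || skind_eqb (@akind M q) (@akind M q') then k else k.+1.

Definition width : nat := \max_(p : aSt M * aSym M) size (adelta p.1 p.2).

(** There is one value more than [width]: it stands for the case that none of the [width] Boolean
    choice functions holds. *)
Definition choices : Type := nat -> nat -> 'I_width.+1.

(** Exhausted time counts as rejection; for runs that halt within [d] steps this case does not
    arise. *)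
Fixpoint outcome (ch : choices) (d t : nat) (c : aconf M) (k : nat) : bool :=
  match verdict c.1.1 (headsym c) with
  | Some v => v
  | None => if d is d'.+1 then
      let c' := anext (ch k t) c in outcome ch d' t.+1 c' (next_block c.1.1 c'.1.1 k)
    else false
  end.

Definition upd_ch (ch : choices) (k : nat) (c0 : nat -> 'I_width.+1) : choices :=
  fun k' => if k' == k then c0 else ch k'.

(** A move fixes the choices of a whole block, as a function of time; even blocks belong to the
    existential player. *)
Fixpoint game (j k : nat) (ch : choices) (P : choices -> Prop) : Prop :=
  if j is j'.+1 then
    if odd k then forall c0, game j' k.+1 (upd_ch ch k c0) P
    else exists c0, game j' k.+1 (upd_ch ch k c0) P
  else P ch.

Lemma outcome_ext ch1 ch2 d t c k :
  (forall k' s, t <= s < t + d -> ch1 k' s = ch2 k' s) ->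
  outcome ch1 d t c k = outcome ch2 d t c k.
Proof.
elim: d t c k => [|d IH] t c k H //=; case: (verdict _ _) => //.
by rewrite H ?IH // => [k' s Hs|]; rewrite ?H //; lia.
Qed.

(** Both games are played with the same moves; only what was fixed before block [k] may differ. *)
Lemma game_rel j k ch1 ch2 P1 P2 :
  (forall k', k <= k' -> ch1 k' =1 ch2 k') ->
  (forall e1 e2, (forall k', k' < k -> e1 k' =1 ch1 k' /\ e2 k' =1 ch2 k') ->
     (forall k', k <= k' -> e1 k' =1 e2 k') -> P1 e1 <-> P2 e2) ->
  game j k ch1 P1 <-> game j k ch2 P2.
Proof.
elim: j k ch1 ch2 => [|j IH] k ch1 ch2 Hch HP /=; first by apply: HP.
have key c0 : game j k.+1 (upd_ch ch1 k c0) P1 <-> game j k.+1 (upd_ch ch2 k c0) P2.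
  apply: IH => [k' Hk' s|e1 e2 H1 H2].
    by rewrite /upd_ch; case: eqP => // _; apply: Hch; apply: ltnW.
  apply: HP => [k' Hk'|k'].
    have [] := H1 k' (ltnW Hk'); rewrite /upd_ch; case: eqP => [E|//]; lia.
  rewrite leq_eqVlt => /orP[/eqP <- s|/H2 //].
  by have [-> ->] : e1 k s = c0 s /\ e2 k s = c0 s by
    have [E1 E2] := H1 k (leqnn _); rewrite E1 E2 /upd_ch eqxx.
case: ifP => _.
  by split=> H c0; apply/key.
by split=> -[c0 /key H]; exists c0.
Qed.

Lemma game_ext j k ch P1 P2 :
  (forall e, (forall k', k' < k -> e k' =1 ch k') -> P1 e <-> P2 e) ->
  (forall e1 e2, (forall k', e1 k' =1 e2 k') -> P2 e1 <-> P2 e2) ->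
  game j k ch P1 <-> game j k ch P2.
Proof.
move=> H12 H2; apply: game_rel => // e1 e2 He1 He2.
rewrite H12; last by move=> k' /He1[].
apply: H2 => k' s; case: (ltnP k' k) => [/He1[-> ->] //|/He2 //].
Qed.

Lemma game_const j k ch (b : bool) : game j k ch (fun=> b) <-> b.
Proof.
elim: j k ch => //= j IH k ch; case: ifP => _.
  by split=> [/(_ (fun=> ord0))/IH //|Hb c0]; apply/IH.
by split=> [[c0 /IH]//|Hb]; exists (fun=> ord0); apply/IH.
Qed.

Lemma next_mem c i : verdict c.1.1 (headsym c) = None -> anext i c \in asuccs c.
Proof.
rewrite /verdict asuccsE /anext /select => H.
have Hn : adelta c.1.1 (headsym c) <> [::] by move=> E; move: H; rewrite E; case: akind.
case: (adelta _ _) Hn => // tr l _; case: (ltnP i (size (tr :: l))) => Hi.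
  by rewrite -(nth_map _ c) //; apply: mem_nth; rewrite size_map.
by rewrite nth_default // mem_head.
Qed.

Lemma mem_next c c' : c' \in asuccs c -> exists i : 'I_width.+1, c' = anext i c.
Proof.
move=> Hc'; have Hi := Hc'; rewrite -index_mem {2}asuccsE size_map in Hi.
have Hi' : index c' (asuccs c) < width.+1.
  rewrite ltnS; apply: ltnW; apply: leq_trans Hi _.
  exact: (@bigmax_sup _ (c.1.1, headsym c)).
exists (Ordinal Hi'); rewrite /anext /select /= -(nth_map _ c) // -asuccsE.
by rewrite nth_index.
Qed.

Lemma verdict_halting c : is_halting (akind_of c) ->
  forall ch d t k, outcome ch d t c k = skind_eqb (akind_of c) KAcc.
Proof.
rewrite /akind_of => H ch d t k.
by case: d => [|d] /=; rewrite /verdict; case: akind H.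
Qed.

Lemma alt_ok_None d r p c : skind_eqb p (akind_of c) = false ->
  @alt_ok M d r (Some p) c -> alt_ok d r None c.
Proof. by case: d => [|d] /= ->. Qed.

Definition block_kind (c : aconf M) (k : nat) : Prop :=
  match akind_of c with KEx => ~~ odd k | KUn => odd k | _ => True end.

(** The earlier choices [ch] are arbitrary, because a run that is in block [k] reads none of the
    blocks before it. *)
Definition game_correct (j : nat) : Prop := forall k t d c ch r,
  block_kind c k -> halts_within d c -> alt_ok d r None c -> r <= j ->
  game j k ch (fun ch => outcome ch d t c k) <-> accepts_in d c.

Lemma outcome_shift ch d t c k : is_halting (akind_of c) ->
  outcome ch d t c k = outcome ch d t c k.+1.
Proof. by move=> H; rewrite !verdict_halting. Qed.

Lemma outcome_upd_step j k ch c0 d t c : verdict c.1.1 (headsym c) = None ->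
  game j k.+1 (upd_ch ch k c0) (fun ch => outcome ch d.+1 t c k) <->
  game j k.+1 (upd_ch ch k c0) (fun ch => outcome ch d t.+1 (anext (c0 t) c)
    (next_block c.1.1 (anext (c0 t) c).1.1 k)).
Proof.
move=> Hv; apply: game_ext => [e He|e1 e2 He]; last first.
  by rewrite (outcome_ext (ch2 := e2)) // => k' s _; exact: He.
by rewrite /= Hv He // /upd_ch eqxx.
Qed.

(** From time [t.+1] on, the entry for time [t] is never read again. *)
Lemma outcome_modify j k ch c0 i d t c q : 
  game j k.+1 (upd_ch ch k c0) (fun ch => outcome ch d t.+1 c q) <->
  game j k.+1 (upd_ch ch k (fun s => if s == t then i else c0 s))
    (fun ch => outcome ch d t.+1 c q).
Proof.
apply: game_rel => [k' Hk' s|e1 e2 H1 H2].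
  by rewrite /upd_ch; case: eqP => // E; lia.
rewrite (outcome_ext (ch2 := e2)) // => k' s /andP[Hs _].
case: (ltnP k k') => [/H2 //|Hk]; have [-> ->] := H1 k' Hk.
rewrite /upd_ch; case: eqP => // _; case: eqP => // E; lia.
Qed.

Lemma next_block_same (c c' : aconf M) k : akind_of c' = akind_of c ->
  next_block c.1.1 c'.1.1 k = k.
Proof. by rewrite /akind_of /next_block => ->; case: akind. Qed.

(** A change of kind opens block [k.+1], unless the successor halts; then its number stays [k], but
    no longer influences the outcome. *)
Lemma block_leave j (IHj : game_correct j) c c' k t d ch r :
  block_kind c k -> ~~ is_halting (akind_of c) -> akind_of c' <> akind_of c ->
  halts_within d c' -> alt_ok d r (Some (akind_of c)) c' -> r <= j ->
  game j k.+1 ch (fun ch => outcome ch d t c' (next_block c.1.1 c'.1.1 k)) <-> accepts_in d c'.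
Proof.
move=> Hb Hn Hk Hh Ha Hr.
have Hs : skind_eqb (akind_of c) (akind_of c') = false.
  by case: (akind_of c) Hk; case: (akind_of c').
have Hb' : block_kind c' k.+1.
  by move: Hb Hn Hs; rewrite /block_kind; case: (akind_of c); case: (akind_of c') => //= ->.
rewrite -(IHj k.+1 t d c' ch r Hb' Hh (alt_ok_None Hs Ha) Hr).
apply: game_ext => [e _|e1 e2 He]; last first.
  by rewrite (outcome_ext (ch2 := e2)) // => k' s _; exact: He.
rewrite /next_block -/(akind_of c') -/(akind_of c) Hs orbF; case: ifP => // H.
by rewrite -outcome_shift.
Qed.

Lemma skind_dec (a b : skind) : a = b \/ a <> b.
Proof. by case: a; case: b; try (by left); right. Qed.

(** Within a block a single player moves, and each time is passed once. Moves made one by one can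
    therefore be collected in one function of time, fixed when the block starts. *)
Lemma block_exists j (IHj : game_correct j) d t c k ch r :
  akind_of c = KEx -> ~~ odd k -> halts_within d c -> alt_ok d r (Some KEx) c -> r <= j ->
  (exists c0, game j k.+1 (upd_ch ch k c0) (fun ch => outcome ch d t c k)) <-> accepts_in d c.
Proof.
elim: d t c => [|d IH] t c Hk Ho /=; first by rewrite Hk.
rewrite Hk /= => Hh [_ Ha] Hr.
case Ev: (verdict c.1.1 (headsym c)) => [v|].
  have [Ed Ev'] : adelta c.1.1 (headsym c) = [::] /\ v = false.
    by move: Ev; rewrite /verdict -/(akind_of c) Hk; case: adelta => // -[<-].
  rewrite Ev' asuccsE Ed; split; first by move=> [c0 /(game_const _ _ _ false)].
  by case.
have Hbk : block_kind c k by rewrite /block_kind Hk.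
have Hnh : ~~ is_halting (akind_of c) by rewrite Hk.
have Ha' c' : c' \in asuccs c -> alt_ok d r (Some (akind_of c)) c' by rewrite Hk; exact: Ha.
split=> [[c0]|[c' Hc' Hacc]].
  have /= := outcome_upd_step j k ch c0 d t Ev; rewrite Ev => -> H.
  have Hm := next_mem (c0 t) Ev; exists (anext (c0 t) c) => //.
  case: (skind_dec (akind_of (anext (c0 t) c)) (akind_of c)) => Hs.
    rewrite next_block_same // in H.
    by apply/(IH t.+1 _ (etrans Hs Hk) Ho (Hh _ Hm) (Ha _ Hm) Hr); exists c0.
  exact: (proj1 (block_leave IHj t.+1 _ Hbk Hnh Hs (Hh _ Hm) (Ha' _ Hm) Hr) H).
have [i Ei] := mem_next Hc'.
suff [c0 H] : exists c0, game j k.+1 (upd_ch ch k c0)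
    (fun ch => outcome ch d t.+1 c' (next_block c.1.1 c'.1.1 k)).
  (* The move at time [t] is patched into the function found for the later times. *)
  exists (fun s => if s == t then i else c0 s).
  have /= := outcome_upd_step j k ch (fun s => if s == t then i else c0 s) d t Ev; rewrite Ev => ->.
  by rewrite eqxx -Ei -outcome_modify.
case: (skind_dec (akind_of c') (akind_of c)) => Hs.
  by rewrite next_block_same //; apply/(IH t.+1 _ (etrans Hs Hk) Ho (Hh _ Hc') (Ha _ Hc') Hr).
by exists (fun=> i); apply/(block_leave IHj t.+1 _ Hbk Hnh Hs (Hh _ Hc') (Ha' _ Hc') Hr).
Qed.

Lemma block_forall j (IHj : game_correct j) d t c k ch r :
  akind_of c = KUn -> odd k -> halts_within d c -> alt_ok d r (Some KUn) c -> r <= j ->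
  (forall c0, game j k.+1 (upd_ch ch k c0) (fun ch => outcome ch d t c k)) <-> accepts_in d c.
Proof.
elim: d t c => [|d IH] t c Hk Ho /=; first by rewrite Hk.
rewrite Hk /= => Hh [_ Ha] Hr.
case Ev: (verdict c.1.1 (headsym c)) => [v|].
  have [Ed Ev'] : adelta c.1.1 (headsym c) = [::] /\ v = true.
    by move: Ev; rewrite /verdict -/(akind_of c) Hk; case: adelta => // -[<-].
  rewrite Ev' asuccsE Ed; split=> // _ c0; exact/(game_const _ _ _ true).
have Hbk : block_kind c k by rewrite /block_kind Hk.
have Hnh : ~~ is_halting (akind_of c) by rewrite Hk.
have Ha' c' : c' \in asuccs c -> alt_ok d r (Some (akind_of c)) c' by rewrite Hk; exact: Ha.
split=> [H c' Hc'|H c0].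
  have [i Ei] := mem_next Hc'.
  have {}H c0 : game j k.+1 (upd_ch ch k c0)
    (fun ch => outcome ch d t.+1 c' (next_block c.1.1 c'.1.1 k)).
    have := H (fun s => if s == t then i else c0 s).
    have /= := outcome_upd_step j k ch (fun s => if s == t then i else c0 s) d t Ev; rewrite Ev => ->.
    by rewrite eqxx -Ei -outcome_modify.
  case: (skind_dec (akind_of c') (akind_of c)) => Hs.
    apply/(IH t.+1 _ (etrans Hs Hk) Ho (Hh _ Hc') (Ha _ Hc') Hr).
    by move=> c0; have := H c0; rewrite next_block_same.
  exact: (proj1 (block_leave IHj t.+1 _ Hbk Hnh Hs (Hh _ Hc') (Ha' _ Hc') Hr) (H (fun=> i))).
have /= := outcome_upd_step j k ch c0 d t Ev; rewrite Ev => ->.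
have Hm := next_mem (c0 t) Ev; have Hacc := H _ Hm.
case: (skind_dec (akind_of (anext (c0 t) c)) (akind_of c)) => Hs.
  by rewrite next_block_same //; exact: (proj2 (IH t.+1 _ (etrans Hs Hk) Ho (Hh _ Hm) (Ha _ Hm) Hr)).
by apply/(block_leave IHj t.+1 _ Hbk Hnh Hs (Hh _ Hm) (Ha' _ Hm) Hr).
Qed.

Lemma alt_ok_enter d r c : ~~ is_halting (akind_of c) -> @alt_ok M d r None c ->
  alt_ok d r.-1 (Some (akind_of c)) c /\ 0 < r.
Proof.
by case: d => [|d] /=; case: (akind_of c) => //= _ [H1 H2]; split.
Qed.

Theorem game_accepts j : game_correct j.
Proof.
elim: j => [|j IHj] k t d c ch r Hb Hh Ha Hr.
  case Hk: (is_halting (akind_of c)); last by have [|_] := alt_ok_enter _ Ha; rewrite ?Hk //; lia.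
  by rewrite /= verdict_halting //; case: d {Hh Ha} => [|d] /=; case: akind_of Hk.
case Hk: (is_halting (akind_of c)).
  rewrite (@game_ext _ _ _ _ (fun=> skind_eqb (akind_of c) KAcc)) //; last first.
    by move=> e _; rewrite verdict_halting //; split.
  by rewrite game_const; case: d {Hh Ha} => [|d] /=; case: akind_of Hk.
have [|Ha' Hr'] := alt_ok_enter _ Ha; first by rewrite Hk.
have Hrj : r.-1 <= j by lia.
case Ek: (akind_of c) Hk Ha' => // _ Ha'; move: Hb; rewrite /block_kind Ek => Hb.
  by rewrite /= (negbTE Hb); apply: block_exists Ha' Hrj.
by rewrite /= Hb; apply: block_forall Ha' Hrj.
Qed.

End Game.

(** * Formulas printed by loop programs *)

Definition qtmpl : Type := (bool * expr * expr)%type.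
Definition ltmpl : Type := (bool * expr * expr * gen expr)%type.

Definition gout_args (x : seq bool) (g : gen expr) (env : seq nat) : seq nat :=
  gev x (fun e env => [:: ev e env]) g env.
Definition lit_of (x : seq bool) (env : seq nat) (l : ltmpl) : lit :=
  let: (s, f, n, args) := l in (s, ev f env, ev n env, gout_args x args env).
Definition clauses_of (x : seq bool) (g : gen (seq ltmpl)) (env : seq nat) : seq (seq lit) :=
  gev x (fun c env => [:: map (lit_of x env) c]) g env.
Definition quants_of (x : seq bool) (g : gen qtmpl) (env : seq nat) : seq quant :=
  gev x (fun q env => [:: (q.1.1, ev q.1.2 env, ev q.2 env)]) g env.

Definition gcats (A B : Type) (f : A -> gen B) (l : seq A) : gen B :=
  foldr (fun a g => GCat (f a) g) GNil l.

Lemma gev_gcats A B C x (h : B -> seq nat -> seq C) (f : A -> gen B) l env :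
  gev x h (gcats f l) env = flatten [seq gev x h (f a) env | a <- l].
Proof. by elim: l => //= a l ->. Qed.

Lemma gscoped_gcats A B p (f : A -> gen B) l d :
  gscoped p d (gcats f l) = all (fun a => gscoped p d (f a)) l.
Proof. by elim: l => //= a l ->. Qed.

Definition bits (bs : seq bool) : gen bleaf := GLeaf (LBits bs).
Definition num (e : expr) : gen bleaf := GLeaf (LNat e).

Definition lit_gen (dual : bool) (l : ltmpl) : gen bleaf :=
  let: (s, f, n, args) := l in
  GCat (bits ((if s (+) dual then [::] else [:: true; false; false]) ++ [:: false; true; false]))
    (GCat (num f) (GCat (num n)
      (gbind args (fun e => GCat (bits [:: false; true; false]) (GCat (num e) (bits (enc_nat 0))))))).

Definition clause_gen (dual : bool) (c : seq ltmpl) : gen bleaf :=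
  GCat (bits (if dual then enc_or else enc_and)) (GCat
    (GCat (gcats (fun l => GCat (bits (if dual then enc_and else enc_or)) (GCat (lit_gen dual l)
         (bits (if dual then [::] else [:: true; false; false])))) c)
       (bits (enc_lit dual (true, 0, 0, [::]))))
    (bits (if dual then [:: true; false; false] else [::]))).

Definition quant_gen (dual : bool) (q : qtmpl) : gen bleaf :=
  let: (ex, f, n) := q in
  GCat (bits ((if ex (+) dual then [::] else [:: true; false; false]) ++ [:: true; false; true]))
    (GCat (num f) (GCat (num n) (bits (if ex (+) dual then [::] else [:: true; false; false])))).

Definition prenex_gen (dual : bool) (Q : gen qtmpl) (C : gen (seq ltmpl)) : gen bleaf :=
  GCat (gbind Q (quant_gen dual))
    (GCat (gbind C (clause_gen dual)) (bits (enc_lit dual (false, 0, 0, [::])))).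

Lemma gev_lit_gen dual x l env :
  gev x bleaf_out (lit_gen dual l) env = enc_lit dual (lit_of x env l).
Proof.
case: l => [[[s f] n] args] /=; rewrite -catA gev_gbind.
congr (_ ++ (_ ++ (_ ++ (_ ++ _)))).
rewrite /gout_args gev_flatten; apply: eq_gev => e env' /=.
by rewrite cats0.
Qed.

Lemma gev_prenex_gen dual x Q C env :
  gev x bleaf_out (prenex_gen dual Q C) env =
  enc_prenex dual (quants_of x Q env) (clauses_of x C env).
Proof.
rewrite /enc_prenex /enc_matrix /prenex_gen /= !gev_gbind !gev_flatten; congr (_ ++ (_ ++ _)).
  apply: eq_gev => -[[ex f] n] env' /=.
  by rewrite cats0 -catA.
apply: eq_gev => c env'; rewrite /= cats0 /enc_clause -!catA; congr (_ ++ (_ ++ _)).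
rewrite gev_gcats -map_comp; congr flatten; apply: eq_map => l /=.
by rewrite gev_lit_gen.
Qed.

Definition ltmpl_scoped (d : nat) (l : ltmpl) : bool :=
  let: (_, f, n, args) := l in [&& evars d f, evars d n & gscoped evars d args].
Definition qtmpl_scoped (d : nat) (q : qtmpl) : bool := evars d q.1.2 && evars d q.2.

Lemma prenex_logspace dual Q C :
  gscoped qtmpl_scoped 1 Q -> gscoped (fun d => all (ltmpl_scoped d)) 1 C ->
  logspace_computable (fun x =>
    enc (prenex_qbsf dual (quants_of x Q [:: size x]) (clauses_of x C [:: size x]))).
Proof.
move=> HQ HC.
have HS : gscoped bleaf_scoped 1 (prenex_gen dual Q C).
  rewrite /= andbT; apply/andP; split.
    apply: gscoped_gbind HQ => d [[ex f] n] /andP[/= -> ->] //.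
  apply: gscoped_gbind HC => d c Hc /=; rewrite !andbT gscoped_gcats.
  apply: sub_all Hc => -[[[s f] n] args] /and3P[/= -> -> Ha] /=; rewrite andbT.
  by apply: gscoped_gbind Ha => d' e /= ->.
have [T [K H]] := gen_logspace HS.
exists T, K => x; have [s [H1 H2 H3]] := H x; exists s; split=> //.
by rewrite H2 gev_prenex_gen enc_prenex_qbsf.
Qed.

(** Truth at all leaves, by recursion on the program: properties of all printed clauses are proved
    through it instead of through the printed list. *)
Fixpoint gsat (A : Type) (x : seq bool) (P : A -> seq nat -> Prop) (g : gen A)
    (env : seq nat) : Prop :=
  match g with
  | GNil => True
  | GLeaf a => P a env
  | GCat g1 g2 => gsat x P g1 env /\ gsat x P g2 env
  | GFor e g => forall i, i < ev e env -> gsat x P g (rcons env i)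
  | GLt e1 e2 g1 g2 => if ev e1 env < ev e2 env then gsat x P g1 env else gsat x P g2 env
  | GIn e g1 g2 => if nth false x (ev e env) then gsat x P g1 env else gsat x P g2 env
  end.

Lemma gsat_iff A x (P Q : A -> seq nat -> Prop) g env :
  (forall a env, P a env <-> Q a env) -> gsat x P g env <-> gsat x Q g env.
Proof.
move=> H; elim: g env => //= [g1 IH1 g2 IH2|e g IH|e1 e2 g1 IH1 g2 IH2|e g1 IH1 g2 IH2] env.
- by rewrite IH1 IH2.
- by split=> HH i /HH/IH.
- by case: ifP.
- by case: ifP.
Qed.

Lemma all_gev A B x (p : B -> bool) (f : A -> seq nat -> seq B) g env :
  all p (gev x f g env) <-> gsat x (fun a env => all p (f a env)) g env.
Proof.
elim: g env => //= [g1 IH1 g2 IH2|e g IH|e1 e2 g1 IH1 g2 IH2|e g1 IH1 g2 IH2] env.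
- by rewrite all_cat -IH1 -IH2; split=> [/andP//|[-> ->]].
- have -> : all p (flatten [seq gev x f g (rcons env i) | i <- iota 0 (ev e env)]) =
      all (fun i => all p (gev x f g (rcons env i))) (iota 0 (ev e env)).
    by elim: (iota _ _) => //= i s IHs; rewrite all_cat IHs.
  split=> [/allP H i Hi|H]; first by apply/IH; apply: H; rewrite mem_iota.
  by apply/allP => i; rewrite mem_iota => /H/IH.
- by case: ifP.
- by case: ifP.
Qed.

Lemma gsat_gcats (A : eqType) B x (P : B -> seq nat -> Prop) (f : A -> gen B) l env :
  gsat x P (gcats f l) env <-> forall a, a \in l -> gsat x P (f a) env.
Proof.
elim: l => [|a l IH] /=; first by split.
rewrite IH; split=> [[H1 H2] b|H]; first by rewrite inE => /orP[/eqP->|/H2].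
by split=> [|b Hb]; apply: H; rewrite inE ?eqxx ?Hb ?orbT.
Qed.

Lemma gsat_gcats_enum (A : finType) B x (P : B -> seq nat -> Prop) (f : A -> gen B) env :
  gsat x P (gcats f (enum A)) env <-> forall a, gsat x P (f a) env.
Proof.
rewrite gsat_gcats; split=> H a; last by move=> _; exact: H.
by apply: H; rewrite mem_enum.
Qed.

Lemma gsat_gcats_iota B x (P : B -> seq nat -> Prop) (f : nat -> gen B) n env :
  gsat x P (gcats f (iota 0 n)) env <-> forall i, i < n -> gsat x P (f i) env.
Proof. by rewrite gsat_gcats; split=> H i; have := H i; rewrite mem_iota. Qed.

(** Such an expression refers only to the input length, hence keeps its value inside nested
    loops. *)
Lemma ev_outer e n env : evars 1 e -> ev e (n :: env) = ev e [:: n].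
Proof. by elim: e => //= [[]|a IHa b IHb /andP[/IHa-> /IHb->]|a IHa b IHb /andP[/IHa-> /IHb->]]. Qed.

(** * The formula of a machine *)

Section Formula.
Variables (M : ATM) (em eR : expr) (k0 : nat).

Local Notation W := (width M).

(* Function symbols are pairs (index, kind); the kinds are the input cells,
   the W choice bits, the tape symbols and the states. *)
Definition nkinds : nat := W.+1 + #|aSym M| + #|aSt M|.
(** This pairing uses only a product and a sum, so that loop programs can compute names from their
    counters. *)
Definition fname (i kd : nat) : nat := i * nkinds + kd.
Definition kind_sym (a : aSym M) : nat := W.+1 + enum_rank a.
Definition kind_st (q : aSt M) : nat := W.+1 + #|aSym M| + enum_rank q.

Lemma kind_sym_lt a : kind_sym a < nkinds.
Proof. by rewrite /kind_sym /nkinds -addnA ltn_add2l (leq_trans (ltn_ord _)) ?leq_addr. Qed.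
Lemma kind_st_lt q : kind_st q < nkinds.
Proof. by rewrite /kind_st /nkinds ltn_add2l ltn_ord. Qed.
Lemma kind_choice_lt i : i <= W -> i < nkinds.
Proof. by rewrite /nkinds; lia. Qed.

Lemma fname_div i kd : kd < nkinds -> fname i kd %/ nkinds = i.
Proof. by move=> H; rewrite /fname divnMDl ?divn_small ?addn0 //; lia. Qed.
Lemma fname_mod i kd : kd < nkinds -> fname i kd %% nkinds = kd.
Proof. by move=> H; rewrite /fname modnMDl modn_small. Qed.

Lemma fname_eq i j kd kd' : kd < nkinds -> kd' < nkinds ->
  (fname i kd == fname j kd') = (i == j) && (kd == kd').
Proof.
move=> H H'; apply/eqP/andP => [E|[/eqP-> /eqP->] //].
split; apply/eqP; first by rewrite -(fname_div i H) E fname_div.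
by rewrite -(fname_mod i H) E fname_mod.
Qed.

Lemma kind_sym_eq a b : (kind_sym a == kind_sym b) = (a == b).
Proof. by rewrite /kind_sym eqn_add2l (inj_eq val_inj) (inj_eq enum_rank_inj). Qed.
Lemma kind_st_eq a b : (kind_st a == kind_st b) = (a == b).
Proof. by rewrite /kind_st eqn_add2l (inj_eq val_inj) (inj_eq enum_rank_inj). Qed.
Lemma kind_sym_st a q : (kind_sym a == kind_st q) = false.
Proof.
apply/negbTE; rewrite neq_ltn /kind_sym /kind_st -addnA ltn_add2l.
by rewrite (leq_trans (ltn_ord _)) ?leq_addr.
Qed.

Definition efname (i : expr) (kd : nat) : expr := EAdd (EMul i (EConst nkinds)) (EConst kd).
Definition em2 : expr := EAdd em em.
(** Each of the [eR] rounds has an existential and a universal block. *)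
Definition eK : expr := EMul (EConst 2) eR.

(* Propositions 0 and 1 are the constants; bit j of the vector variable v
   (0: time, 1 and 2: positions) is proposition 3 j + v + 2. *)
Definition ebit (v : nat) (j : nat) : expr := EAdd (EMul (EVar j) (EConst 3)) (EConst v.+2).
Definition econst (b : bool) : expr := EConst b.

Definition vfree (d v : nat) : gen expr := GFor em (GLeaf (ebit v d)).
Definition vzero : gen expr := GFor em (GLeaf (econst false)).
(* With [up = false] the vectors u 0 1..1, with [up = true] their successors
   u 1 0..0, the carry stopping at the bit given by variable c. *)
Definition vstep (d v : nat) (up : bool) (c : nat) : gen expr :=
  GFor em (GLt (EVar d) (EVar c) (GLeaf (ebit v d))
    (GLt (EVar c) (EVar d) (GLeaf (econst (~~ up))) (GLeaf (econst up)))).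
Definition vset (d v : nat) (b : bool) (c : nat) : gen expr :=
  GFor em (GLt (EVar d) (EVar c) (GLeaf (ebit v d))
    (GLt (EVar c) (EVar d) (GLeaf (ebit v d)) (GLeaf (econst b)))).

Definition lIn (s : bool) (i : expr) (v : gen expr) : ltmpl := (s, efname i 0, em, v).
Definition lG (s : bool) (k : expr) (i : nat) (v : gen expr) : ltmpl := (s, efname k i.+1, em, v).
Definition lC (s : bool) (a : aSym M) (t p : gen expr) : ltmpl :=
  (s, efname (EConst 0) (kind_sym a), em2, GCat t p).
Definition lH (s : bool) (k : expr) (q : aSt M) (t p : gen expr) : ltmpl :=
  (s, efname k (kind_st q), em2, GCat t p).

Definition one_gen : gen (seq ltmpl) := GLeaf [:: (true, econst true, EConst 0, GNil)].

(** Input bits are indexed by a loop counter, tape cells by vectors. The input predicates link the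
    two: number [i] is meant to hold at position [i] alone, and the last one, which propagates
    itself, at all positions behind the input. *)
Definition input_gen : gen (seq ltmpl) :=
  GCat (GLeaf [:: lIn true (EConst 0) vzero])
  (GCat (GFor (EVar 0) (GFor em (GLeaf
     [:: lIn false (EVar 1) (vstep 3 1 false 2);
         lIn true (EAdd (EVar 1) (EConst 1)) (vstep 3 1 true 2)])))
  (GCat (GFor em (GLeaf [:: lIn false (EVar 0) (vstep 2 1 false 1);
                            lIn true (EVar 0) (vstep 2 1 true 1)]))
  (GCat (GFor (EVar 0) (GIn (EVar 1)
     (GLeaf [:: lIn false (EVar 1) (vfree 2 1); lC true (ainput M true) vzero (vfree 2 1)])
     (GLeaf [:: lIn false (EVar 1) (vfree 2 1); lC true (ainput M false) vzero (vfree 2 1)])))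
  (GCat (GLeaf [:: lIn false (EVar 0) (vfree 1 1); lC true (ablank M) vzero (vfree 1 1)])
    (GLeaf [:: lH true (EConst k0) (astart M) vzero vzero]))))).

(** The head literal certifies that the cell is not being written: the two positions carry opposite
    constants at the bit given by variable 2. Variable 1 is the carry position of the time, variable
    3 the block. *)
Definition frame_gen : gen (seq ltmpl) :=
  GFor em (GFor em (GFor eK
    (gcats (fun s : bool => gcats (fun q => gcats (fun a => GLeaf
      [:: lH false (EVar 3) q (vstep 4 0 false 1) (vset 4 1 s 2);
          lC false a (vstep 4 0 false 1) (vset 4 2 (~~ s) 2);
          lC true a (vstep 4 0 true 1) (vset 4 2 (~~ s) 2)])
     (enum (aSym M))) (enum (aSt M))) [:: false; true]))).

(** These literals negate the premise that [i] is the least index whose choice function holds, or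
    [W] if none does. Some are positive, so the clauses are Horn with respect to the guessed
    tableau; the choice functions are fixed further outside. *)
Definition choice_lits (d i : nat) : seq ltmpl :=
  [seq lG true (EVar 2) i' (vstep d 0 false 1) | i' <- iota 0 i] ++
  (if i < W then [:: lG false (EVar 2) i (vstep d 0 false 1)] else [::]).

Definition step_clause (d : nat) q a i (p : gen expr) (l : ltmpl) : gen (seq ltmpl) :=
  GLeaf (lH false (EVar 2) q (vstep d 0 false 1) p :: lC false a (vstep d 0 false 1) p
    :: choice_lits d i ++ [:: l]).

(** A left move uses the successor pattern backwards. Position zero has no predecessor, and its own
    clause keeps the head there. *)
Definition step_gen (q : aSt M) (a : aSym M) (i : nat) : gen (seq ltmpl) :=
  let: (q', a', dr) := select q a i in
  let hd d p p' := step_clause d q a i p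
    (lH true (EAdd (EVar 2) (EConst (next_block q q' 0))) q' (vstep d 0 true 1) p') in
  GCat (step_clause 3 q a i (vfree 3 1) (lC true a' (vstep 3 0 true 1) (vfree 3 1)))
    match dr with
    | DS => hd 3 (vfree 3 1) (vfree 3 1)
    | DR => GFor em (hd 4 (vstep 4 1 false 3) (vstep 4 1 true 3))
    | DL => GCat (hd 3 vzero vzero) (GFor em (hd 4 (vstep 4 1 true 3) (vstep 4 1 false 3)))
    end.

Definition choice_range : seq nat := iota 0 W.+1.

Definition steps_gen : gen (seq ltmpl) :=
  GFor em (GFor eK (gcats (fun q => gcats (fun a =>
    if verdict q a is None then gcats (step_gen q a) choice_range else GNil)
    (enum (aSym M))) (enum (aSt M)))).

Definition reject_gen : gen (seq ltmpl) :=
  GFor eK (gcats (fun q => gcats (fun a =>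
    if verdict q a is Some false then GLeaf
      [:: lH false (EVar 1) q (vfree 2 0) (vfree 2 1); lC false a (vfree 2 0) (vfree 2 1)]
    else GNil) (enum (aSym M))) (enum (aSt M))).

Definition matrix_gen : gen (seq ltmpl) :=
  GCat one_gen (GCat input_gen (GCat frame_gen (GCat steps_gen reject_gen))).

Definition ktmpl : Type := (expr * expr)%type.
Definition quants_gen (ex : bool) (g : gen ktmpl) : gen qtmpl :=
  gbind g (fun k => GLeaf (ex, k.1, k.2)).

Definition choice_keys (k : expr) : gen ktmpl :=
  gcats (fun i => GLeaf (efname k i.+1, em)) (iota 0 W).

(** Head predicates are quantified also for the number after the last block, since step clauses of
    the last block may name it. *)
Definition witness_keys : gen ktmpl :=
  GCat (GLeaf (EConst 0, EConst 0)) (GCat (GLeaf (EConst 1, EConst 0))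
  (GCat (GFor (EAdd (EVar 0) (EConst 1)) (GLeaf (efname (EVar 1) 0, em)))
  (GCat (gcats (fun a => GLeaf (efname (EConst 0) (kind_sym a), em2)) (enum (aSym M)))
    (GFor (EAdd eK (EConst 1))
      (gcats (fun q => GLeaf (efname (EVar 1) (kind_st q), em2)) (enum (aSt M))))))).

Definition vector_keys : gen ktmpl :=
  GFor em (gcats (fun v => GLeaf (ebit v 1, EConst 0)) (iota 0 3)).

Definition choice_quants : gen qtmpl :=
  GFor eR (GCat (quants_gen true (choice_keys (EMul (EConst 2) (EVar 1))))
    (quants_gen false (choice_keys (EAdd (EMul (EConst 2) (EVar 1)) (EConst 1))))).

Definition prefix_gen : gen qtmpl :=
  GCat choice_quants (GCat (quants_gen true witness_keys) (quants_gen false vector_keys)).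

Hypotheses (em1 : evars 1 em) (eR1 : evars 1 eR).

Lemma evars_outer d e : 0 < d -> evars 1 e -> evars d e.
Proof.
move=> Hd; elim: e => //= [v|a IHa b IHb /andP[/IHa-> /IHb->] //|a IHa b IHb /andP[/IHa-> /IHb->] //].
by case: v.
Qed.

Lemma em_scoped d : evars d.+1 em.
Proof. exact: evars_outer. Qed.
Lemma eR_scoped d : evars d.+1 eR.
Proof. exact: evars_outer. Qed.

Lemma matrix_scoped : gscoped (fun d => all (ltmpl_scoped d)) 1 matrix_gen.
Proof.
rewrite /= !em_scoped !eR_scoped /=; apply/and3P; split.
- rewrite andbT; apply/andP; split; rewrite gscoped_gcats; apply/allP => q _;
  by rewrite gscoped_gcats; apply/allP => a _ /=; rewrite !em_scoped.
- rewrite gscoped_gcats; apply/allP => q _; rewrite gscoped_gcats; apply/allP => a _.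
  case: (verdict q a) => [//|].
  rewrite -[gscoped _ _ _]/(gscoped (fun d => all (ltmpl_scoped d)) 3 (gcats (step_gen q a) choice_range)).
  rewrite gscoped_gcats; apply/allP => i _.
  have Hc d j : 2 < d -> all (ltmpl_scoped d) (choice_lits d j).
    case: d => // d Hd; rewrite /choice_lits all_cat; apply/andP; split.
      by rewrite all_map; apply/allP => i' _; rewrite /= !em_scoped /= !ltnS leqnn; lia.
    by case: ifP => // _; rewrite /= !em_scoped /= !ltnS leqnn; lia.
  rewrite /step_gen; case: (select q a i) => -[q' a'] dr.
  have := Hc 3 i isT; have := Hc 4 i isT; rewrite /choice_lits !all_cat => /andP[h1 h2] /andP[h3 h4].
  by case: dr; rewrite /= ?em_scoped /= ?all_cat ?h1 ?h2 ?h3 ?h4 /= ?em_scoped.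
- rewrite gscoped_gcats; apply/allP => q _; rewrite gscoped_gcats; apply/allP => a _.
  by case: (verdict q a) => [[]|] //=; rewrite !em_scoped.
Qed.

Lemma prefix_scoped : gscoped qtmpl_scoped 1 prefix_gen.
Proof.
pose ks d (k : ktmpl) := evars d k.1 && evars d k.2.
have Hq ex g d : gscoped ks d g -> gscoped qtmpl_scoped d (quants_gen ex g).
  by apply: gscoped_gbind => d' k.
rewrite /= eR1 !Hq //=.
- by rewrite /qtmpl_scoped /= !em_scoped.
- by rewrite gscoped_gcats; apply/allP => q _; rewrite /ks /= !em_scoped.
- by rewrite gscoped_gcats; apply/allP => q _; rewrite /ks /= !em_scoped.
- by rewrite gscoped_gcats; apply/allP => i _; rewrite /ks /= em_scoped.
- by rewrite gscoped_gcats; apply/allP => i _; rewrite /ks /= em_scoped.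
Qed.

End Formula.

(** * The printed clauses with loops unfolded *)

Section FormulaSemantics.
Variables (M : ATM) (em eR : expr) (k0 : nat) (x : seq bool).
Hypotheses (em1 : evars 1 em) (eR1 : evars 1 eR).

Local Notation n := (size x).
Local Notation W := (width M).
Local Notation m := (ev em [:: size x]).
Local Notation R := (ev eR [:: size x]).
Local Notation NK := (nkinds M).

Definition afree v := [seq j * 3 + v.+2 | j <- iota 0 m].
Definition azero := [seq 0 | j <- iota 0 m].
Definition astep v (up : bool) c :=
  [seq if j < c then j * 3 + v.+2 else if c < j then nat_of_bool (~~ up) else nat_of_bool up | j <- iota 0 m].
Definition aset v (b : bool) c :=
  [seq if j < c then j * 3 + v.+2 else if c < j then j * 3 + v.+2 else nat_of_bool b | j <- iota 0 m].

Lemma em_ev env : ev em (n :: env) = m.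
Proof. exact: ev_outer. Qed.
Lemma eR_ev env : ev eR (n :: env) = R.
Proof. exact: ev_outer. Qed.

Lemma gout_for env body (h : nat -> nat) :
  (forall i, gout_args x body (rcons (n :: env) i) = [:: h i]) ->
  gout_args x (GFor em body) (n :: env) = [seq h j | j <- iota 0 m].
Proof.
move=> H; rewrite /gout_args /= em_ev; elim: (iota 0 m) => //= i s ->.
by have := H i; rewrite /gout_args /= => ->.
Qed.

Lemma nth_last (env : seq nat) d i : size env = d -> nth 0 (rcons env i) d = i.
Proof. by move=> <-; rewrite nth_rcons ltnn eqxx. Qed.
Lemma nth_old (env : seq nat) d c i : size env = d -> c < d -> nth 0 (rcons env i) c = nth 0 env c.
Proof. by move=> <- H; rewrite nth_rcons H. Qed.

Lemma args_vfree env d v : size (n :: env) = d ->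
  gout_args x (vfree em d v) (n :: env) = afree v.
Proof.
by move=> H; apply: gout_for => i; rewrite /gout_args [gev _ _ _ _]/= -rcons_cons nth_last.
Qed.

Lemma args_vzero env : gout_args x (vzero em) (n :: env) = azero.
Proof. by apply: gout_for. Qed.

Lemma args_vstep env d v up c : size (n :: env) = d -> c < d ->
  gout_args x (vstep em d v up c) (n :: env) = astep v up (nth 0 (n :: env) c).
Proof.
move=> H Hc; apply: gout_for => i; rewrite /gout_args [gev _ _ _ _]/= -rcons_cons nth_last //.
by rewrite (nth_old _ H) //; case: ifP => //; case: ifP.
Qed.

Lemma args_vset env d v b c : size (n :: env) = d -> c < d ->
  gout_args x (vset em d v b c) (n :: env) = aset v b (nth 0 (n :: env) c).
Proof.
move=> H Hc; apply: gout_for => i; rewrite /gout_args [gev _ _ _ _]/= -rcons_cons nth_last //.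
by rewrite (nth_old _ H) //; case: ifP => //; case: ifP.
Qed.

Definition litIn s i v : lit := (s, fname M i 0, m, v).
Definition litG s k i v : lit := (s, fname M k i.+1, m, v).
Definition litC s (a : aSym M) t p : lit := (s, fname M 0 (kind_sym a), m + m, t ++ p).
Definition litH s k (q : aSt M) t p : lit := (s, fname M k (kind_st q), m + m, t ++ p).

Lemma lit_of_In env s i v :
  lit_of x (n :: env) (lIn M em s i v) = litIn s (ev i (n :: env)) (gout_args x v (n :: env)).
Proof. by rewrite /= em_ev. Qed.
Lemma lit_of_G env s k i v :
  lit_of x (n :: env) (lG M em s k i v) = litG s (ev k (n :: env)) i (gout_args x v (n :: env)).
Proof. by rewrite /= em_ev. Qed.
Lemma lit_of_C env s a t p :
  lit_of x (n :: env) (lC em s a t p) =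
  litC s a (gout_args x t (n :: env)) (gout_args x p (n :: env)).
Proof. by rewrite /= em_ev. Qed.
Lemma lit_of_H env s k q t p :
  lit_of x (n :: env) (lH em s k q t p) =
  litH s (ev k (n :: env)) q (gout_args x t (n :: env)) (gout_args x p (n :: env)).
Proof. by rewrite /= em_ev. Qed.

Definition litsChoice k c i : seq lit :=
  [seq litG true k i' (astep 0 false c) | i' <- iota 0 i] ++
  (if i < W then [:: litG false k i (astep 0 false c)] else [::]).

Lemma lits_of_choice env d i : size (n :: env) = d -> 1 < d ->
  map (lit_of x (n :: env)) (choice_lits M em d i) =
  litsChoice (nth 0 (n :: env) 2) (nth 0 (n :: env) 1) i.
Proof.
move=> H Hd; rewrite /choice_lits /litsChoice map_cat -map_comp.
congr (_ ++ _); last by case: ifP => //= _; rewrite em_ev args_vstep.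
by apply: eq_map => i'; rewrite /= em_ev args_vstep.
Qed.

(* [P] will be truth under an interpretation as well as well-formedness. *)
Section Clauses.
Variable P : seq lit -> Prop.
Definition step_P k c q a i p l : Prop :=
  P (litH false k q (astep 0 false c) p :: litC false a (astep 0 false c) p ::
      litsChoice k c i ++ [:: l]).

Definition head_P k c q a i q' p p' : Prop :=
  step_P k c q a i p (litH true (k + next_block q q' 0) q' (astep 0 true c) p').

Definition input_P : Prop :=
  [/\ P [:: litIn true 0 azero],
   forall i e, i < n -> e < m -> P [:: litIn false i (astep 1 false e); litIn true i.+1 (astep 1 true e)],
   forall e, e < m -> P [:: litIn false n (astep 1 false e); litIn true n (astep 1 true e)],
   forall i, i < n -> P [:: litIn false i (afree 1); litC true (ainput M (nth false x i)) azero (afree 1)] &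
   P [:: litIn false n (afree 1); litC true (ablank M) azero (afree 1)] /\
   P [:: litH true k0 (astart M) azero azero]].

Definition frame_P : Prop := forall c j k s q a, c < m -> j < m -> k < 2 * R ->
  P [:: litH false k q (astep 0 false c) (aset 1 s j);
        litC false a (astep 0 false c) (aset 2 (~~ s) j);
        litC true a (astep 0 true c) (aset 2 (~~ s) j)].

Definition steps_P : Prop := forall c k q a i, c < m -> k < 2 * R ->
  verdict q a = None -> i <= W ->
  let: (q', a', dr) := select q a i in
  step_P k c q a i (afree 1) (litC true a' (astep 0 true c) (afree 1)) /\
  match dr with
  | DS => head_P k c q a i q' (afree 1) (afree 1)
  | DR => forall e, e < m -> head_P k c q a i q' (astep 1 false e) (astep 1 true e)
  | DL => head_P k c q a i q' azero azero /\
      forall e, e < m -> head_P k c q a i q' (astep 1 true e) (astep 1 false e)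
  end.

Definition reject_P : Prop := forall k q a, k < 2 * R -> verdict q a = Some false ->
  P [:: litH false k q (afree 0) (afree 1); litC false a (afree 0) (afree 1)].

Definition tmpl_P (c : seq ltmpl) (env : seq nat) : Prop := P (map (lit_of x env) c).
Arguments tmpl_P : simpl never.

Lemma gsat_step_clause env d q a i p l : size (n :: env) = d -> 1 < d ->
  gsat x tmpl_P (step_clause em d q a i p l) (n :: env) <->
  step_P (nth 0 (n :: env) 2) (nth 0 (n :: env) 1) q a i (gout_args x p (n :: env))
    (lit_of x (n :: env) l).
Proof.
move=> H Hd; rewrite [gsat _ _ _ _]/= /tmpl_P !map_cons map_cat lits_of_choice //.
by rewrite lit_of_H lit_of_C args_vstep.
Qed.

Definition argsE := (lit_of_In, lit_of_G, lit_of_C, lit_of_H, args_vfree, args_vzero, args_vstep, args_vset).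

Lemma gsat_input : gsat x tmpl_P (input_gen M em k0) [:: n] <-> input_P.
Proof.
rewrite /input_gen [gsat _ _ _ _]/=.
split=> [[H1 [H2 [H3 [H4 [H5 H6]]]]]|[H1 H2 H3 H4 [H5 H6]]].
  split=> [|i e Hi He|e He|i Hi|].
  - by move: H1; rewrite /tmpl_P !map_cons !argsE.
  - have := H2 i Hi e; rewrite em_ev => /(_ He).
    by rewrite /tmpl_P !map_cons !argsE //= addn1.
  - by have := H3 e He; rewrite /tmpl_P !map_cons !argsE.
  - by have := H4 i Hi; case: (nth false x i); rewrite /tmpl_P !map_cons !argsE.
  - by split; [move: H5|move: H6]; rewrite /tmpl_P !map_cons !argsE.
split; first by rewrite /tmpl_P !map_cons !argsE.
split=> [i Hi e|].
  by rewrite em_ev => He; rewrite /tmpl_P !map_cons !argsE //= addn1; apply: H2.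
split=> [e He|]; first by rewrite /tmpl_P !map_cons !argsE //=; apply: H3.
split=> [i Hi|].
  by have := H4 i Hi; case: (nth false x i); rewrite /tmpl_P !map_cons !argsE.
by split; rewrite /tmpl_P !map_cons !argsE.
Qed.

Lemma gsat_frame : gsat x tmpl_P (frame_gen M em eR) [:: n] <-> frame_P.
Proof.
rewrite /frame_gen [gsat _ _ _ _]/=.
split=> [H c j k s q a Hc Hj Hk|H c Hc j].
  have := H c Hc j; rewrite em_ev => /(_ Hj k); rewrite eR_ev => /(_ Hk)[H1 [H2 _]].
  move: H1 H2; rewrite !gsat_gcats_enum => /(_ q) H1 /(_ q) H2.
  move: H1 H2; rewrite !gsat_gcats_enum => /(_ a) H1 /(_ a) H2.
  by case: s; [move: H2|move: H1]; rewrite [gsat _ _ _ _]/= /tmpl_P !map_cons !argsE.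
rewrite em_ev => Hj k; rewrite eR_ev => Hk.
by split; [|split=> //]; rewrite gsat_gcats_enum => q; rewrite gsat_gcats_enum => a;
   rewrite [gsat _ _ _ _]/= /tmpl_P !map_cons !argsE //=; [apply: (H c j k false)|apply: (H c j k true)].
Qed.

Lemma gsat_step c k q a i :
  gsat x tmpl_P (step_gen em q a i) [:: n; c; k] <->
  let: (q', a', dr) := select q a i in
  step_P k c q a i (afree 1) (litC true a' (astep 0 true c) (afree 1)) /\
  match dr with
  | DS => head_P k c q a i q' (afree 1) (afree 1)
  | DR => forall e, e < m -> head_P k c q a i q' (astep 1 false e) (astep 1 true e)
  | DL => head_P k c q a i q' azero azero /\
      forall e, e < m -> head_P k c q a i q' (astep 1 true e) (astep 1 false e)
  end.
Proof.
rewrite /step_gen; case: (select q a i) => -[q' a'] dr.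
have EC g1 g2 env : gsat x tmpl_P (GCat g1 g2) env = (gsat x tmpl_P g1 env /\ gsat x tmpl_P g2 env) by [].
have EF g : gsat x tmpl_P (GFor em g) [:: n; c; k] = forall e, e < m -> gsat x tmpl_P g [:: n; c; k; e].
  by rewrite /= em_ev.
rewrite EC gsat_step_clause // lit_of_C args_vfree // args_vstep //.
have EH d p p' env : size (n :: env) = d -> 2 < d ->
  gsat x tmpl_P (step_clause em d q a i p
    (lH em true (EAdd (EVar 2) (EConst (next_block q q' 0))) q' (vstep em d 0 true 1) p')) (n :: env) <->
  head_P (nth 0 (n :: env) 2) (nth 0 (n :: env) 1) q a i q' (gout_args x p (n :: env)) (gout_args x p' (n :: env)).
  by move=> H Hd; rewrite gsat_step_clause ?lit_of_H ?args_vstep //; lia.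
case: dr.
- rewrite EC EF EH // args_vzero.
  split=> -[H1 [H2 H3]]; split=> //; split=> // e He; have := H3 e He; rewrite EH // !args_vstep //.
- by rewrite EH // args_vfree.
- rewrite EF; split=> -[H1 H3]; split=> // e He; have := H3 e He; rewrite EH // !args_vstep //.
Qed.

Lemma gsat_steps : gsat x tmpl_P (steps_gen M em eR) [:: n] <-> steps_P.
Proof.
have E c k q a : gsat x tmpl_P (if verdict q a is None then gcats (step_gen em q a) (choice_range M) else GNil) [:: n; c; k]
   <-> (verdict q a = None -> forall i, i <= W -> gsat x tmpl_P (step_gen em q a i) [:: n; c; k]).
  case: (verdict q a) => [v|]; first by split.
  rewrite /choice_range gsat_gcats_iota; split=> [H _ i Hi|H i Hi]; exact: H.
split=> [H c k q a i Hc Hk Hv Hi|H c Hc k Hk].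
  apply/gsat_step; move: (H c Hc k); rewrite -/gsat [_ < _]/= eR_ev => /(_ Hk).
  by rewrite gsat_gcats_enum => /(_ q); rewrite gsat_gcats_enum => /(_ a)/E/(_ Hv)/(_ i Hi).
rewrite -/gsat /= eR_ev in Hk *.
rewrite gsat_gcats_enum => q; rewrite gsat_gcats_enum => a; apply/E => Hv i Hi.
by apply/gsat_step; exact: H.
Qed.

Lemma gsat_reject : gsat x tmpl_P (reject_gen M em eR) [:: n] <-> reject_P.
Proof.
have E k q a : gsat x tmpl_P (if verdict q a is Some false then GLeaf
      [:: lH em false (EVar 1) q (vfree em 2 0) (vfree em 2 1); lC em false a (vfree em 2 0) (vfree em 2 1)]
    else GNil) [:: n; k]
   <-> (verdict q a = Some false -> P [:: litH false k q (afree 0) (afree 1); litC false a (afree 0) (afree 1)]).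
  case: (verdict q a) => [[]|]; [by split| |by split].
  rewrite [gsat _ _ _ _]/= /tmpl_P !map_cons !argsE //=.
  by split=> [H _|]; [|apply].
split=> [H k q a Hk Hv|H k Hk].
  move: (H k); rewrite -/gsat [_ < _]/= => /(_ Hk).
  by rewrite gsat_gcats_enum => /(_ q); rewrite gsat_gcats_enum => /(_ a)/E/(_ Hv).
rewrite -/gsat gsat_gcats_enum => q; rewrite gsat_gcats_enum => a; apply/E; exact: H.
Qed.

Lemma gsat_matrix : gsat x tmpl_P (matrix_gen M em eR k0) [:: n] <->
  P [:: (true, 1, 0, [::])] /\ [/\ input_P, frame_P, steps_P & reject_P].
Proof.
split=> [[H1 [/gsat_input H2 [/gsat_frame H3 [/gsat_steps H4 /gsat_reject H5]]]]|[H1 [H2 H3 H4 H5]]].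
  by [].
split=> //; split; first exact/gsat_input.
by split; [exact/gsat_frame|split; [exact/gsat_steps|exact/gsat_reject]].
Qed.

End Clauses.

Lemma all_clauses (p : pred (seq lit)) :
  all p (clauses_of x (matrix_gen M em eR k0) [:: n]) <->
  p [:: (true, 1, 0, [::])] /\ [/\ input_P p, frame_P p, steps_P p & reject_P p].
Proof.
rewrite -gsat_matrix all_gev; apply: gsat_iff => c env.
by rewrite /= andbT.
Qed.

End FormulaSemantics.

(** * The quantifier prefix and closedness of the formula *)

Section Prefix.
Variables (M : ATM) (em eR : expr) (k0 : nat) (x : seq bool).
Hypotheses (em1 : evars 1 em) (eR1 : evars 1 eR).

Local Notation n := (size x).
Local Notation W := (width M).
Local Notation m := (ev em [:: size x]).
Local Notation R := (ev eR [:: size x]).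

Let emE env : ev em (n :: env) = m := em_ev x em1 env.

Definition keysG k := [seq (fname M k i.+1, m) | i <- iota 0 W].
Definition keysE : seq (nat * nat) := [:: (0, 0); (1, 0)] ++
  [seq (fname M i 0, m) | i <- iota 0 (n + 1)] ++
  [seq (fname M 0 (kind_sym a), m + m) | a <- enum (aSym M)] ++
  flatten [seq [seq (fname M k (kind_st q), m + m) | q <- enum (aSt M)] | k <- iota 0 (2 * R + 1)].
Definition keysA : seq (nat * nat) :=
  flatten [seq [seq (j * 3 + v.+2, 0) | v <- iota 0 3] | j <- iota 0 m].

Definition game_quants b r : seq quant :=
  flatten [seq quants true (keysG (2 * b)) ++ quants false (keysG (2 * b + 1)) | b <- iota b r].

Lemma flatten_map1 (A B : Type) (f : A -> B) s : flatten [seq [:: f a] | a <- s] = map f s.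
Proof. by elim: s => //= a s ->. Qed.

Definition keys_of (g : gen ktmpl) (env : seq nat) : seq (nat * nat) :=
  gev x (fun k env => [:: (ev k.1 env, ev k.2 env)]) g env.

Lemma quants_of_keys ex g env :
  quants_of x (quants_gen ex g) env = quants ex (keys_of g env).
Proof.
rewrite /quants_of /quants_gen gev_gbind /quants /keys_of -flatten_map1 gev_flatten.
exact: eq_gev.
Qed.

Lemma keys_of_gcats (A : Type) (f : A -> ktmpl) l env :
  keys_of (gcats (fun a => GLeaf (f a)) l) env = [seq (ev (f a).1 env, ev (f a).2 env) | a <- l].
Proof. by rewrite /keys_of gev_gcats flatten_map1. Qed.

Lemma keys_of_choice k env v : ev k (n :: env) = v ->
  keys_of (choice_keys M em k) (n :: env) = keysG v.
Proof.
move=> <-; rewrite /choice_keys keys_of_gcats; apply: eq_map => i /=.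
by rewrite emE.
Qed.

Lemma keys_of_witness : keys_of (witness_keys M em eR) [:: n] = keysE.
Proof.
have EC g1 g2 env : keys_of (GCat g1 g2) env = keys_of g1 env ++ keys_of g2 env by [].
rewrite /witness_keys !EC keys_of_gcats; congr (_ :: (_ :: (_ ++ (_ ++ _)))).
  rewrite -[RHS]flatten_map1 /keys_of [LHS]/=; congr flatten; apply: eq_map => i.
  by rewrite emE.
rewrite {1}/keys_of [LHS]/=; congr flatten; apply: eq_map => k.
rewrite -/(keys_of _ _) keys_of_gcats; apply: eq_map => q /=.
by rewrite emE.
Qed.

Lemma quants_of_prefix : quants_of x (prefix_gen M em eR) [:: n] =
  game_quants 0 R ++ quants true keysE ++ quants false keysA.
Proof.
have EC g1 g2 env : quants_of x (GCat g1 g2) env = quants_of x g1 env ++ quants_of x g2 env by [].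
rewrite /prefix_gen 2!EC !quants_of_keys keys_of_witness; congr (_ ++ (_ ++ _)).
rewrite /choice_quants {1}/quants_of [LHS]/= /game_quants; congr flatten; apply: eq_map => b.
rewrite -/(quants_of _ (quants_gen true _) _) -/(quants_of _ (quants_gen false _) _).
by rewrite !quants_of_keys; congr (quants _ _ ++ quants _ _); apply: keys_of_choice.
Qed.

Definition keys := map quant_key (quants_of x (prefix_gen M em eR) [:: n]) ++ [::].

Lemma quant_key_quants ex s : map quant_key (quants ex s) = s.
Proof. by rewrite -map_comp -[RHS]map_id; apply: eq_map => -[]. Qed.

Lemma keys_mem p : p \in keys = [|| p \in map quant_key (game_quants 0 R), p \in keysE | p \in keysA].
Proof. by rewrite /keys cats0 quants_of_prefix 2!map_cat 2!mem_cat !quant_key_quants. Qed.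

Lemma mem_keysG k i : k < 2 * R -> i < W -> (fname M k i.+1, m) \in keys.
Proof.
move=> Hk Hi; rewrite keys_mem; apply/orP; left.
rewrite /game_quants map_flatten -map_comp; apply/flatten_mapP.
exists (k %/ 2); first by rewrite mem_iota; lia.
rewrite /= map_cat !quant_key_quants mem_cat.
have Hm : (fname M k i.+1, m) \in keysG k.
  by apply/mapP; exists i; rewrite // mem_iota.
have [E|E] : (k = 2 * (k %/ 2)) \/ (k = 2 * (k %/ 2) + 1) by lia.
  by rewrite -E Hm.
by rewrite -E Hm orbT.
Qed.

Lemma mem_key0 : (0, 0) \in keys.
Proof. by rewrite keys_mem /keysE !mem_cat !inE !orbT. Qed.

Lemma mem_key1 : (1, 0) \in keys.
Proof. by rewrite keys_mem /keysE !mem_cat !inE /= !orbT. Qed.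

Lemma mem_keyIn i : i <= n -> (fname M i 0, m) \in keysE.
Proof.
move=> Hi; rewrite /keysE !mem_cat; apply/orP; right; apply/orP; left.
by apply/mapP; exists i; rewrite // mem_iota; lia.
Qed.

Lemma mem_keyC (a : aSym M) : (fname M 0 (kind_sym a), m + m) \in keysE.
Proof.
rewrite /keysE !mem_cat; do 2 (apply/orP; right); apply/orP; left.
by apply/mapP; exists a; rewrite // mem_enum.
Qed.

Lemma mem_keyH k (q : aSt M) : k <= 2 * R -> (fname M k (kind_st q), m + m) \in keysE.
Proof.
move=> Hk; rewrite /keysE !mem_cat; do 3 (apply/orP; right).
apply/flatten_mapP; exists k; first by rewrite mem_iota; lia.
by apply/mapP; exists q; rewrite // mem_enum.
Qed.

Lemma mem_keyA j v : j < m -> v < 3 -> (j * 3 + v.+2, 0) \in keysA.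
Proof.
move=> Hj Hv; apply/flatten_mapP; exists j; first by rewrite mem_iota.
by apply/mapP; exists v; rewrite // mem_iota.
Qed.

Local Arguments lit_ok : simpl never.

Definition args_ok (s : seq nat) := (size s == m) && all (fun p => (p, 0) \in keys) s.

Lemma args_ok_map (f : nat -> nat) : (forall j, j < m -> (f j, 0) \in keys) ->
  args_ok [seq f j | j <- iota 0 m].
Proof.
move=> H; rewrite /args_ok size_map size_iota eqxx all_map; apply/allP => j.
by rewrite mem_iota => /H.
Qed.

Lemma mem_key_bit j v : j < m -> v < 3 -> (j * 3 + v.+2, 0) \in keys.
Proof. by move=> Hj Hv; rewrite keys_mem mem_keyA ?orbT. Qed.

Lemma mem_key_bool (b : bool) : (nat_of_bool b, 0) \in keys.
Proof. by case: b; [exact: mem_key1|exact: mem_key0]. Qed.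

Lemma afree_ok v : v < 3 -> args_ok (afree em x v).
Proof. by move=> Hv; apply: args_ok_map => j Hj; apply: mem_key_bit. Qed.
Lemma azero_ok : args_ok (azero em x).
Proof. by apply: args_ok_map => j Hj; apply: mem_key0. Qed.
Lemma astep_ok v b c : v < 3 -> args_ok (astep em x v b c).
Proof.
move=> Hv; apply: args_ok_map => j Hj.
by case: ifP => _; [exact: mem_key_bit|case: ifP => _; exact: mem_key_bool].
Qed.
Lemma aset_ok v b c : v < 3 -> args_ok (aset em x v b c).
Proof.
move=> Hv; apply: args_ok_map => j Hj.
by case: ifP => _; [|case: ifP => _]; [exact: mem_key_bit|exact: mem_key_bit|exact: mem_key_bool].
Qed.

Lemma litIn_ok s i v : i <= n -> args_ok v -> lit_ok keys (litIn M em x s i v).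
Proof. by move=> Hi /andP[H1 H2]; rewrite /lit_ok /= H1 H2 keys_mem mem_keyIn ?orbT. Qed.
Lemma litG_ok s k i v : k < 2 * R -> i < W -> args_ok v -> lit_ok keys (litG M em x s k i v).
Proof. by move=> Hk Hi /andP[H1 H2]; rewrite /lit_ok /= H1 H2 mem_keysG. Qed.
Lemma litC_ok s (a : aSym M) t p : args_ok t -> args_ok p -> lit_ok keys (litC em x s a t p).
Proof.
move=> /andP[/eqP H1 H2] /andP[/eqP H3 H4].
by rewrite /lit_ok /= size_cat H1 H3 eqxx all_cat H2 H4 keys_mem mem_keyC ?orbT.
Qed.
Lemma litH_ok s k (q : aSt M) t p : k <= 2 * R -> args_ok t -> args_ok p ->
  lit_ok keys (litH em x s k q t p).
Proof.
move=> Hk /andP[/eqP H1 H2] /andP[/eqP H3 H4].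
by rewrite /lit_ok /= size_cat H1 H3 eqxx all_cat H2 H4 keys_mem mem_keyH ?orbT.
Qed.

Lemma litsChoice_ok k c i : k < 2 * R -> i <= W -> all (lit_ok keys) (litsChoice M em x k c i).
Proof.
move=> Hk Hi; rewrite /litsChoice all_cat; apply/andP; split.
  rewrite all_map; apply/allP => i'; rewrite mem_iota add0n => /andP[_ Hi'].
  by apply: litG_ok; [|exact: leq_trans Hi' Hi|exact: astep_ok].
by case: ifP => // Hi'; rewrite all_seq1 litG_ok // astep_ok.
Qed.

Lemma next_block0 (q : aSt M) q' : next_block q q' 0 <= 1.
Proof. by rewrite /next_block; case: ifP. Qed.

Lemma clauses_ok : k0 <= 2 * R ->
  all (all (lit_ok keys)) (clauses_of x (matrix_gen M em eR k0) [:: n]).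
Proof.
have ok1 l : lit_ok keys l -> all (lit_ok keys) [:: l] by rewrite all_seq1.
have ok2 l l' : lit_ok keys l -> lit_ok keys l' -> all (lit_ok keys) [:: l; l'].
  by move=> H H'; apply/andP; split=> //; exact: ok1.
have ok3 l l' l'' : lit_ok keys l -> lit_ok keys l' -> lit_ok keys l'' -> all (lit_ok keys) [:: l; l'; l''].
  by move=> H H' H''; apply/andP; split=> //; exact: ok2.
move=> Hk0; apply/all_clauses => //; split; first by apply: ok1; rewrite /lit_ok mem_key1.
split.
- split; [|move=> i e Hi He|move=> e He|move=> i Hi|split].
  + exact: ok1 (litIn_ok _ (leq0n _) azero_ok).
  + by apply: ok2; apply: litIn_ok; rewrite ?(ltnW Hi) //; exact: astep_ok.
  + by apply: ok2; apply: litIn_ok; rewrite ?leqnn //; exact: astep_ok.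
  + by apply: ok2; [apply: litIn_ok|apply: litC_ok]; rewrite ?(ltnW Hi) //; [exact: afree_ok|exact: azero_ok|exact: afree_ok].
  + by apply: ok2; [apply: litIn_ok|apply: litC_ok]; rewrite ?leqnn //; [exact: afree_ok|exact: azero_ok|exact: afree_ok].
  + exact: ok1 (litH_ok _ _ Hk0 azero_ok azero_ok).
- move=> c j k s q a Hc Hj Hk.
  by apply: ok3; [apply: litH_ok; first exact: ltnW|apply: litC_ok|apply: litC_ok];
    (exact: astep_ok || exact: aset_ok).
- move=> c k q a i Hc Hk Hv Hi; case: (select q a i) => -[q' a'] dr.
  have Hs p l : args_ok p -> lit_ok keys l -> step_P em x (all (lit_ok keys)) k c q a i p l.
    move=> Hp Hl; have H1 := litH_ok false q (ltnW Hk) (astep_ok false c (isT : 0 < 3)) Hp.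
    have H2 := litC_ok false a (astep_ok false c (isT : 0 < 3)) Hp.
    rewrite /step_P -cat1s all_cat all_seq1 H1 -cat1s all_cat all_seq1 H2.
    by rewrite all_cat litsChoice_ok // all_seq1.
  have Hh p p' : args_ok p -> args_ok p' -> head_P em x (all (lit_ok keys)) k c q a i q' p p'.
    move=> Hp Hp'; apply: Hs => //; apply: litH_ok => //; last exact: astep_ok.
    by have := next_block0 q q'; lia.
  split; first by apply: Hs; [exact: afree_ok|apply: litC_ok; [exact: astep_ok|exact: afree_ok]].
  case: dr; [split; [|move=> e He]| |move=> e He].
  + exact: Hh azero_ok azero_ok.
  + by apply: Hh; exact: astep_ok.
  + by apply: Hh; exact: afree_ok.
  + by apply: Hh; exact: astep_ok.
- move=> k q a Hk Hv.
  by apply: ok2; [apply: litH_ok; first exact: ltnW|apply: litC_ok]; exact: afree_ok.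
Qed.

Lemma formula_wf dual : k0 <= 2 * R ->
  let phi := prenex_qbsf dual (quants_of x (prefix_gen M em eR) [:: n])
     (clauses_of x (matrix_gen M em eR k0) [:: n]) in
  qwf phi && qclosed [::] phi.
Proof. by move=> H; apply: prenex_qbsf_wf; [exact: clauses_ok|exact: mem_key0]. Qed.

End Prefix.

(** * Truth of the matrix *)

(** The right-hand side is the condition negated by the choice literals; at [i = w] it says that no
    index satisfies [p]. *)
Lemma find_iota_eq (p : pred nat) w i : i <= w ->
  (find p (iota 0 w) == i) = ~~ has p (iota 0 i) && ((i < w) ==> p i).
Proof.
move=> Hi; rewrite -(subnKC Hi) iotaD find_cat size_iota add0n.
case Hh: (has p (iota 0 i)).
  by have := Hh; rewrite has_find size_iota => H; rewrite ltn_eqF.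
rewrite /= -[X in _ == X]addn0 eqn_add2l.
case: (w - i) => [|k] /=; first by rewrite addn0 ltnn.
by rewrite addnS ltnS leq_addr /=; case: (p i).
Qed.

Section Rules.
Variables (M : ATM) (em eR : expr) (k0 : nat) (x : seq bool).
Hypotheses (em1 : evars 1 em) (eR1 : evars 1 eR).

Local Notation n := (size x).
Local Notation W := (width M).
Local Notation m := (ev em [:: size x]).
Local Notation R := (ev eR [:: size x]).

Definition V (f : nat -> bool) : seq bool := [seq f j | j <- iota 0 m].
Definition stepf (up : bool) c (u : nat -> bool) j :=
  if j < c then u j else if c < j then ~~ up else up.
Definition setf (b : bool) c (u : nat -> bool) j :=
  if j < c then u j else if c < j then u j else b.
Definition V0 := V (fun=> false).

Variables (fIn : nat -> seq bool -> bool) (idx : nat -> seq bool -> nat).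
Variables (fC : aSym M -> seq bool -> seq bool -> bool).
Variables (fH : nat -> aSt M -> seq bool -> seq bool -> bool).
Variable (u : nat -> nat -> bool).

Definition input_R : Prop :=
  [/\ fIn 0 V0,
   forall i e, i < n -> e < m -> fIn i (V (stepf false e (u 1))) -> fIn i.+1 (V (stepf true e (u 1))),
   forall e, e < m -> fIn n (V (stepf false e (u 1))) -> fIn n (V (stepf true e (u 1))),
   forall i, i < n -> fIn i (V (u 1)) -> fC (ainput M (nth false x i)) V0 (V (u 1)) &
   (fIn n (V (u 1)) -> fC (ablank M) V0 (V (u 1))) /\ fH k0 (astart M) V0 V0].

Definition frame_R : Prop := forall c j k s q a, c < m -> j < m -> k < 2 * R ->
  fH k q (V (stepf false c (u 0))) (V (setf s j (u 1))) ->
  fC a (V (stepf false c (u 0))) (V (setf (~~ s) j (u 2))) ->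
  fC a (V (stepf true c (u 0))) (V (setf (~~ s) j (u 2))).

Definition head_R k c q a i q' p p' : Prop :=
  let T := V (stepf false c (u 0)) in
  fH k q T p -> fC a T p -> idx k T = i ->
  fH (k + next_block q q' 0) q' (V (stepf true c (u 0))) p'.

Definition steps_R : Prop := forall c k q a i, c < m -> k < 2 * R ->
  verdict q a = None -> i <= W ->
  let T := V (stepf false c (u 0)) in
  let: (q', a', dr) := select q a i in
  (fH k q T (V (u 1)) -> fC a T (V (u 1)) -> idx k T = i ->
     fC a' (V (stepf true c (u 0))) (V (u 1))) /\
  match dr with
  | DS => head_R k c q a i q' (V (u 1)) (V (u 1))
  | DR => forall e, e < m -> head_R k c q a i q' (V (stepf false e (u 1))) (V (stepf true e (u 1)))
  | DL => head_R k c q a i q' V0 V0 /\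
      forall e, e < m -> head_R k c q a i q' (V (stepf true e (u 1))) (V (stepf false e (u 1)))
  end.

Definition reject_R : Prop := forall k q a, k < 2 * R -> verdict q a = Some false ->
  ~~ (fH k q (V (u 0)) (V (u 1)) && fC a (V (u 0)) (V (u 1))).

(** Abstract predicates are used because the rules are applied both to arbitrary models and to the
    tableau of the true run. *)
Definition rules : Prop := [/\ input_R, frame_R, steps_R & reject_R].
End Rules.

Section MatrixRules.
Variables (M : ATM) (em eR : expr) (k0 : nat) (x : seq bool).
Hypotheses (em1 : evars 1 em) (eR1 : evars 1 eR).

Local Notation n := (size x).
Local Notation W := (width M).
Local Notation m := (ev em [:: size x]).
Local Notation R := (ev eR [:: size x]).

Variable J : interp.
Definition JIn i v := J (fname M i 0) m v.
Definition Jidx k v := find (fun i => J (fname M k i.+1) m v) (iota 0 W).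
Definition JC (a : aSym M) t p := J (fname M 0 (kind_sym a)) (m + m) (t ++ p).
Definition JH k (q : aSt M) t p := J (fname M k (kind_st q)) (m + m) (t ++ p).
Definition Jbit v j := J (j * 3 + v.+2) 0 [::].

Hypotheses (J0 : J 0 0 [::] = false) (J1 : J 1 0 [::] = true).

Local Notation Jargs s := [seq J p 0 [::] | p <- s].
Lemma Jbool (b : bool) : J b 0 [::] = b.
Proof. by case: b. Qed.
Lemma Jafree v : Jargs (afree em x v) = V em x (Jbit v).
Proof. by rewrite /afree -map_comp. Qed.
Lemma Jazero : Jargs (azero em x) = V0 em x.
Proof. by rewrite /azero -map_comp; apply: eq_map => j /=. Qed.
Lemma Jastep v up c : Jargs (astep em x v up c) = V em x (stepf up c (Jbit v)).
Proof.
rewrite /astep -map_comp; apply: eq_map => j /=; rewrite /stepf.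
by case: ifP => //; case: ifP; rewrite Jbool.
Qed.
Lemma Jaset v b c : Jargs (aset em x v b c) = V em x (setf b c (Jbit v)).
Proof.
rewrite /aset -map_comp; apply: eq_map => j /=; rewrite /setf.
by case: ifP => //; case: ifP; rewrite ?Jbool.
Qed.

Lemma trueIn s i v : lit_true J (litIn M em x s i v) = (JIn i (Jargs v) == s).
Proof. by []. Qed.
Lemma trueC s a t p : lit_true J (litC em x s a t p) = (JC a (Jargs t) (Jargs p) == s).
Proof. by rewrite /= map_cat. Qed.
Lemma trueH s k q t p : lit_true J (litH em x s k q t p) = (JH k q (Jargs t) (Jargs p) == s).
Proof. by rewrite /= map_cat. Qed.

Lemma true_choice k c i : i <= W ->
  has (lit_true J) (litsChoice M em x k c i) = (Jidx k (V em x (stepf false c (Jbit 0))) != i).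
Proof.
move=> Hi; rewrite find_iota_eq // negb_and negbK /litsChoice has_cat has_map.
congr (_ || _).
  by apply: eq_has => i'; rewrite /= Jastep eqb_id.
by case: ifP => //= _; rewrite orbF Jastep; case: (J _ _ _).
Qed.

Definition trueE := (trueIn, trueC, trueH, Jafree, Jazero, Jastep, Jaset).

Lemma step_true k c q a i p l : i <= W ->
  step_P em x (has (lit_true J)) k c q a i p l <->
  (JH k q (V em x (stepf false c (Jbit 0))) (Jargs p) ->
   JC a (V em x (stepf false c (Jbit 0))) (Jargs p) ->
   Jidx k (V em x (stepf false c (Jbit 0))) = i -> lit_true J l).
Proof.
move=> Hi; rewrite /step_P -cat1s has_cat has_seq1 -cat1s has_cat has_seq1 has_cat has_seq1.
rewrite true_choice // !trueE !eqbF_neg; split.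
  by move=> H h1 h2 h3; move: H; rewrite h1 h2 h3 eqxx.
by case: JH => //=; case: JC => //=; case: eqP => //= E H; apply: H.
Qed.

Lemma matrix_rules :
  matrix_true J (clauses_of x (matrix_gen M em eR k0) [:: n]) <->
  rules em eR k0 x JIn Jidx JC JH Jbit.
Proof.
have imp1 a b : has (lit_true J) [:: a; b] = (lit_true J a || lit_true J b).
  by rewrite /= orbF.
have imp2 a b c : has (lit_true J) [:: a; b; c] = [|| lit_true J a, lit_true J b | lit_true J c].
  by rewrite /= orbF.
have Himp (a b : bool) : (a == false) || (b == true) <-> (a -> b).
  by case: a; case: b; split=> // /(_ isT).
rewrite /matrix_true all_clauses //; split.
- move=> [_ [[H1 H2 H3 H4 [H5 H6]] Hf Hs Hr]]; split.
  + split; [|move=> i e Hi He|move=> e He|move=> i Hi|split].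
    * by move: H1; rewrite has_seq1 !trueE eqb_id.
    * by have := H2 i e Hi He; rewrite imp1 !trueE => /Himp.
    * by have := H3 e He; rewrite imp1 !trueE => /Himp.
    * by have := H4 i Hi; rewrite imp1 !trueE => /Himp.
    * by move: H5; rewrite imp1 !trueE => /Himp.
    * by move: H6; rewrite has_seq1 !trueE eqb_id.
  + move=> c j k s q a Hc Hj Hk; have := Hf c j k s q a Hc Hj Hk.
    by rewrite imp2 !trueE; case: JH => //=; case: JC => //=; rewrite eqb_id.
  + move=> c k q a i Hc Hk Hv Hi /=; have := Hs c k q a i Hc Hk Hv Hi.
    case: (select q a i) => -[q' a'] dr [/(step_true _ _ _ _ _ _ Hi) HC Hd].
    split; first by move: HC; rewrite !trueE eqb_id.
    have Hh p p' : head_P em x (has (lit_true J)) k c q a i q' p p' ->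
       head_R em x Jidx JC JH Jbit k c q a i q' (Jargs p) (Jargs p').
      by move=> /(step_true _ _ _ _ _ _ Hi); rewrite !trueE eqb_id.
    case: dr Hd => [[Hd1 Hd2]|Hd|Hd].
    * split; first by have := Hh _ _ Hd1; rewrite !trueE.
      by move=> e /Hd2/Hh; rewrite !trueE.
    * by have := Hh _ _ Hd; rewrite !trueE.
    * by move=> e /Hd/Hh; rewrite !trueE.
  + move=> k q a Hk Hv; have := Hr k q a Hk Hv.
    by rewrite imp1 !trueE !eqbF_neg negb_and.
- move=> [[H1 H2 H3 H4 [H5 H6]] Hf Hs Hr]; split; first by rewrite /= J1.
  split.
  + split; [|move=> i e Hi He|move=> e He|move=> i Hi|split].
    * by rewrite has_seq1 !trueE eqb_id.
    * by rewrite imp1 !trueE; apply/Himp; exact: H2.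
    * by rewrite imp1 !trueE; apply/Himp; exact: H3.
    * by rewrite imp1 !trueE; apply/Himp; exact: H4.
    * by rewrite imp1 !trueE; apply/Himp.
    * by rewrite has_seq1 !trueE eqb_id.
  + move=> c j k s q a Hc Hj Hk; have := Hf c j k s q a Hc Hj Hk.
    by rewrite imp2 !trueE; case: JH => //=; case: JC => //= ->.
  + move=> c k q a i Hc Hk Hv Hi /=; have := Hs c k q a i Hc Hk Hv Hi.
    case: (select q a i) => -[q' a'] dr [HC Hd].
    split; first by apply/(step_true _ _ _ _ _ _ Hi); rewrite !trueE eqb_id.
    have Hh p p' : head_R em x Jidx JC JH Jbit k c q a i q' (Jargs p) (Jargs p') ->
       head_P em x (has (lit_true J)) k c q a i q' p p'.
      by move=> H; apply/(step_true _ _ _ _ _ _ Hi); rewrite !trueE eqb_id.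
    case: dr Hd => [[Hd1 Hd2]|Hd|Hd].
    * by split=> [|e He]; apply: Hh; rewrite !trueE //; exact: Hd2.
    * by apply: Hh; rewrite !trueE.
    * by move=> e He; apply: Hh; rewrite !trueE; exact: Hd.
  + move=> k q a Hk Hv; have := Hr k q a Hk Hv.
    by rewrite imp1 !trueE !eqbF_neg negb_and.
Qed.
End MatrixRules.

(** * Successor and inequality of binary vectors *)

Lemma bits_val_cat s t : bits_val (s ++ t) = bits_val s * 2 ^ size t + bits_val t.
Proof.
elim/last_ind: t => [|t b IH]; first by rewrite cats0 muln1 addn0.
by rewrite -rcons_cat !bits_val_rcons IH size_rcons expnS; nia.
Qed.

Lemma bits_val_cons (b : bool) t : bits_val (b :: t) = b * 2 ^ size t + bits_val t.
Proof. by rewrite -cat1s bits_val_cat. Qed.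

Lemma map_const_iota (T : Type) (c : T) i k : [seq c | _ <- iota i k] = nseq k c.
Proof. by elim: k i => //= k IH i; rewrite IH. Qed.

Lemma bits_val_nseq k (b : bool) : bits_val (nseq k b) = if b then (2 ^ k).-1 else 0.
Proof.
elim: k => [|k IH]; first by case: b.
rewrite -[nseq _ _]/([:: b] ++ nseq k b) bits_val_cat size_nseq IH expnS; case: b {IH} => //=.
have : 0 < 2 ^ k by rewrite expn_gt0.
by rewrite /bits_val /=; lia.
Qed.

Lemma bits_val_last0 v : (bits_val v).+1 < 2 ^ size v ->
  exists w k, v = w ++ false :: nseq k true.
Proof.
elim/last_ind: v => [|v b IH] //; rewrite bits_val_rcons size_rcons expnS => H.
case: b H => H; last by exists v, 0; rewrite cats1.
have [|w [k ->]] := IH; first by lia.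
exists w, k.+1; rewrite rcons_cat rcons_cons; congr (_ ++ (_ :: _)).
by rewrite -cats1 -[[:: true]]/(nseq 1 true) -nseqD addn1.
Qed.

Section Vectors.
Variables (em : expr) (x : seq bool).
Local Notation m := (ev em [:: size x]).
Local Notation V := (V em x).

Lemma size_V f : size (V f) = m.
Proof. by rewrite size_map size_iota. Qed.
Lemma nth_V f j : j < m -> nth false (V f) j = f j.
Proof. by move=> H; rewrite (nth_map 0) ?size_iota // nth_iota. Qed.
Lemma V_nth v : size v = m -> V (nth false v) = v.
Proof. by move=> H; apply: (@eq_from_nth _ false); rewrite size_V ?H // => i Hi; rewrite nth_V. Qed.
Lemma eq_V f g : (forall j, j < m -> f j = g j) -> V f = V g.
Proof. by move=> H; apply: (@eq_from_nth _ false); rewrite !size_V // => i Hi; rewrite !nth_V // H. Qed.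

Lemma V_vec f : vec m (bits_val (V f)) = V f.
Proof. by rewrite -{1}(size_V f) bits_valK. Qed.
Lemma bits_V_lt f : bits_val (V f) < 2 ^ m.
Proof. by have := size_bits_val (V f); rewrite size_V. Qed.
Lemma vec_V v : V (nth false (vec m v)) = vec m v.
Proof. by apply: V_nth; rewrite size_vec. Qed.

Lemma V_stepf up c u : c < m ->
  V (stepf up c u) = [seq u j | j <- iota 0 c] ++ up :: nseq (m - c.+1) (~~ up).
Proof.
move=> Hc; rewrite /V; have {1}-> : m = c + (m - c.+1).+1 by lia.
rewrite iotaD map_cat /=; congr (_ ++ (_ :: _)).
- by apply/eq_in_map => j; rewrite mem_iota /stepf => /andP[_ ->].
- by rewrite /stepf ltnn.
- rewrite -(map_const_iota _ c.+1); apply/eq_in_map => j; rewrite mem_iota /stepf => H.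
  have -> : (j < c) = false by lia.
  by have -> : (c < j) = true by lia.
Qed.

Lemma bits_val_stepf c u : c < m ->
  bits_val (V (stepf true c u)) = (bits_val (V (stepf false c u))).+1.
Proof.
move=> Hc; rewrite !V_stepf // !bits_val_cat !bits_val_cons /= !size_nseq !bits_val_nseq /=.
have : 0 < 2 ^ (m - c.+1) by rewrite expn_gt0.
lia.
Qed.

(** The carry position is the place of the last zero, which exists since the vector is not all
    ones. *)
Lemma vec_succ t : t.+1 < 2 ^ m -> exists2 c, c < m &
  vec m t = V (stepf false c (nth false (vec m t))) /\
  vec m t.+1 = V (stepf true c (nth false (vec m t))).
Proof.
move=> Ht; set v := vec m t; have Hv : bits_val v = t by rewrite vecK //; lia.
have [|w [k Ew]] := @bits_val_last0 v; first by rewrite Hv size_vec.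
have Hs : m = size w + k.+1 by rewrite -(size_vec m t) -/v Ew size_cat /= size_nseq.
have Hc : size w < m by lia.
have E : v = V (stepf false (size w) (nth false v)).
  rewrite V_stepf // {1}Ew; congr (_ ++ (_ :: _)).
    rewrite Ew; apply: (@eq_from_nth _ false); rewrite ?size_map ?size_iota // => i Hi.
    by rewrite (nth_map 0) ?size_iota // nth_iota // nth_cat Hi.
  by congr nseq; lia.
exists (size w) => //; split=> //; apply: bits_val_inj; first by rewrite size_vec size_V.
by rewrite vecK // bits_val_stepf // -E Hv.
Qed.

Lemma bits_val_setf s j u u' : j < m ->
  bits_val (V (setf s j u)) <> bits_val (V (setf (~~ s) j u')).
Proof.
move=> Hj E; have : V (setf s j u) = V (setf (~~ s) j u').
  by apply: bits_val_inj => //; rewrite !size_V.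
move/(congr1 (fun v => nth false v j)); rewrite !nth_V // /setf ltnn; by case: s {E}.
Qed.

Lemma vec_neq p p' : p < 2 ^ m -> p' < 2 ^ m -> p != p' -> exists j s, [/\ j < m,
  vec m p = V (setf s j (nth false (vec m p))) &
  vec m p' = V (setf (~~ s) j (nth false (vec m p')))].
Proof.
move=> Hp Hp' /eqP ne.
have [j Hj Hne] : exists2 j, j < m & nth false (vec m p) j != nth false (vec m p') j.
  suff /hasP[j] : has (fun j => nth false (vec m p) j != nth false (vec m p') j) (iota 0 m).
    by rewrite mem_iota => Hj Hn; exists j.
  rewrite -[has _ _]negbK -all_predC; apply/negP => /allP H; apply: ne.
  rewrite -(vecK Hp) -(vecK Hp'); congr bits_val.
  apply: (@eq_from_nth _ false); rewrite !size_vec // => i Hi.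
  by apply/eqP; have := H i; rewrite mem_iota /= negbK; apply.
exists j, (nth false (vec m p) j); split=> //.
  by rewrite -[LHS]vec_V; apply: eq_V => i Hi; rewrite /setf; case: ltngtP => // ->.
rewrite -[LHS]vec_V; apply: eq_V => i Hi; rewrite /setf; case: ltngtP => // ->.
by case: nth Hne; case: nth.
Qed.

Lemma vec0 : vec m 0 = V (fun=> false).
Proof.
apply: bits_val_inj; first by rewrite size_vec size_V.
rewrite vecK ?expn_gt0 //.
have -> : V (fun=> false) = nseq m false by rewrite -(map_const_iota _ 0).
by rewrite bits_val_nseq.
Qed.

End Vectors.

(** * Models of the matrix and runs of the machine *)

Section Tableau.
Variables (M : ATM) (em eR : expr) (k0 : nat) (x : seq bool).

Local Notation n := (size x).
Local Notation W := (width M).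
Local Notation m := (ev em [:: size x]).
Local Notation R := (ev eR [:: size x]).
Local Notation V := (V em x).
Local Notation V0 := (V0 em x).

Definition cont (c : aconf M) (p : nat) : aSym M := nth (ablank M) c.1.2 p.

Definition move_pos (d : dir) (p : nat) : nat :=
  match d with DL => p.-1 | DS => p | DR => p.+1 end.

Lemma apply_trE c q a d p : let c' := apply_tr c (q, a, d) in
  [/\ c'.1.1 = q, c'.2 = move_pos d c.2 & cont c' p = if p == c.2 then a else cont c p].
Proof.
case: c => [[q0 tp] pos]; rewrite /apply_tr /tape_move /cont /=; split=> //.
have E : nth (ablank M) (set_nth (ablank M) tp pos a) p = if p == pos then a else nth (ablank M) tp p.
  by rewrite nth_set_nth.
case: ifP => // _; rewrite nth_rcons; case: ltnP => // H; rewrite -E.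
by case: eqP => _; rewrite nth_default.
Qed.

Lemma cont_init p : cont (ainit M x) p = if p < n then ainput M (nth false x p) else ablank M.
Proof.
rewrite /cont /ainit /=; case: (x) => [|b s]; first by case: p => [|[]].
case: ltnP => H; first by rewrite (nth_map false).
by rewrite nth_default // size_map.
Qed.

Lemma next_blockE (q q' : aSt M) k : next_block q q' k = k + next_block q q' 0.
Proof. by rewrite /next_block; case: ifP; rewrite ?addn0 ?addn1. Qed.

Section Sound.
Variables (fIn : nat -> seq bool -> bool) (idx : nat -> seq bool -> nat).
Variables (fC : aSym M -> seq bool -> seq bool -> bool).
Variables (fH : nat -> aSt M -> seq bool -> seq bool -> bool).
Hypothesis Hrules : forall u, rules em eR k0 x fIn idx fC fH u.
Variable ch : choices M.
Hypothesis Hch : forall k t, t < 2 ^ m -> ch k t = idx k (vec m t) :> nat.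

Definition facts t (c : aconf M) k : Prop :=
  fH k c.1.1 (vec m t) (vec m c.2) /\ forall p, p < 2 ^ m -> fC (cont c p) (vec m t) (vec m p).

(** Instances of the universal bits: a time for variable 0, positions for variables 1 and 2. *)
Definition env3 (a b c : seq bool) (v : nat) : nat -> bool :=
  nth false (nth [::] [:: a; b; c] v).

Lemma facts_init : facts 0 (ainit M x) k0.
Proof.
split.
  have [[_ _ _ _ [_ H]] _ _ _] := Hrules (fun _ _ => false); rewrite /= vec0; exact: H.
(* Induction along the positions; behind the input the last predicate carries itself on. *)
have HIn p : p < 2 ^ m -> fIn (if p < n then p else n) (vec m p).
  elim: p => [|p IH] Hp.
    have [[H0 _ _ _ _] _ _ _] := Hrules (fun _ _ => false); rewrite vec0.
    by case: ltnP H0 => //; rewrite leqn0 => /eqP->.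
  have [c Hc [E1 E2]] := vec_succ Hp; have Hp' := ltnW Hp; have := IH Hp'.
  have [[_ H1 H2 _ _] _ _ _] := Hrules (env3 [::] (vec m p) [::]).
  rewrite E2 {1}E1; case: (ltnP p n) => Hpn.
    move=> /(H1 _ _ Hpn Hc); case: (ltngtP p.+1 n) => // [|->//]; lia.
  have -> : (p.+1 < n) = false by lia.
  exact: H2.
move=> p Hp; have := HIn p Hp; rewrite cont_init vec0.
have [[_ _ _ H3 [H4 _]] _ _ _] := Hrules (env3 [::] (vec m p) [::]).
move: H3 H4; rewrite /env3 /= vec_V => H3 H4.
by case: ltnP => Hpn; [exact: H3|exact: H4].
Qed.

(** The head is never further right than the elapsed time, so its position fits into [m] bits and
    successors do not overflow. *)
Lemma facts_step t c k : facts t c k -> verdict c.1.1 (headsym c) = None ->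
  t.+1 < 2 ^ m -> k < 2 * R -> c.2 <= t ->
  let c' := anext (ch k t) c in facts t.+1 c' (next_block c.1.1 c'.1.1 k) /\ c'.2 <= t.+1.
Proof.
move=> [FH FC] Hv Ht Hk Hpos; rewrite /anext /=.
have [cc Hcc [T1 T2]] := vec_succ Ht.
have Hpm : c.2 < 2 ^ m by lia.
have Hi := ltn_ord (ch k t); have Hidx := Hch k (ltnW Ht).
have HC := FC _ Hpm; rewrite -/(headsym c) in HC.
case Es: (select c.1.1 (headsym c) (ch k t)) => [[q' a'] dr].
have [E1 E2 _] := apply_trE c q' a' dr 0; have E3 p := let: And3 _ _ E := apply_trE c q' a' dr p in E.
rewrite E1 E2 /=; split; last by case: dr E2 {Es E1 E3} => _ /=; lia.
split.
  rewrite E2 next_blockE.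
  case: dr Es {E1 E2 E3} => Es /=.
  - case: (posnP c.2) => Hp0.
      have [_ _ /(_ cc k c.1.1 (headsym c) (ch k t) Hcc Hk Hv Hi) + _] := Hrules (env3 (vec m t) [::] [::]).
      rewrite Es /head_R /env3 /= -T1 -T2 => -[_ [+ _]].
      have -> : V0 = vec m c.2 by rewrite Hp0 vec0.
      have -> : c.2.-1 = c.2 by lia.
      by apply.
    have Hp1 : c.2.-1.+1 = c.2 by lia.
    have [|e He [P1 P2]] := @vec_succ em x c.2.-1; first by lia.
    have [_ _ /(_ cc k c.1.1 (headsym c) (ch k t) Hcc Hk Hv Hi) + _] := Hrules (env3 (vec m t) (vec m c.2.-1) [::]).
    rewrite Es /head_R /env3 /= -T1 -T2 => -[_ [_ /(_ e He)]].
    by rewrite -P1 -P2 Hp1; apply.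
  - have [_ _ /(_ cc k c.1.1 (headsym c) (ch k t) Hcc Hk Hv Hi) + _] := Hrules (env3 (vec m t) (vec m c.2) [::]).
    by rewrite Es /head_R /env3 /= -T1 -T2 vec_V => -[_]; apply.
  - have [|e He [P1 P2]] := @vec_succ em x c.2; first by lia.
    have [_ _ /(_ cc k c.1.1 (headsym c) (ch k t) Hcc Hk Hv Hi) + _] := Hrules (env3 (vec m t) (vec m c.2) [::]).
    rewrite Es /head_R /env3 /= -T1 -T2 => -[_ /(_ e He)].
    by rewrite -P1 -P2; apply.
move=> p Hp; rewrite E3; case: eqVneq => [->|Hne].
  have [_ _ /(_ cc k c.1.1 (headsym c) (ch k t) Hcc Hk Hv Hi) + _] := Hrules (env3 (vec m t) (vec m c.2) [::]).
  by rewrite Es /env3 /= -T1 -T2 vec_V => -[+ _]; apply.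
have [|j [s [Hj P1 P2]]] := @vec_neq em x c.2 p Hpm Hp; first by rewrite eq_sym.
have [_ /(_ cc j k s c.1.1 (cont c p) Hcc Hj Hk) + _ _] := Hrules (env3 (vec m t) (vec m c.2) (vec m p)).
by rewrite /env3 /= -T1 -T2 -P1 -P2; apply=> //; exact: FC.
Qed.

(** [r] counts the blocks still to be charged. If the configuration continues the previous block or
    halts, block [k] has been charged already, and the bound has to be strict for [k] to stay below
    [2 * R]. *)
Definition within_budget (r : nat) (prev : option skind) (c : aconf M) (k : nat) : bool :=
  if is_halting (akind_of c) || (if prev is Some p then skind_eqb p (akind_of c) else false)
  then k + r < 2 * R else k + r <= 2 * R.

Lemma block_bound d r prev c k :
  alt_ok d r prev c -> within_budget r prev c k -> k < 2 * R.
Proof.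
have Hlt : k + r < 2 * R -> k < 2 * R by exact: leq_ltn_trans (leq_addr _ _).
have Hle : 0 < r -> k + r <= 2 * R -> k < 2 * R by lia.
rewrite /within_budget; case: d => [|d] /=; case: (is_halting _) => //= -[];
  by case: (if prev is Some p then _ else _) => //= Hr _; exact: Hle.
Qed.

(** The facts of the true run are forced step by step. A rejecting verdict would violate an
    exclusion clause, available because the block number stays below [2 * R], and halting in time
    leaves only acceptance. *)
Lemma rules_sound d t c k r prev :
  facts t c k -> c.2 <= t -> t + d < 2 ^ m -> halts_within d c -> alt_ok d r prev c ->
  within_budget r prev c k -> outcome ch d t c k.
Proof.
elim: d t c k r prev => [|d IH] t c k r prev HF Hpos Ht Hh Ha Hb;
  have Hk := block_bound Ha Hb;
  (have Hrej : verdict c.1.1 (headsym c) <> Some false by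
    move=> Hv; have [FH FC] := HF; have Hp : c.2 < 2 ^ m := leq_ltn_trans Hpos (leq_ltn_trans (leq_addr _ _) Ht);
    have [_ _ _ /(_ k _ _ Hk Hv)] := Hrules (env3 (vec m t) (vec m c.2) [::]);
    rewrite /env3 /= !vec_V FH /=; have := FC _ Hp; rewrite -/(headsym c) => ->).
  move: Hh Hrej => /=; case E: (verdict _ _) => [[]|] //.
  by move: E; rewrite /verdict -/(akind_of c); case: (akind_of c).
move: Hrej => /=; case E: (verdict _ _) => [[]|] // _.
have Hn : is_halting (akind_of c) = false.
  by move: E; rewrite /verdict -/(akind_of c); case: (akind_of c).
move: Ha Hh Hb => /=; rewrite /within_budget Hn /= => -[Hr Ha] Hh Hb.
have [|F1 P1] := facts_step HF E _ Hk Hpos; first by lia.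
have Hm := next_mem (ch k t) E.
apply: IH F1 P1 _ (Hh _ Hm) (Ha _ Hm) _; first by lia.
set c' := anext _ _; rewrite /within_budget /next_block -/(akind_of c') -/(akind_of c).
move: Hr Hb; case: (if prev is Some p then _ else _) => /= Hr Hb;
  by case: (is_halting _ || _) => /=; lia.
Qed.
End Sound.

Section Complete.
Variables (idx : nat -> seq bool -> nat) (ch : choices M).
Hypothesis Hch : forall k t, t < 2 ^ m -> ch k t = idx k (vec m t) :> nat.

(** The run is frozen once it has a verdict, which defines the tableau at all times representable by
    [m] bits. *)
Definition run_step t (ck : aconf M * nat) : aconf M * nat :=
  let: (c, k) := ck in
  if verdict c.1.1 (headsym c) is None then
    let c' := anext (ch k t) c in (c', next_block c.1.1 c'.1.1 k)
  else (c, k).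

Fixpoint tm_run (t : nat) : aconf M * nat :=
  if t is t'.+1 then run_step t' (tm_run t') else (ainit M x, k0).

Lemma outcome_run d : outcome ch d 0 (ainit M x) k0 ->
  forall t, verdict (tm_run t).1.1.1 (headsym (tm_run t).1) <> Some false.
Proof.
move=> H t.
have [d'] : exists d', outcome ch d' t (tm_run t).1 (tm_run t).2.
  elim: t => [|t [d']]; first by exists d.
  rewrite /= ; case: (tm_run t) => c k /=.
  case: d' => [|d'] /=; case E: (verdict _ _) => [v|] //= Hv.
  - by exists 0; rewrite /= E.
  - by exists 0; rewrite /= E.
  - by exists d'.
by case: d' => [|d'] /=; case: (verdict _ _) => [[]|].
Qed.

Definition mIn (i : nat) (v : seq bool) : bool :=
  if i < n then bits_val v == i else n <= bits_val v.
Definition mC (a : aSym M) (t p : seq bool) : bool :=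
  cont (tm_run (bits_val t)).1 (bits_val p) == a.
Definition mH (k : nat) (q : aSt M) (t p : seq bool) : bool :=
  let: (c, k') := tm_run (bits_val t) in [&& k' == k, c.1.1 == q & c.2 == bits_val p].

Lemma mHE k q t p c k' : tm_run (bits_val t) = (c, k') ->
  mH k q t p = [&& k' == k, c.1.1 == q & c.2 == bits_val p].
Proof. by rewrite /mH => ->. Qed.

Lemma rules_complete :
  (forall t, verdict (tm_run t).1.1.1 (headsym (tm_run t).1) <> Some false) ->
  forall u, rules em eR k0 x mIn idx mC mH u.
Proof.
move=> Hrun u.
have B0 : bits_val V0 = 0 by rewrite /V0 -vec0 vecK // expn_gt0.
have Hcont0 p : cont (tm_run 0).1 p = if p < n then ainput M (nth false x p) else ablank M.
  exact: cont_init.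
split.
- split.
  + by rewrite /mIn B0; case: ltnP => //.
  + move=> i e Hi He; rewrite /mIn Hi bits_val_stepf // => /eqP->.
    by case: ltnP => //.
  + by move=> e He; rewrite /mIn ltnn bits_val_stepf //; lia.
  + by move=> i Hi; rewrite /mIn /mC Hi B0 Hcont0 => /eqP->; rewrite Hi.
  + rewrite /mIn /mC /mH B0 ltnn Hcont0 /= !eqxx; split=> // Hn.
    by rewrite ltnNge Hn.
- move=> c j k s q a Hc Hj Hk; rewrite /mH /mC bits_val_stepf // [tm_run _.+1]/=.
  case: (tm_run _) => cf k' /and3P[_ _ /eqP Hp] /eqP <-.
  have Hne : bits_val (V (setf s j (u 1))) <> bits_val (V (setf (~~ s) j (u 2))) by exact: bits_val_setf.
  rewrite /run_step; case: (verdict _ _) => //=.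
  rewrite /anext; case: (select _ _ _) => -[q' a'] dr.
  have [_ _ ->] := apply_trE cf q' a' dr (bits_val (V (setf (~~ s) j (u 2)))).
  by case: ifP => [/eqP E|_]; [case: Hne; rewrite -Hp E | exact: eqxx].
- move=> c k q a i Hc Hk Hv Hi T.
  case Es: (select q a i) => [[q' a'] dr].
  have key p : mH k q T p -> mC a T p -> idx k T = i ->
     exists cf, tm_run (bits_val (V (stepf true c (u 0)))) =
       (apply_tr cf (q', a', dr), k + next_block q q' 0) /\ cf.2 = bits_val p.
    rewrite /mH /mC bits_val_stepf // [tm_run _.+1]/= -/T.
    case Er: (tm_run _) => [cf k'] /and3P[/eqP Ek /eqP Eq /eqP Ep] /eqP Ea Eidx.
    have Eh : headsym cf = a by rewrite -Ea /headsym /cont Ep.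
    exists cf; split=> //; rewrite /run_step Eq Eh Hv /anext Eq Eh Ek.
    rewrite Hch ?bits_V_lt // V_vec Eidx Es.
    by have [-> _ _] := apply_trE cf q' a' dr 0; rewrite next_blockE.
  split.
    move=> h1 h2 h3; have [cf [E Ep]] := key _ h1 h2 h3.
    rewrite /mC E [(_, _).1]/=; have [_ _ ->] := apply_trE cf q' a' dr (bits_val (V (u 1))).
    by rewrite Ep eqxx.
  have hd p p' : bits_val p' = move_pos dr (bits_val p) ->
     head_R em x idx mC mH u k c q a i q' p p'.
    move=> Epp T' h1 h2 h3; have [cf [E Ep]] := key _ h1 h2 h3.
    rewrite (mHE _ _ _ E); have [-> -> _] := apply_trE cf q' a' dr 0.
    by rewrite !eqxx Epp Ep /=.
  case: dr Es key hd => Es key hd.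
  + split=> [|e He]; apply: hd; first by rewrite B0.
    by rewrite bits_val_stepf.
  + exact: hd.
  + by move=> e He; apply: hd; rewrite bits_val_stepf.
- move=> k q a Hk Hv; apply/negP => /andP[]; rewrite /mH /mC.
  have := Hrun (bits_val (V (u 0))); case: (tm_run _) => cf k' /= Hnr /and3P[_ /eqP Eq /eqP Ep] /eqP Ea.
  by apply: Hnr; rewrite Eq /headsym -[nth _ _ _]/(cont cf cf.2) Ep Ea.
Qed.

End Complete.
End Tableau.

(** * Rules and partially specified predicates *)

Section Congruence.
Variables (M : ATM) (em eR : expr) (k0 : nat) (x : seq bool).
Local Notation n := (size x).
Local Notation m := (ev em [:: size x]).
Local Notation R := (ev eR [:: size x]).
Local Notation V := (V em x).

Variables (fIn fIn' : nat -> seq bool -> bool) (idx idx' : nat -> seq bool -> nat).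
Variables (fC fC' : aSym M -> seq bool -> seq bool -> bool).
Variables (fH fH' : nat -> aSt M -> seq bool -> seq bool -> bool).
Variables (u u' : nat -> nat -> bool).
Hypotheses (EIn : forall i v, i <= n -> fIn i v = fIn' i v)
  (Eidx : forall k v, idx k v = idx' k v)
  (EC : forall a t p, size t = m -> fC a t p = fC' a t p)
  (EH : forall k q t p, k <= 2 * R -> size t = m -> fH k q t p = fH' k q t p)
  (Eu : forall v j, v < 3 -> j < m -> u v j = u' v j).

(** An interpretation matches the intended predicates only at quantified indices and at arguments of
    the right length; the rules mention no others. *)
Lemma rules_congr : k0 <= 2 * R ->
  rules em eR k0 x fIn idx fC fH u -> rules em eR k0 x fIn' idx' fC' fH' u'.
Proof.
move=> Hk0.
have E1 v : v < 3 -> V (u v) = V (u' v) by move=> Hv; apply: eq_V => j Hj; exact: Eu.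
have E2 v up c : v < 3 -> V (stepf up c (u v)) = V (stepf up c (u' v)).
  by move=> Hv; apply: eq_V => j Hj; rewrite /stepf Eu.
have E3 v b c : v < 3 -> V (setf b c (u v)) = V (setf b c (u' v)).
  by move=> Hv; apply: eq_V => j Hj; rewrite /setf Eu.
have S0 : size (V0 em x) = m by exact: size_V.
move=> [[a1 a2 a3 a4 [a5 a6]] Hf Hs Hr].
split.
- split.
  + by rewrite -EIn.
  + move=> i e Hi He; rewrite -!EIn -?E2 //; [exact: a2|exact: ltnW].
  + by move=> e He; rewrite -!EIn -?E2 //; exact: a3.
  + by move=> i Hi; rewrite -!EIn -?EC -?E1 //; [exact: a4|exact: ltnW].
  + by rewrite -EIn -?EC -?EH -?E1.
- move=> c j k s q a Hc Hj Hk; rewrite -EH -?EC -?E2 -?E3 ?size_V //; first exact: Hf.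
  exact: ltnW.
- move=> c k q a i Hc Hk Hv Hi T; have := Hs c k q a i Hc Hk Hv Hi.
  case: (select q a i) => -[q' a'] dr; rewrite /T -E2 // => -[HC Hd].
  split; first by rewrite -EH -?EC -?Eidx -?E1 -?E2 ?size_V //; exact: ltnW.
  have hd p p' : head_R em x idx fC fH u k c q a i q' p p' ->
     head_R em x idx' fC' fH' u' k c q a i q' p p'.
    have Hb : k + next_block q q' 0 <= 2 * R by have := next_block0 q q'; lia.
    by rewrite /head_R -!E2 // -!EH -?EC -?Eidx ?size_V //; exact: ltnW.
  case: dr Hd => [[Hd1 Hd2]|Hd|Hd].
  + by split=> [|e He]; apply: hd; rewrite -?E2 //; exact: Hd2.
  + by apply: hd; rewrite -E1.
  + by move=> e He; apply: hd; rewrite -!E2 //; exact: Hd.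
- move=> k q a Hk Hv; rewrite -EH -?EC -?E1 ?size_V //; [exact: Hr|exact: ltnW].
Qed.
End Congruence.

Lemma override_in I s G f n : (f, n) \in s -> override I s G f n = G f n.
Proof. by rewrite /override => ->. Qed.
Lemma override_notin I s G f n : (f, n) \notin s -> override I s G f n = I f n.
Proof. by rewrite /override => /negbTE->. Qed.

(** * Truth of the formula and acceptance *)

Section Correctness.
Variables (M : ATM) (em eR : expr) (k0 : nat) (x : seq bool).
Hypotheses (em1 : evars 1 em) (eR1 : evars 1 eR).
Local Notation n := (size x).
Local Notation W := (width M).
Local Notation m := (ev em [:: size x]).
Local Notation R := (ev eR [:: size x]).
Local Notation NK := (nkinds M).
Hypotheses (m_gt0 : 0 < m) (Hk0 : k0 <= 2 * R).

Local Notation KE := (keysE M em eR x).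
Local Notation KA := (keysA em x).

Lemma keysA_notin f a : 0 < a \/ f < 2 -> (f, a) \notin KA.
Proof.
move=> H; apply/negP => /flatten_mapP[j _ /mapP[v _ [E1 E2]]].
by move: H; rewrite E1 E2 => -[]; lia.
Qed.

(** As [m] is positive, the arities 0, [m] and [m + m] differ. Only the input predicates share the
    arity of the choice functions, and they have kind 0. *)
Lemma keysE_notin_choice k i : i < W -> (fname M k i.+1, m) \notin KE.
Proof.
move=> Hi; have Hm : (m == m + m) = false by lia.
have Hm0 : (m == 0) = false by lia.
have Hin : i.+1 < NK by apply: kind_choice_lt.
rewrite /keysE !mem_cat !inE !xpair_eqE Hm0 !andbF /= !negb_or; apply/and3P; split.
- apply/negP => /mapP[i' _ [/eqP]]; rewrite fname_eq ?andbF //; exact: kind_choice_lt.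
- by apply/negP => /mapP[a _ [_ /eqP]]; rewrite Hm.
- by apply/negP => /flatten_mapP[k' _ /mapP[q _ [_ /eqP]]]; rewrite Hm.
Qed.

Definition chI (I : interp) : choices M := fun k t => inord (Jidx M em x I k (vec m t)).

Lemma chIE I k t : chI I k t = Jidx M em x I k (vec m t) :> nat.
Proof.
by rewrite inordK // ltnS /Jidx -[X in _ <= X](size_iota 0) find_size.
Qed.

Section Extend.
Variables (I G G' : interp).
Let I1 := override I KE G.
Let J := override I1 KA G'.

Lemma ext_0 : J 0 0 = G 0 0.
Proof.
rewrite /J override_notin; last by apply: keysA_notin; right.
by rewrite /I1 override_in // /keysE !mem_cat !inE eqxx ?orbT.
Qed.
Lemma ext_1 : J 1 0 = G 1 0.
Proof.
rewrite /J override_notin; last by apply: keysA_notin; right.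
by rewrite /I1 override_in // /keysE !mem_cat !inE eqxx ?orbT.
Qed.
Lemma ext_In i v : i <= n -> JIn M em x J i v = G (fname M i 0) m v.
Proof.
move=> Hi; rewrite /JIn /J override_notin; last by apply: keysA_notin; left.
by rewrite /I1 override_in // mem_keyIn.
Qed.
Lemma ext_idx k v : Jidx M em x J k v = Jidx M em x I k v.
Proof.
apply: eq_in_find => i; rewrite mem_iota => Hi.
rewrite /J override_notin; last by apply: keysA_notin; left.
by rewrite /I1 override_notin // keysE_notin_choice.
Qed.
Lemma ext_C a t p : @JC M em x J a t p = G (fname M 0 (kind_sym a)) (m + m) (t ++ p).
Proof.
rewrite /JC /J override_notin; last by apply: keysA_notin; left; lia.
by rewrite /I1 override_in // mem_keyC.
Qed.
Lemma ext_H k q t p : k <= 2 * R ->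
  @JH M em x J k q t p = G (fname M k (kind_st q)) (m + m) (t ++ p).
Proof.
move=> Hk; rewrite /JH /J override_notin; last by apply: keysA_notin; left; lia.
by rewrite /I1 override_in // mem_keyH.
Qed.
Lemma ext_bit v j : v < 3 -> j < m -> Jbit J v j = G' (j * 3 + v.+2) 0 [::].
Proof. by move=> Hv Hj; rewrite /Jbit /J override_in // mem_keyA. Qed.
End Extend.

Variables (D r : nat).
Hypotheses (HD : D < 2 ^ m) (Hhalt : halts_within D (ainit M x)).
Hypotheses (Halt : alt_ok D r None (ainit M x)) (Hr : k0 + r <= 2 * R).
Hypothesis Hstart : ~~ is_halting (@akind M (astart M)).

Local Notation cs := (clauses_of x (matrix_gen M em eR k0) [:: n]).

Definition bit_interp (u : nat -> nat -> bool) : interp :=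
  fun f _ _ => u ((f - 2) %% 3) ((f - 2) %/ 3).

(** The arity tells propositions, input predicates and tableau predicates apart, after which the
    name is decoded or compared. *)
Definition model_interp (ch : choices M) : interp := fun f a s =>
  if a == 0 then f == 1 else if a == m then mIn x (f %/ NK) s else
  let: (c, k) := tm_run k0 x ch (bits_val (take m s)) in
  (f == fname M 0 (kind_sym (cont c (bits_val (drop m s))))) ||
  (f == fname M k (kind_st c.1.1)) && (c.2 == bits_val (drop m s)).

(** A witness [G] satisfies the rules for all values of the bits, which forces the run into it;
    conversely, the tableau of the run satisfies them for all bits simultaneously. *)
Lemma tableau_outcome I :
  (exists G, forall G', let J := override (override I KE G) KA G' in
     matrix_true J cs && ~~ J 0 0 [::]) <->
  outcome (chI I) D 0 (ainit M x) k0.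
Proof.
have Hch k t : t < 2 ^ m -> chI I k t = Jidx M em x I k (vec m t) :> nat by move=> _; exact: chIE.
split=> [[G HG]|Hout].
  have G0 : G 0 0 [::] = false.
    by have /= := HG G; rewrite ext_0 => /andP[_ /negbTE].
  have G1 : G 1 0 [::] = true.
    have /= /andP[+ _] := HG G; rewrite /matrix_true all_clauses // => -[+ _].
    by rewrite /= ext_1 orbF => /eqP.
  have Hrules u : rules em eR k0 x (fun i v => G (fname M i 0) m v) (Jidx M em x I)
     (fun (a : aSym M) t p => G (fname M 0 (kind_sym a)) (m + m) (t ++ p))
     (fun k (q : aSt M) t p => G (fname M k (kind_st q)) (m + m) (t ++ p)) u.
    have /= /andP[+ _] := HG (bit_interp u).
    rewrite matrix_rules ?ext_0 ?ext_1 //.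
    apply: rules_congr => //.
    + by move=> i v Hi; exact: ext_In.
    + by move=> k v; exact: ext_idx.
    + by move=> a t p _; exact: ext_C.
    + by move=> k q t p Hk _; exact: ext_H.
    + move=> v j Hv Hj; rewrite ext_bit // /bit_interp.
      by congr (u _ _); lia.
  apply: (rules_sound Hrules Hch (facts_init Hrules) _ _ Hhalt Halt) => //.
  by rewrite /within_budget /akind_of /= (negbTE Hstart).
exists (model_interp (chI I)) => G'; set J := override _ _ _; rewrite /=.
have J0 : J 0 0 [::] = false by rewrite /J ext_0.
have J1 : J 1 0 [::] = true by rewrite /J ext_1.
rewrite J0 andbT matrix_rules //.
have := rules_complete eR Hch (outcome_run Hout) (Jbit J).
apply: rules_congr => //.
- move=> i v Hi; rewrite /J ext_In // /model_interp eqxx.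
  by have -> : (m == 0) = false by [lia]; rewrite fname_div //; exact: kind_choice_lt.
- by move=> k v; rewrite /J ext_idx.
- move=> a t p Ht; rewrite /J ext_C /model_interp.
  have -> : (m + m == 0) = false by lia.
  have -> : (m + m == m) = false by lia.
  rewrite take_size_cat // drop_size_cat // /mC; case: (tm_run _ _ _ _) => c k /=.
  rewrite !fname_eq ?kind_sym_lt ?kind_st_lt // kind_sym_eq kind_sym_st andbF orbF.
  exact: eq_sym.
- move=> k q t p Hk Ht; rewrite /J ext_H // /model_interp.
  have -> : (m + m == 0) = false by lia.
  have -> : (m + m == m) = false by lia.
  rewrite take_size_cat // drop_size_cat // /mH; case: (tm_run _ _ _ _) => c k' /=.
  rewrite !fname_eq ?kind_sym_lt ?kind_st_lt // kind_st_eq (eq_sym (kind_st q)) kind_sym_st andbF /=.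
  by rewrite -andbA (eq_sym k) (eq_sym q).
Qed.

Lemma Jidx_override_choice I k G k' v :
  Jidx M em x (override I (keysG M em x k) G) k' v =
  if k' == k then Jidx M em x G k v else Jidx M em x I k' v.
Proof.
case: eqVneq => [->|Hne]; apply: eq_in_find => i; rewrite mem_iota add0n => /andP[_ Hi].
  by rewrite override_in //; apply/mapP; exists i; rewrite // mem_iota.
rewrite override_notin //; apply/negP => /mapP[i']; rewrite mem_iota add0n => /andP[_ Hi'] [/eqP].
by rewrite fname_eq ?(negbTE Hne) //; exact: kind_choice_lt.
Qed.

(** One-hot coding: among the choice functions only the one of the chosen index holds, and none for
    the index [W]. *)
Definition choice_interp (c0 : nat -> 'I_W.+1) : interp :=
  fun f _ s => f %% NK == (c0 (bits_val s)).+1.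

Lemma Jidx_choice_interp c0 k t : t < 2 ^ m ->
  Jidx M em x (choice_interp c0) k (vec m t) = c0 t.
Proof.
move=> Ht; rewrite /Jidx; set c := nat_of_ord (c0 t).
have Hc : c <= W by rewrite -ltnS ltn_ord.
have -> : find (fun i => choice_interp c0 (fname M k i.+1) m (vec m t)) (iota 0 W) =
    find (pred1 c) (iota 0 W).
  apply: eq_in_find => i; rewrite mem_iota add0n => /andP[_ Hi].
  by rewrite /choice_interp fname_mod ?vecK //; exact: kind_choice_lt.
apply/eqP; rewrite find_iota_eq //= eqxx implybT andbT.
by apply/hasPn => i; rewrite mem_iota add0n => /andP[_ Hi] /=; rewrite neq_ltn Hi.
Qed.

Definition agrees (I : interp) (ch : choices M) : Prop :=
  forall k t, t < 2 ^ m -> chI I k t = ch k t.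

Lemma agrees_override I ch k G (c0 : nat -> 'I_W.+1) : agrees I ch ->
  (forall t, t < 2 ^ m -> Jidx M em x G k (vec m t) = c0 t) ->
  agrees (override I (keysG M em x k) G) (upd_ch ch k c0).
Proof.
move=> HI HG k' t Ht; apply: val_inj; rewrite /= chIE Jidx_override_choice /upd_ch.
by case: eqP => _; [exact: HG|rewrite -HI // chIE].
Qed.

(** Moves are translated both ways: an interpretation determines indices by [chI], and indices are
    realized by [choice_interp]. Agreement below [2 ^ m] suffices, as the outcome reads only times
    below [D]. *)
Lemma game_link P I ch b q :
  (forall J, P J <-> outcome (chI J) D 0 (ainit M x) k0) -> agrees I ch ->
  qsem (game_quants M em x b q) P I <->
  game (2 * q) (2 * b) ch (fun ch => outcome ch D 0 (ainit M x) k0).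
Proof.
move=> HP; elim: q b I ch => [|q IH] b I ch HI.
  rewrite /= HP (outcome_ext (ch2 := ch)) // => k s Hs; apply: HI; lia.
have -> : game_quants M em x b q.+1 = quants true (keysG M em x (2 * b)) ++
   quants false (keysG M em x (2 * b + 1)) ++ game_quants M em x b.+1 q.
  by rewrite /game_quants /= -catA.
rewrite !qsem_cat qsem_exists.
have -> : 2 * q.+1 = (2 * q).+2 by lia.
have Hodd : odd (2 * b) = false by rewrite mul2n odd_double.
rewrite /= Hodd /=.
have Hex k0' J ch' c0 : agrees J ch' -> agrees (override J (keysG M em x k0') (choice_interp c0)) (upd_ch ch' k0' c0).
  by move=> HJ; apply: agrees_override => // t Ht; rewrite Jidx_choice_interp.
have Hfrom k0' J ch' G : agrees J ch' -> agrees (override J (keysG M em x k0') G)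
    (upd_ch ch' k0' (fun t => chI G k0' t)).
  by move=> HJ; apply: agrees_override => // t Ht; rewrite chIE.
have E1 : (2 * b).+1 = 2 * b + 1 by lia.
have E2 : (2 * b + 1).+1 = 2 * b.+1 by lia.
rewrite E1 E2; split=> [[G]|[c0 H]].
  rewrite qsem_cat qsem_forall => H; exists (chI G (2 * b)) => c1.
  apply/(IH b.+1); last exact: (H (choice_interp c1)).
  by apply: Hex; exact: Hfrom.
exists (choice_interp c0); rewrite qsem_cat qsem_forall => G1.
apply/(IH b.+1); last exact: (H (chI G1 (2 * b + 1))).
by apply: Hfrom; exact: Hex.
Qed.

Hypothesis Hparity : k0 = (if @akind M (astart M) is KUn then 1 else 0).
Hypothesis HrR : r < 2 * R.

Lemma game_start ch :
  game (2 * R) 0 ch (fun ch => outcome ch D 0 (ainit M x) k0) <-> accepts_in D (ainit M x).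
Proof.
have Hb : block_kind (ainit M x) k0.
  by rewrite Hparity /block_kind /akind_of /=; case: akind.
have [E|E] : k0 = 0 \/ k0 = 1 by rewrite Hparity; case: akind; [left|right|left|left].
  by rewrite E in Hb *; apply: game_accepts Hb Hhalt Halt _; exact: ltnW.
have -> : 2 * R = (2 * R).-1.+1 by lia.
rewrite E in Hb * => /=; split=> [[c0 H]|H].
  by apply/(game_accepts (j := (2 * R).-1) 0 (upd_ch ch 0 c0) Hb Hhalt Halt); [lia|].
(* A run that starts in block 1 never reads block 0, so any move serves. *)
exists (ch 0); apply/(game_accepts (j := (2 * R).-1) 0 (upd_ch ch 0 (ch 0)) Hb Hhalt Halt) => //; lia.
Qed.

Lemma formula_accepts :
  qeval I0 (prenex_qbsf false (quants_of x (prefix_gen M em eR) [:: n]) cs) <->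
  accepts_in D (ainit M x).
Proof.
rewrite qeval_prenexP; last by have /andP[] := formula_wf M em1 eR1 false Hk0.
rewrite quants_of_prefix // qsem_cat.
rewrite (@game_link _ _ (chI I0) 0 R) ?game_start //.
move=> J; rewrite -tableau_outcome qsem_cat qsem_exists.
split=> -[G H]; exists G; first by move=> G'; have /qsem_forall := H; exact.
by apply/qsem_forall => G'; exact: H.
Qed.

End Correctness.

(** * Exchanging the players, and the reduction *)

Local Arguments akind_of : simpl never.

Definition dual_kind (k : skind) : skind :=
  match k with KEx => KUn | KUn => KEx | KAcc => KRej | KRej => KAcc end.

Definition dual_ATM (M : ATM) : ATM :=
  @Build_ATM (aSt M) (aSym M) (ablank M) (ainput M) (astart M)
    (fun q => dual_kind (@akind M q)) (@adelta M).

Lemma akind_of_dual M (c : aconf M) : @akind_of (dual_ATM M) c = dual_kind (akind_of c).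
Proof. by []. Qed.

Lemma is_halting_dual k : is_halting (dual_kind k) = is_halting k.
Proof. by case: k. Qed.

Lemma halts_within_dual M d (c : aconf M) :
  halts_within d c -> @halts_within (dual_ATM M) d c.
Proof.
elim: d c => [|d IH] c /=; rewrite akind_of_dual is_halting_dual; case: ifP => // _ H c' Hc'.
by apply: IH; exact: H.
Qed.

Lemma alt_ok_dual M d r prev (c : aconf M) :
  alt_ok d r prev c -> @alt_ok (dual_ATM M) d r (omap dual_kind prev) c.
Proof.
have Hs p k : skind_eqb (dual_kind p) (dual_kind k) = skind_eqb p k by case: p; case: k.
elim: d r prev c => [|d IH] r prev c /=; rewrite akind_of_dual is_halting_dual; case: ifP => // _;
  case: prev => [p|] /= [H1 H2]; rewrite ?Hs; split=> // c' Hc'; exact: IH (H2 _ Hc').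
Qed.

(** Negation exchanges the two kinds of branching; obtaining a rejecting successor from a failed
    universal step is the classical part. *)
Lemma accepts_in_dual M d (c : aconf M) : halts_within d c ->
  @accepts_in (dual_ATM M) d c <-> ~ accepts_in d c.
Proof.
elim: d c => [|d IH] c /=; rewrite akind_of_dual; case: (akind_of c) => //= Hh.
- by tauto.
- split=> [H [c' Hc' Ha]|H c' Hc'].
    by have /(IH _ (Hh _ Hc')) := H c' Hc'; apply.
  by apply/(IH _ (Hh _ Hc')) => Ha; apply: H; exists c'.
- split=> [[c' Hc' /(IH _ (Hh _ Hc')) H1] H2|H]; first exact: H1 (H2 _ Hc').
  apply: NNPP => Hn; apply: H => c' Hc'; apply: NNPP => Ha; apply: Hn.
  by exists c' => //; apply/(IH _ (Hh _ Hc')).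
- by tauto.
Qed.

Fixpoint epow (k : nat) : expr := if k is k'.+1 then EMul (EVar 0) (epow k') else EConst 1.
Definition epoly (k c : nat) : expr := EAdd (EAdd (EMul (EConst k) (epow k)) (EConst k)) (EConst c).

Lemma ev_epow k n : ev (epow k) [:: n] = n ^ k.
Proof. by elim: k => //= k ->; rewrite expnS. Qed.
Lemma ev_epoly k c n : ev (epoly k c) [:: n] = k * n ^ k + k + c.
Proof. by rewrite /= ev_epow. Qed.
Lemma evars_epoly k c : evars 1 (epoly k c).
Proof. by rewrite /= !andbT; elim: k. Qed.

(** Both summands are at most [2 ^ C * 2 ^ e]; two further bits make the bound on their sum
    strict. *)
Lemma time_bound C t e : t <= 2 ^ e -> C * t + C < 2 ^ (e + C.+2).
Proof.
move=> Ht; have HC := ltn_expl C (isT : 1 < 2); have He : 0 < 2 ^ e by rewrite expn_gt0.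
have : C * t + C <= 2 ^ C * 2 ^ e + 2 ^ C * 2 ^ e by nia.
have : 0 < 2 ^ C * 2 ^ e by rewrite muln_gt0 !expn_gt0.
by rewrite addnC expnD !expnS; nia.
Qed.

Lemma hard_for_qbsf (dual : bool) (L : language) (form : qbsf -> Prop) :
  (forall qs cs, form (prenex_qbsf dual qs cs)) -> AEXP_poly L ->
  logspace_reduces L (fun w => exists phi, enc phi = w /\ form phi /\ in_QBSF phi).
Proof.
move=> Hform [t [p [[kt Ht] [[kp Hp] [M0 [HM0 [C HC]]]]]]].
pose M := if dual then dual_ATM M0 else M0.
pose k0 := if @akind M (astart M) is KUn then 1 else 0.
(* [C.+2] additional bits absorb the constants of the running time. The additional 1 puts
   [p (size x)] below the number of rounds, which leaves room for an unread block 0. *)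
pose em := epoly kt C.+2; pose eR := epoly kp 1.
pose F x := prenex_qbsf dual (quants_of x (prefix_gen M em eR) [:: size x])
  (clauses_of x (matrix_gen M em eR k0) [:: size x]).
have em1 : evars 1 em := evars_epoly _ _; have eR1 : evars 1 eR := evars_epoly _ _.
exists (fun x => enc (F x)); split.
  by apply: prenex_logspace; [exact: prefix_scoped|exact: matrix_scoped].
have Hk0 : k0 <= 1 by rewrite /k0; case: akind.
move=> x; have [Hh Ha HL] := HC x; set D := _ + C in Hh Ha HL.
have Em : ev em [:: size x] = kt * size x ^ kt + kt + C.+2 := ev_epoly _ _ _.
have ER : ev eR [:: size x] = kp * size x ^ kp + kp + 1 := ev_epoly _ _ _.
have Hps := Hp (size x).
have HK : k0 <= 2 * ev eR [:: size x] by rewrite ER; lia.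
have HwF : qwf (F x) && qclosed [::] (F x) by exact: formula_wf.
have /andP[Hw _] := HwF.
have HF : in_QBSF (F x) = qeval I0 (F x) by rewrite /in_QBSF andbA HwF.
suff HE : L x <-> qeval I0 (F x).
  rewrite HE -HF; split=> [H|[phi [E [_ H]]]].
    by exists (F x); split=> //; split=> //; exact: Hform.
  (* Membership of the output gives some formula with this code; unique readability identifies it
     with the constructed one. *)
  have /and3P[Hw' _ _] := H.
  have [<- //] : phi = F x /\ [::] = [::] :> seq bool.
  by apply: enc_inj => //; rewrite E.
have Hacc : @halts_within M D (ainit M x) -> @alt_ok M D (p (size x)) None (ainit M x) ->
   qeval I0 (prenex_qbsf false (quants_of x (prefix_gen M em eR) [:: size x])
     (clauses_of x (matrix_gen M em eR k0) [:: size x])) <-> @accepts_in M D (ainit M x).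
  move=> Hh' Ha'; apply: (@formula_accepts M em eR k0 x em1 eR1 _ HK D (p (size x))) => //.
  - by rewrite Em; lia.
  - by rewrite Em; apply: time_bound; exact: Ht.
  - by rewrite ER; lia.
  - by rewrite /M; case: (dual) => /=; rewrite HM0.
  - by rewrite ER; lia.
rewrite HL; clear -Hacc Hh Ha; rewrite /F; move: Hacc; rewrite /k0 {F k0}.
rewrite {}/M; case: dual => Hacc; last by rewrite Hacc.
have {}Hacc := Hacc (halts_within_dual Hh) (alt_ok_dual Ha).
rewrite qeval_dual; have HD := accepts_in_dual Hh; split=> [HA|/negP HA].
  by apply/negP => /Hacc/HD.
by apply: NNPP => Hn; apply: HA; apply/Hacc/HD.
Qed.

Theorem theorem5 :
  logspace_hard_for AEXP_poly QBSF_CNF /\ logspace_hard_for AEXP_poly QBSF_DNF.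
Proof.
split=> L HL.
  exact: hard_for_qbsf prenex_qbsf_CNF HL.
exact: hard_for_qbsf prenex_qbsf_DNF HL.
Qed.
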